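(* Let $\mu\ge1$ and $\alpha>0$. If $$\max_{(R_p,R_c)\in\mathcal{R}_{part,out}^{\alpha}}\mu R_p+R_c=\max_{(R_p,R_c)\in\mathcal{C}_{BC}^{\alpha}}\mu R_p+R_c,$$ then $$\max_{(R_p,R_c)\in\mathcal{R}_{part,out}^{\alpha}}\mu R_p+R_c=\inf_{\Sigma_z}\max_{(R_p,R_c)\in\mathcal{R}_{out}^{\alpha,\Sigma_z}}\mu R_p+R_c,$$ the infimum being over admissible $\Sigma_z$.
   Context: Fixed complex matrices $H_{p,p}\in\mathbb{C}^{n_{p,r}\times n_{p,t}}$, $H_{c,p}\in\mathbb{C}^{n_{p,r}\times n_{c,t}}$, $H_{c,c}\in\mathbb{C}^{n_{c,r}\times n_{c,t}}$, powers $P_p,P_c>0$. For $\alpha>0$ let $G_\alpha=[H_{p,p}\ \ H_{c,p}/\sqrt\alpha]$, $K=[0\ \ H_{c,c}/\sqrt\alpha]$ (the zero block of size $n_{c,r}\times n_{p,t}$), and $\overline K=\begin{pmatrix}H_{p,p}&H_{c,p}/\sqrt\alpha\\0&H_{c,c}/\sqrt\alpha\end{pmatrix}$. $A^\dagger$ is conjugate transpose, $|\cdot|$ determinant. An admissible $\Sigma_z$ is a positive definite matrix of the form $\begin{pmatrix}I_{n_{p,r}}&Q_z\\Q_z^\dagger&I_{n_{c,r}}\end{pmatrix}$. $\mathcal{R}_{out}^{\alpha,\Sigma_z}$ is the closure of the convex hull of the set of $(R_p,R_c)$, $R_p,R_c\ge0$, for which there exist $Q_p,Q_c\succeq0$ (size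 $n_{p,t}+n_{c,t}$) with $\mathrm{Tr}(Q_p)+\mathrm{Tr}(Q_c)\le P_p+\alpha P_c$, $R_p\le\log|I+G_\alpha(Q_p+Q_c)G_\alpha^\dagger|-\log|I+G_\alpha Q_cG_\alpha^\dagger|$, $R_c\le\log|\Sigma_z+\overline KQ_c\overline K^\dagger|-\log|\Sigma_z|$. $\mathcal{R}_{part,out}^{\alpha}$ is the closure of the convex hull of the set of $(R_p,R_c)$, $R_p,R_c\ge0$, for which there exist $Q_p\succeq0$ (size $n_{p,t}+n_{c,t}$) and $\Sigma_{c,c}\succeq0$ (size $n_{c,t}$) with $\mathrm{Tr}(Q_p)+\mathrm{Tr}(\Sigma_{c,c})\le P_p+\alpha P_c$, $R_p\le\log|I+G_\alpha Q_pG_\alpha^\dagger+\tfrac1\alpha H_{c,p}\Sigma_{c,c}H_{c,p}^\dagger|-\log|I+\tfrac1\alpha H_{c,p}\Sigma_{c,c}H_{c,p}^\dagger|$, $R_c\le\log|I+\tfrac1\alpha H_{c,c}\Sigma_{c,c}H_{c,c}^\dagger|$. $\mathcal{C}_{BC}^{\alpha}$ is the capacity region of the two-user Gaussian MIMO broadcast channel with input $X(i)\in\mathbb{C}^{n_{p,t}+n_{c,t}}$, outputs $Y_1(i)=G_\alpha X(i)+Z_1(i)$, $Y_2(i)=KX(i)+Z_2(i)$ with $Z_1,Z_2$ i.i.d. $\mathcal{N}(0,I)$ noise, and power constraint $\sum_{i=1}^n\mathrm{Tr}(\mathrm{Cov}(X(i)))\le n(P_p+\alpha P_c)$ (user 1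 has rate $R_p$, user 2 rate $R_c$). *)

(* Defs.v *)
From HB Require Import structures.
From mathcomp Require Import all_boot all_order all_algebra.
From mathcomp Require Import spectral.
From mathcomp Require Import complex.
From mathcomp Require Import all_classical all_reals all_analysis.

Set Implicit Arguments.
Unset Strict Implicit.
Unset Printing Implicit Defensive.

Import Order.TTheory GRing.Theory Num.Theory Num.Def.
Import numFieldNormedType.Exports.
Local Open Scope classical_set_scope.
Local Open Scope ring_scope.

Definition ctr (R : realType) (m n : nat) (A : 'M[R[i]]_(m, n)) : 'M[R[i]]_(n, m) :=
  (map_mx conjC A)^T.

Definition cR (R : realType) (x : R) : R[i] := Complex x 0.

Definition psd (R : realType) (n : nat) (A : 'M[R[i]]_n) : Prop :=
  ctr A = A /\ forall v : 'cV[R[i]]_n, 0 <= (ctr v *m A *m v) ord0 ord0.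

Definition pd (R : realType) (n : nat) (A : 'M[R[i]]_n) : Prop :=
  ctr A = A /\ forall v : 'cV[R[i]]_n, v != 0 -> 0 < (ctr v *m A *m v) ord0 ord0.

(* log |A| for a Hermitian positive definite A (whose determinant is real > 0) *)
Definition logdet (R : realType) (n : nat) (A : 'M[R[i]]_n) : R :=
  ln (complex.Re (\det A)).

(* Tr(A) (real part; the trace of a Hermitian matrix is real) *)
Definition rtrace (R : realType) (n : nat) (A : 'M[R[i]]_n) : R :=
  complex.Re (\tr A).

Definition convex_hull2 (R : realType) (A : set (R * R)) : set (R * R) :=
  [set p | exists (k : nat) (w : 'I_k -> R) (x : 'I_k -> R * R),
      (forall j, 0 <= w j) /\ \sum_(j < k) w j = 1 /\ (forall j, A (x j)) /\
      p = (\sum_(j < k) w j * (x j).1, \sum_(j < k) w j * (x j).2)].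

Definition cl_hull (R : realType) (A : set (R * R)) : set (R * R) :=
  closure (convex_hull2 A).

Definition wmax (R : realType) (mu : R) (S : set (R * R)) : \bar R :=
  ereal_sup [set ((mu * p.1 + p.2)%:E) | p in S].

Definition isq (R : realType) (alpha : R) : R[i] := cR (Num.sqrt alpha)^-1.

Definition Gmx (R : realType) (npt nct npr : nat) (alpha : R)
  (Hpp : 'M[R[i]]_(npr, npt)) (Hcp : 'M[R[i]]_(npr, nct)) :
  'M[R[i]]_(npr, npt + nct) := row_mx Hpp (isq alpha *: Hcp).

Definition Kmx (R : realType) (npt nct ncr : nat) (alpha : R)
  (Hcc : 'M[R[i]]_(ncr, nct)) : 'M[R[i]]_(ncr, npt + nct) :=
  row_mx 0 (isq alpha *: Hcc).

Definition Kbarmx (R : realType) (npt nct npr ncr : nat) (alpha : R)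
  (Hpp : 'M[R[i]]_(npr, npt)) (Hcp : 'M[R[i]]_(npr, nct))
  (Hcc : 'M[R[i]]_(ncr, nct)) : 'M[R[i]]_(npr + ncr, npt + nct) :=
  col_mx (Gmx alpha Hpp Hcp) (Kmx npt alpha Hcc).

Definition Sigmaz (R : realType) (npr ncr : nat) (Qz : 'M[R[i]]_(npr, ncr)) :
  'M[R[i]]_(npr + ncr) := block_mx 1%:M Qz (ctr Qz) 1%:M.

Definition admissible (R : realType) (npr ncr : nat) (Qz : 'M[R[i]]_(npr, ncr)) : Prop :=
  pd (Sigmaz Qz).

Definition Rout (R : realType) (npt nct npr ncr : nat)
  (Hpp : 'M[R[i]]_(npr, npt)) (Hcp : 'M[R[i]]_(npr, nct)) (Hcc : 'M[R[i]]_(ncr, nct))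
  (Pp Pc alpha : R) (Qz : 'M[R[i]]_(npr, ncr)) : set (R * R) :=
  let G := Gmx alpha Hpp Hcp in
  let Kb := Kbarmx alpha Hpp Hcp Hcc in
  let Sz := Sigmaz Qz in
  cl_hull [set p | 0 <= p.1 /\ 0 <= p.2 /\
    exists Qp Qc : 'M[R[i]]_(npt + nct),
      psd Qp /\ psd Qc /\ rtrace Qp + rtrace Qc <= Pp + alpha * Pc /\
      p.1 <= logdet (1%:M + G *m (Qp + Qc) *m ctr G) - logdet (1%:M + G *m Qc *m ctr G) /\
      p.2 <= logdet (Sz + Kb *m Qc *m ctr Kb) - logdet Sz].

Definition Rpartout (R : realType) (npt nct npr ncr : nat)
  (Hpp : 'M[R[i]]_(npr, npt)) (Hcp : 'M[R[i]]_(npr, nct)) (Hcc : 'M[R[i]]_(ncr, nct))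
  (Pp Pc alpha : R) : set (R * R) :=
  let G := Gmx alpha Hpp Hcp in
  let a := cR alpha^-1 in
  cl_hull [set p | 0 <= p.1 /\ 0 <= p.2 /\
    exists (Qp : 'M[R[i]]_(npt + nct)) (Scc : 'M[R[i]]_nct),
      psd Qp /\ psd Scc /\ rtrace Qp + rtrace Scc <= Pp + alpha * Pc /\
      p.1 <= logdet (1%:M + G *m Qp *m ctr G + a *: (Hcp *m Scc *m ctr Hcp))
             - logdet (1%:M + a *: (Hcp *m Scc *m ctr Hcp)) /\
      p.2 <= logdet (1%:M + a *: (Hcc *m Scc *m ctr Hcc))].

(* A noise realisation over n channel uses at a receiver with r antennas
   is a tuple of (n*r)*2 reals: real and imaginary parts of Z(i)_j. *)
Definition noise_seq (R : realType) (n r : nat) (z : ((n * r) * 2).-tuple R) :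
  'I_n -> 'cV[R[i]]_r :=
  fun i => \col_j Complex (tnth z (mxvec_index (mxvec_index i j) ord0))
                          (tnth z (mxvec_index (mxvec_index i j) ord_max)).

(* P is the law of i.i.d. circularly-symmetric CN(0,1) entries, i.e. all
   real coordinates are i.i.d. N(0, 1/2). *)
Definition iid_cgauss (R : realType) (k : nat) (P : probability (k.-tuple R) R) : Prop :=
  forall A : 'I_k -> set R, (forall j, measurable (A j)) ->
    P [set z | forall j, A j (tnth z j)] =
    \big[*%E/1%E]_(j < k) normal_prob 0 (Num.sqrt (2^-1 : R)) (A j).

Definition out_seq (R : realType) (n r nt : nat) (H : 'M[R[i]]_(r, nt))
  (x : 'I_n -> 'cV[R[i]]_nt) (z : ((n * r) * 2).-tuple R) : 'I_n -> 'cV[R[i]]_r :=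
  fun i => H *m x i + noise_seq z i.

Definition dec_measurable (R : realType) (n r nt M : nat) (H : 'M[R[i]]_(r, nt))
  (X : set ('I_n -> 'cV[R[i]]_nt)) (dec : ('I_n -> 'cV[R[i]]_r) -> 'I_M) : Prop :=
  forall x, X x -> forall m : 'I_M,
    measurable [set z : ((n * r) * 2).-tuple R | dec (out_seq H x z) = m].

Definition err_prob (R : realType) (n r nt M1 M2 M : nat) (H : 'M[R[i]]_(r, nt))
  (enc : 'I_M1 -> 'I_M2 -> 'I_n -> 'cV[R[i]]_nt)
  (dec : ('I_n -> 'cV[R[i]]_r) -> 'I_M) (msg : 'I_M1 -> 'I_M2 -> 'I_M)
  (P : probability (((n * r) * 2).-tuple R) R) : \bar R :=
  ((M1 * M2)%:R^-1)%:E *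
  (\sum_(m1 < M1) \sum_(m2 < M2)
     P [set z | dec (out_seq H (enc m1 m2) z) != msg m1 m2])%E.

Definition power_ok (R : realType) (n nt M1 M2 : nat)
  (enc : 'I_M1 -> 'I_M2 -> 'I_n -> 'cV[R[i]]_nt) (Pw : R) : Prop :=
  let c := cR (M1 * M2)%:R^-1 in
  let mean i := c *: \sum_(m1 < M1) \sum_(m2 < M2) enc m1 m2 i in
  let cov i := c *: (\sum_(m1 < M1) \sum_(m2 < M2) (enc m1 m2 i *m ctr (enc m1 m2 i)))
               - mean i *m ctr (mean i) in
  \sum_(i < n) rtrace (cov i) <= n%:R * Pw.

Definition bc_achievable (R : realType) (nt r1 r2 : nat)
  (G : 'M[R[i]]_(r1, nt)) (K : 'M[R[i]]_(r2, nt)) (Pw : R) : set (R * R) :=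
  [set p | 0 <= p.1 /\ 0 <= p.2 /\
   forall eps : R, 0 < eps -> exists N : nat, forall n : nat, (N <= n)%N -> (0 < n)%N ->
   exists (M1 M2 : nat) (enc : 'I_M1 -> 'I_M2 -> 'I_n -> 'cV[R[i]]_nt)
          (dec1 : ('I_n -> 'cV[R[i]]_r1) -> 'I_M1)
          (dec2 : ('I_n -> 'cV[R[i]]_r2) -> 'I_M2),
     [/\ (0 < M1)%N /\ (0 < M2)%N,
         n%:R * (p.1 - eps) <= ln (M1%:R : R) /\
         n%:R * (p.2 - eps) <= ln (M2%:R : R),
         power_ok enc Pw,
         dec_measurable G [set x | exists m1 m2, x = enc m1 m2] dec1 /\
         dec_measurable K [set x | exists m1 m2, x = enc m1 m2] dec2 &
         forall (P1 : probability (((n * r1) * 2).-tuple R) R)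
                (P2 : probability (((n * r2) * 2).-tuple R) R),
           iid_cgauss P1 -> iid_cgauss P2 ->
           (err_prob G enc dec1 (fun m1 _ => m1) P1 <= eps%:E)%E /\
           (err_prob K enc dec2 (fun _ m2 => m2) P2 <= eps%:E)%E]].

Definition CBC (R : realType) (npt nct npr ncr : nat)
  (Hpp : 'M[R[i]]_(npr, npt)) (Hcp : 'M[R[i]]_(npr, nct)) (Hcc : 'M[R[i]]_(ncr, nct))
  (Pp Pc alpha : R) : set (R * R) :=
  closure (bc_achievable (Gmx alpha Hpp Hcp) (Kmx npt alpha Hcc) (Pp + alpha * Pc)).

(* Main.v *)
(** Let phi be the maximum of (mu - 1) log|1 + G^* P1 G| + log|1 + G^* P1 G + K^* P2 K| over
    psd P1, P2 with trace P1 + trace P2 <= P (the dual multiple-access channel), attained with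
    multiplier lam, and let T be the inverse of the last matrix.

    Data processing bounds the partial region by every outer region.  For s < 1 the noise
    correlation Qz = (s / lam) G T K^* is admissible by the KKT conditions, and concavity of
    log-determinants then bounds mu Rp + Rc by phi - (npt + nct) ln s on the outer region; so
    the infimum is at most phi.  The KKT conditions also turn (P1, P2) into broadcast
    covariances Qp, Qc of the same weighted rate phi.  Dirty-paper coding achieves these
    rates, so phi is at most the maximum over the capacity region, which the hypothesis
    identifies with the maximum over the partial region.

    Achievability: x = Lp a + Lc g with a and g typical words over a fine finite lattice;
    user 2 is sent u = g + (W2 K Lp a rounded to the lattice), chosen in a random bin.  Both
    receivers test sum |v - W y|^2 / e against the MMSE error variances e.  Wrong words pass
    rarely because theta series count the lattice words in an ellipsoid uniformly in its
    centre, and right words pass because of empirical second moments and Chebyshev. *)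

(* The weighted broadcast rate is not concave in (Qp, Qc); the dual objective is, since mu >= 1
   makes it a nonnegative combination of log-determinants of affine matrices. Its first-order
   conditions are obtained without derivatives, by comparing log-determinants along segments. At s =
   1 the noise correlation they suggest may give a singular Sigma_z; s < 1 restores positive
   definiteness, and the price -(npt + nct) ln s vanishes as s tends to 1. The quotient s / lam
   needs lam > 0; lam = 0 forces G = K = 0, a case settled apart.

   Achievability fixes the code before it quantifies over the noise laws satisfying [iid_cgauss], so
   that law has to be shown unique. Codewords come from finite sets, which turns random coding into
   averages of finite sums; only the noise is integrated. Typicality refers to empirical second
   moments alone, so that moments up to the fourth suffice and error probabilities decay like
   1/n. *)
Require Import Defs.
From HB Require Import structures.
From mathcomp Require Import all_boot all_order all_algebra.
From mathcomp Require Import spectral.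
From mathcomp Require Import complex.
From mathcomp Require Import all_classical all_reals all_analysis.
From mathcomp Require Import measurable_realfun.
From mathcomp Require Import ring lra.
Import Order.TTheory GRing.Theory Num.Theory.
Import numFieldNormedType.Exports HBSimple HBNNSimple.
Local Open Scope classical_set_scope.
Local Open Scope ring_scope.

Set Implicit Arguments.
Unset Strict Implicit.
Unset Printing Implicit Defensive.

(** * Positive matrices and log-determinants *)

Section ConjugateTranspose.
Variable R : realType.
Local Notation C := R[i].

Lemma cRE (x : R) : cR x = (x%:C)%C. Proof. by []. Qed.

Lemma cR_ge0 (x : R) : (0 <= cR x) = (0 <= x). Proof. exact: ler0c. Qed.

Lemma cR_gt0 (x : R) : (0 < cR x) = (0 < x). Proof. exact: (ltcR 0 x). Qed.

Lemma ReD (x y : C) : complex.Re (x + y) = complex.Re x + complex.Re y.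
Proof. by case: x => ? ?; case: y. Qed.

Lemma ReN (x : C) : complex.Re (- x) = - complex.Re x.
Proof. by case: x. Qed.

Lemma Re_sum (I : Type) (r : seq I) (P : pred I) (F : I -> C) :
  complex.Re (\sum_(i <- r | P i) F i) = \sum_(i <- r | P i) complex.Re (F i).
Proof. exact: (big_morph _ ReD erefl). Qed.

Lemma Re_cRM (x : R) (y : C) : complex.Re (cR x * y) = x * complex.Re y.
Proof. by case: y => a b; rewrite /= mul0r subr0. Qed.

Lemma Re_ge0 (x : C) : 0 <= x -> 0 <= complex.Re x.
Proof. by rewrite lecE => /andP[]. Qed.

Lemma Re_gt0 (x : C) : 0 < x -> 0 < complex.Re x.
Proof. by rewrite ltcE => /andP[]. Qed.

Lemma ge0_cR_Re (x : C) : 0 <= x -> x = cR (complex.Re x).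
Proof. by case: x => a b; rewrite lecE /= => /andP[/eqP-> _]. Qed.

Lemma conj_cR (x : R) : (cR x)^* = cR x.
Proof. exact: (conjc_real x). Qed.

Lemma conjE (x : C) : x^* = conjc x. Proof. by []. Qed.

Lemma ctrE m n (A : 'M[C]_(m, n)) i j : ctr A i j = (A j i)^*.
Proof. by rewrite !mxE. Qed.

Lemma ctrK m n (A : 'M[C]_(m, n)) : ctr (ctr A) = A.
Proof. by apply/matrixP => i j; rewrite !ctrE conjCK. Qed.

Lemma ctrM m n p (A : 'M[C]_(m, n)) (B : 'M[C]_(n, p)) :
  ctr (A *m B) = ctr B *m ctr A.
Proof. by rewrite /ctr map_mxM trmx_mul. Qed.

Lemma ctrD m n (A B : 'M[C]_(m, n)) : ctr (A + B) = ctr A + ctr B.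
Proof. by rewrite /ctr map_mxD linearD. Qed.

Lemma ctrN m n (A : 'M[C]_(m, n)) : ctr (- A) = - ctr A.
Proof. by rewrite /ctr map_mxN linearN. Qed.

Lemma ctrB m n (A B : 'M[C]_(m, n)) : ctr (A - B) = ctr A - ctr B.
Proof. by rewrite ctrD ctrN. Qed.

Lemma ctrZ m n (c : C) (A : 'M[C]_(m, n)) : ctr (c *: A) = c^* *: ctr A.
Proof. by rewrite /ctr map_mxZ linearZ. Qed.

Lemma ctrZr m n (c : R) (A : 'M[C]_(m, n)) : ctr (cR c *: A) = cR c *: ctr A.
Proof. by rewrite ctrZ conj_cR. Qed.

Lemma ctr0 m n : ctr (0 : 'M[C]_(m, n)) = 0.
Proof. by rewrite /ctr map_mx0 linear0. Qed.

Lemma ctr1 n : ctr (1%:M : 'M[C]_n) = 1%:M.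
Proof. by rewrite /ctr map_mx1 trmx1. Qed.

Lemma ctr_inv n (A : 'M[C]_n) : ctr (invmx A) = invmx (ctr A).
Proof. by rewrite /ctr map_invmx trmx_inv. Qed.

Lemma ctr_unit n (A : 'M[C]_n) : (ctr A \in unitmx) = (A \in unitmx).
Proof. by rewrite /ctr unitmx_tr map_unitmx. Qed.

Lemma ctr_row_mx m n1 n2 (A : 'M[C]_(m, n1)) (B : 'M[C]_(m, n2)) :
  ctr (row_mx A B) = col_mx (ctr A) (ctr B).
Proof. by rewrite /ctr map_row_mx tr_row_mx. Qed.

Lemma ctr_col_mx m1 m2 n (A : 'M[C]_(m1, n)) (B : 'M[C]_(m2, n)) :
  ctr (col_mx A B) = row_mx (ctr A) (ctr B).
Proof. by rewrite /ctr map_col_mx tr_col_mx. Qed.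

Lemma det_ctr n (A : 'M[C]_n) : \det (ctr A) = (\det A)^*.
Proof. by rewrite /ctr det_tr det_map_mx. Qed.

(** Two block matrices of which one is unitriangular have a block triangular product in either
    order; one order exhibits 1 + B A, the other 1 + A B. *)
Lemma det_sylvester m n (A : 'M[C]_(m, n)) (B : 'M[C]_(n, m)) :
  \det (1%:M + A *m B) = \det (1%:M + B *m A).
Proof.
have e1 : block_mx 1%:M (- A) B 1%:M *m block_mx 1%:M A 0 1%:M =
    block_mx 1%:M 0 B (1%:M + B *m A).
  by rewrite mulmx_block !mul1mx !mulmx1 !mulmx0 !addr0 subrr addrC.
have e2 : block_mx 1%:M A 0 1%:M *m block_mx 1%:M (- A) B 1%:M =
    block_mx (1%:M + A *m B) 0 B 1%:M.
  by rewrite mulmx_block !mul1mx !mulmx1 !mul0mx !add0r addNr.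
have := congr1 (fun M => \det M) e1; have := congr1 (fun M => \det M) e2.
by rewrite !det_mulmx !det_lblock det_ublock !det1 !mul1r !mulr1 => <- <-.
Qed.

End ConjugateTranspose.

Section PositiveMatrices.
Variable R : realType.
Local Notation C := R[i].

Definition quad n (A : 'M[C]_n) (v : 'cV[C]_n) : C := (ctr v *m A *m v) ord0 ord0.

Lemma quadD n (A B : 'M[C]_n) v : quad (A + B) v = quad A v + quad B v.
Proof. by rewrite /quad mulmxDr mulmxDl mxE. Qed.

Lemma quadN n (A : 'M[C]_n) v : quad (- A) v = - quad A v.
Proof. by rewrite /quad mulmxN mulNmx mxE. Qed.

Lemma quadZ n (c : C) (A : 'M[C]_n) v : quad (c *: A) v = c * quad A v.
Proof. by rewrite /quad -scalemxAr -scalemxAl mxE. Qed.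

Lemma quad_conj m n (A : 'M[C]_n) (B : 'M[C]_(m, n)) v :
  quad (B *m A *m ctr B) v = quad A (ctr B *m v).
Proof. by rewrite /quad ctrM ctrK !mulmxA. Qed.

Lemma quad1E n (v : 'cV[C]_n) : quad 1%:M v = \sum_i `|v i 0| ^+ 2.
Proof.
rewrite /quad mulmx1 mxE; apply: eq_bigr => i _.
by rewrite ctrE normCK mulrC.
Qed.

Lemma quad1_gt0 n (v : 'cV[C]_n) : v != 0 -> 0 < quad 1%:M v.
Proof.
move=> vN0; rewrite quad1E lt0r sumr_ge0 ?andbT; last by move=> i _; rewrite exprn_ge0.
apply: contra vN0 => /eqP/psumr_eq0P H; apply/eqP/colP => i.
have /eqP := H (fun j _ => exprn_ge0 2 (normr_ge0 (v j 0))) i isT.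
by rewrite expf_eq0 normr_eq0 mxE => /eqP.
Qed.

Lemma psdP n (A : 'M[C]_n) : psd A <-> ctr A = A /\ forall v, 0 <= quad A v.
Proof. by []. Qed.

Lemma pdP n (A : 'M[C]_n) :
  pd A <-> ctr A = A /\ forall v, v != 0 -> 0 < quad A v.
Proof. by []. Qed.

Lemma pd_psd n (A : 'M[C]_n) : pd A -> psd A.
Proof.
move=> [hA pA]; split=> // v; have [->|vN0] := eqVneq v 0.
  by rewrite mulmx0 mxE.
exact/ltW/pA.
Qed.

Lemma psdD n (A B : 'M[C]_n) : psd A -> psd B -> psd (A + B).
Proof.
move=> /psdP[hA pA] /psdP[hB pB]; apply/psdP; split; first by rewrite ctrD hA hB.
by move=> v; rewrite quadD addr_ge0.
Qed.

Lemma pdD n (A B : 'M[C]_n) : pd A -> psd B -> pd (A + B).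
Proof.
move=> /pdP[hA pA] /psdP[hB pB]; apply/pdP; split; first by rewrite ctrD hA hB.
by move=> v vN0; rewrite quadD ltr_pwDl ?pA.
Qed.

Lemma psdZ n (c : R) (A : 'M[C]_n) : 0 <= c -> psd A -> psd (cR c *: A).
Proof.
move=> c0 /psdP[hA pA]; apply/psdP; split; first by rewrite ctrZr hA.
by move=> v; rewrite quadZ mulr_ge0 ?cR_ge0.
Qed.

Lemma pdZ n (c : R) (A : 'M[C]_n) : 0 < c -> pd A -> pd (cR c *: A).
Proof.
move=> c0 /pdP[hA pA]; apply/pdP; split; first by rewrite ctrZr hA.
by move=> v v0; rewrite quadZ mulr_gt0 ?cR_gt0 ?pA.
Qed.

Lemma psd_conj m n (A : 'M[C]_n) (B : 'M[C]_(m, n)) :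
  psd A -> psd (B *m A *m ctr B).
Proof.
move=> /psdP[hA pA]; apply/psdP; split; first by rewrite !ctrM ctrK hA mulmxA.
by move=> v; rewrite quad_conj.
Qed.

Lemma pd1 n : pd (1%:M : 'M[C]_n).
Proof. by apply/pdP; split; [exact: ctr1 | exact: quad1_gt0]. Qed.

Lemma psd1 n : psd (1%:M : 'M[C]_n). Proof. exact/pd_psd/pd1. Qed.

Lemma psd0 n : psd (0 : 'M[C]_n).
Proof.
by apply/psdP; split; [exact: ctr0 | move=> v; rewrite /quad mulmx0 mul0mx mxE].
Qed.

Lemma psd_gram m n (B : 'M[C]_(m, n)) : psd (B *m ctr B).
Proof. by have := psd_conj B (psd1 n); rewrite mulmx1. Qed.

Lemma pd_unit n (A : 'M[C]_n) : pd A -> A \in unitmx.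
Proof.
move=> /pdP[hA pA]; rewrite -row_free_unit -kermx_eq0; apply/negPn/negP => K0.
have /rowV0Pn[v /sub_kermxP vA v0] := K0.
have : ctr v != 0 by apply: contra v0 => /eqP e; rewrite -[v]ctrK e ctr0.
by move=> /pA; rewrite /quad ctrK vA mul0mx mxE ltxx.
Qed.

Lemma pd_conj n (A B : 'M[C]_n) : pd A -> B \in unitmx -> pd (B *m A *m ctr B).
Proof.
move=> /pdP[hA pA] uB; apply/pdP; split; first by rewrite !ctrM ctrK hA mulmxA.
move=> v v0; rewrite quad_conj pA //; apply: contra v0 => /eqP e.
by rewrite -[v](@mulKmx _ _ _ (ctr B)) ?ctr_unit // e mulmx0.
Qed.

Lemma pd_inv n (A : 'M[C]_n) : pd A -> pd (invmx A).
Proof.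
move=> pA; have uA := pd_unit pA; have [hA _] := pA.
have -> : invmx A = invmx A *m A *m ctr (invmx A).
  by rewrite ctr_inv hA mulVmx // mul1mx.
by apply: pd_conj => //; rewrite unitmx_inv.
Qed.

Lemma psd_spectral n (A : 'M[C]_n) : psd A -> exists (U : 'M[C]_n) (d : 'I_n -> R),
  [/\ U *m ctr U = 1%:M, ctr U *m U = 1%:M, forall i, 0 <= d i &
      A = U *m diag_mx (\row_i cR (d i)) *m ctr U].
Proof.
move=> /psdP[hA pA].
have trE m (B : 'M[C]_m) : map_mx Num.conj B^T = ctr B by rewrite /ctr map_trmx.
have An : A \is normalmx by apply/normalmxP; rewrite trE hA.
have /orthomx_spectralP := An.
set S := spectralmx A; set D := spectral_diag A.
have Su : S \is unitarymx by exact: spectral_unitarymx.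
rewrite invmx_unitary // trE => AE.
have SS : S *m ctr S = 1%:M by move/unitarymxP: Su; rewrite trE.
have SS' : ctr S *m S = 1%:M by exact: mulmx1C.
have DE : diag_mx D = S *m A *m ctr S.
  by rewrite AE !mulmxA SS mul1mx -mulmxA SS mulmx1.
have D0 i : 0 <= D 0 i.
  have := pA (ctr S *m delta_mx i 0); rewrite -quad_conj -DE.
  rewrite /quad /ctr map_delta_mx trmx_delta -rowE -colE !mxE.
  by rewrite (eqxx i) mulr1n.
exists (ctr S), (fun i => complex.Re (D 0 i)).
split; [by rewrite ctrK | by rewrite ctrK | by move=> i; exact: Re_ge0 |].
rewrite ctrK {1}AE; congr (_ *m diag_mx _ *m _); apply/rowP => i.
by rewrite mxE -ge0_cR_Re.
Qed.

End PositiveMatrices.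

Section LogDet.
Variable R : realType.
Local Notation C := R[i].

Lemma psd_factor n (A : 'M[C]_n) : psd A -> exists L : 'M[C]_n, A = L *m ctr L.
Proof.
move=> /psd_spectral[U [d [_ _ d0 ->]]].
exists (U *m diag_mx (\row_i cR (Num.sqrt (d i)))).
rewrite ctrM !mulmxA -[in RHS](mulmxA U); congr (_ *m _ *m _).
rewrite /ctr map_diag_mx tr_diag_mx mulmx_diag; congr diag_mx.
apply/rowP => i; rewrite !mxE /= conj_cR !cRE -rmorphM /=.
by rewrite -expr2 sqr_sqrtr.
Qed.

Lemma pd_factor n (A : 'M[C]_n) : pd A ->
  exists2 L : 'M[C]_n, L \in unitmx & A = L *m ctr L.
Proof.
move=> pA; have [L AE] := psd_factor (pd_psd pA); exists L => //.
by have := pd_unit pA; rewrite AE unitmx_mul => /andP[].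
Qed.

Lemma det_pd_gt0 n (A : 'M[C]_n) : pd A -> 0 < \det A.
Proof.
move=> /pd_factor[L uL ->]; rewrite det_mulmx det_ctr -normCK exprn_gt0 //.
by rewrite normr_gt0 -unitfE -unitmxE.
Qed.

Lemma det_pd_Re n (A : 'M[C]_n) : pd A -> \det A = cR (complex.Re (\det A)).
Proof. by move/det_pd_gt0/ltW/ge0_cR_Re. Qed.

Lemma Re_det_gt0 n (A : 'M[C]_n) : pd A -> 0 < complex.Re (\det A).
Proof. by move/det_pd_gt0/Re_gt0. Qed.

Lemma logdet_mulE n (A B D : 'M[C]_n) : pd A -> pd B -> pd D ->
  \det A = \det B * \det D -> logdet A = logdet B + logdet D.
Proof.
move=> pA pB pD; rewrite (det_pd_Re pB) (det_pd_Re pD) !cRE -rmorphM /= => e.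
by rewrite /logdet e /= lnM ?posrE ?Re_det_gt0.
Qed.

Lemma logdet1 n : logdet (1%:M : 'M[C]_n) = 0.
Proof. by rewrite /logdet det1 ln1. Qed.

Lemma logdet_inv n (A : 'M[C]_n) : pd A -> logdet (invmx A) = - logdet A.
Proof.
move=> pA; apply/eqP; rewrite -addr_eq0; apply/eqP.
rewrite -(@logdet_mulE _ 1%:M) ?logdet1 //; [exact: pd1|exact: pd_inv|].
by rewrite det_inv det1 mulVr // -unitmxE pd_unit.
Qed.

Lemma logdetZ n (c : R) (A : 'M[C]_n) : 0 < c -> pd A ->
  logdet (cR c *: A) = n%:R * ln c + logdet A.
Proof.
move=> c0 pA; rewrite /logdet detZ (det_pd_Re pA) !cRE -rmorphXn -rmorphM /=.
by rewrite lnM ?posrE ?exprn_gt0 ?Re_det_gt0 // lnXn // mulr_natl.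
Qed.

Lemma rtraceD n (A B : 'M[C]_n) : rtrace (A + B) = rtrace A + rtrace B.
Proof. by rewrite /rtrace mxtraceD ReD. Qed.

Lemma rtraceN n (A : 'M[C]_n) : rtrace (- A) = - rtrace A.
Proof. by rewrite /rtrace raddfN ReN. Qed.

Lemma rtraceB n (A B : 'M[C]_n) : rtrace (A - B) = rtrace A - rtrace B.
Proof. by rewrite rtraceD rtraceN. Qed.

Lemma rtraceZ n (c : R) (A : 'M[C]_n) : rtrace (cR c *: A) = c * rtrace A.
Proof. by rewrite /rtrace mxtraceZ Re_cRM. Qed.

Lemma rtrace1 n : rtrace (1%:M : 'M[C]_n) = n%:R.
Proof. by rewrite /rtrace mxtrace1 -(rmorph_nat (real_complex R)). Qed.

Lemma rtrace0 n : rtrace (0 : 'M[C]_n) = 0.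
Proof. by rewrite /rtrace mxtrace0. Qed.

Lemma rtraceC m n (A : 'M[C]_(m, n)) (B : 'M[C]_(n, m)) :
  rtrace (A *m B) = rtrace (B *m A).
Proof. by rewrite /rtrace mxtrace_mulC. Qed.

Lemma quad_diag n (A : 'M[C]_n) i : quad A (delta_mx i 0) = A i i.
Proof. by rewrite /quad /ctr map_delta_mx trmx_delta -rowE -colE !mxE. Qed.

Lemma psd_diag_ge0 n (A : 'M[C]_n) i : psd A -> 0 <= A i i.
Proof. by move=> /psdP[_ /(_ (delta_mx i 0))]; rewrite quad_diag. Qed.

Lemma rtrace_psd n (A : 'M[C]_n) : psd A -> 0 <= rtrace A.
Proof.
move=> pA; rewrite /rtrace /mxtrace Re_sum sumr_ge0 // => i _.
by rewrite Re_ge0 // psd_diag_ge0.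
Qed.

Lemma rtrace_psdM n (A B : 'M[C]_n) : psd A -> psd B -> 0 <= rtrace (A *m B).
Proof.
move=> pA /psd_factor[L ->]; rewrite mulmxA rtraceC mulmxA.
by have := psd_conj (ctr L) pA; rewrite ctrK => /rtrace_psd.
Qed.

Lemma rtrace_gram m n (A : 'M[C]_(m, n)) :
  rtrace (A *m ctr A) = \sum_i \sum_j complex.Re (`|A i j| ^+ 2).
Proof.
rewrite /rtrace /mxtrace Re_sum; apply: eq_bigr => i _.
by rewrite mxE Re_sum; apply: eq_bigr => j _; rewrite ctrE normCK.
Qed.

Lemma rtrace_gram_eq0 m n (A : 'M[C]_(m, n)) : rtrace (A *m ctr A) = 0 -> A = 0.
Proof.
have p i j : 0 <= `|A i j| ^+ 2 by rewrite exprn_ge0.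
rewrite rtrace_gram => /psumr_eq0P H; apply/matrixP => i j; rewrite mxE.
have Hi : \sum_j complex.Re (`|A i j| ^+ 2) = 0.
  by apply: H => // k _; apply: sumr_ge0 => l _; exact: Re_ge0.
have Hj : complex.Re (`|A i j| ^+ 2) = 0.
  by move/psumr_eq0P: Hi; apply=> // k _; exact: Re_ge0.
apply/eqP; rewrite -normr_eq0; have : `|A i j| ^+ 2 = 0.
  by rewrite (ge0_cR_Re (p i j)) Hj.
by move/eqP; rewrite expf_eq0.
Qed.

(** With A = L L^* and B = M M^* the trace is the squared Frobenius norm of L^* M. This is how
    complementary slackness passes from a scalar equation to a matrix equation. *)
Lemma rtrace_psdM_eq0 n (A B : 'M[C]_n) : psd A -> psd B ->
  rtrace (A *m B) = 0 -> A *m B = 0.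
Proof.
move=> /psd_factor[L ->] /psd_factor[M ->]; set X := ctr L *m M.
have XE : ctr X = ctr M *m L by rewrite ctrM ctrK.
have -> : L *m ctr L *m (M *m ctr M) = L *m (X *m ctr M) by rewrite !mulmxA.
rewrite rtraceC -mulmxA -XE => /rtrace_gram_eq0 ->.
by rewrite mul0mx mulmx0.
Qed.

(** This is ln x <= x - 1 summed over the eigenvalues. *)
Lemma logdet_le_trace n (A : 'M[C]_n) : pd A -> logdet A <= rtrace A - n%:R.
Proof.
move=> pA; have /psd_spectral[U [d [UU UU' d0 AE]]] := pd_psd pA.
have dtE : \det A = cR (\prod_i d i).
  rewrite AE det_mulmx mulrC det_mulmx mulrA -det_mulmx UU' det1 mul1r det_diag.
  by rewrite cRE rmorph_prod; apply: eq_bigr => i _; rewrite mxE.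
have dp i : 0 < d i.
  rewrite lt0r d0 andbT; apply/eqP => di; have := Re_det_gt0 pA.
  by rewrite dtE /= (bigD1 i) //= di mul0r ltxx.
have -> : rtrace A = \sum_i d i.
  rewrite AE rtraceC mulmxA UU' mul1mx /rtrace mxtrace_diag Re_sum.
  by apply: eq_bigr => i _; rewrite mxE.
rewrite /logdet dtE /= ; have -> : n%:R = \sum_(i < n) 1 :> R.
  by rewrite sumr_const card_ord.
rewrite -sumrB.
(* Positivity of the partial products is carried along because [lnM] requires it. *)
have : 0 < \prod_i d i /\ ln (\prod_i d i) <= \sum_i (d i - 1).
  elim/big_ind2: _ => [|x1 x2 y1 y2 [a1 b1] [a2 b2]|i _].
  - by rewrite ln1.
  - by rewrite mulr_gt0 // lnM ?posrE // lerD.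
  - split => //; rewrite lerBrDl.
    by rewrite -[leRHS]lnK ?posrE // expR_ge1Dx.
by case.
Qed.

Lemma invmx_mul n (A B : 'M[C]_n) : A \in unitmx -> B \in unitmx ->
  invmx (A *m B) = invmx B *m invmx A.
Proof.
move=> uA uB; have uAB : A *m B \in unitmx by rewrite unitmx_mul uA.
rewrite -[RHS](mulKmx uAB); by rewrite -!mulmxA (mulmxA B) mulmxV // mul1mx mulmxV // mulmx1.
Qed.

(** Congruence by a factor of B reduces to B = 1, which is [logdet_le_trace]. Monotonicity and
    concavity of [logdet] both follow from this supergradient inequality. *)
Lemma logdet_tangent n (A B : 'M[C]_n) : pd A -> pd B ->
  logdet A <= logdet B + rtrace (invmx B *m (A - B)).
Proof.
move=> pA pB; have [L uL BE] := pd_factor pB.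
have uL' : ctr L \in unitmx by rewrite ctr_unit.
set X := invmx L *m A *m ctr (invmx L).
have pX : pd X by apply: pd_conj => //; rewrite unitmx_inv.
have AE : A = L *m X *m ctr L.
  by rewrite /X ctr_inv !mulmxA mulmxKV // mulmxV // mul1mx.
have -> : logdet A = logdet B + logdet X.
  apply: logdet_mulE => //; rewrite [in LHS]AE BE !det_mulmx.
  by rewrite mulrAC.
rewrite lerD2l; apply: le_trans (logdet_le_trace pX) _.
rewrite mulmxBr rtraceB mulVmx ?pd_unit // rtrace1 lerB //.
by rewrite BE invmx_mul // /X ctr_inv rtraceC !mulmxA.
Qed.

Lemma logdet_le n (A B : 'M[C]_n) : pd A -> pd B -> psd (B - A) ->
  logdet A <= logdet B.
Proof.
move=> pA pB pBA; apply: le_trans (logdet_tangent pA pB) _.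
rewrite gerDl -opprB mulmxN rtraceN oppr_le0.
by apply: rtrace_psdM => //; exact/pd_psd/pd_inv.
Qed.

(** Both tangents are taken at the mixture, where the weighted linear terms cancel. *)
Lemma logdet_concave n (a b : R) (A B : 'M[C]_n) : 0 <= a -> 0 <= b -> a + b = 1 ->
  pd A -> pd B -> a * logdet A + b * logdet B <= logdet (cR a *: A + cR b *: B).
Proof.
move=> a0 b0 ab pA pB; set D := cR a *: A + cR b *: B.
have pD : pd D.
  have [a_gt0|] := ltrP 0 a; first by apply: pdD; [exact: pdZ|exact/psdZ/pd_psd].
  move=> a_le0; have e : a = 0 by apply/eqP; rewrite eq_le a_le0.
  have -> : D = B; last by [].
  by move: ab; rewrite /D e add0r => ->; rewrite scale0r add0r scale1r.
have hA := ler_wpM2l a0 (logdet_tangent pA pD).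
have hB := ler_wpM2l b0 (logdet_tangent pB pD).
have : a * rtrace (invmx D *m (A - D)) + b * rtrace (invmx D *m (B - D)) = 0.
  rewrite -!rtraceZ -rtraceD !scalemxAr -mulmxDr !scalerBr addrACA -opprD.
  rewrite -scalerDl !cRE -rmorphD /= ab rmorph1 scale1r.
  by rewrite -!cRE subrr mulmx0 rtrace0.
move: hA hB; rewrite !mulrDr => hA hB e.
have := lerD hA hB; rewrite addrACA e addr0 -mulrDl ab mul1r.
by [].
Qed.

(** Hypothesis and conclusion are the two Schur complements of the block matrix with diagonal T^-1,
    Sg and off-diagonal D^*, D. The proof completes the square at w = Sg^-1 D v. *)
Lemma psd_inv_degraded k n (T : 'M[C]_n) (D : 'M[C]_(k, n)) (Sg : 'M[C]_k) :
  pd T -> pd Sg -> psd (Sg - D *m T *m ctr D) ->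
  psd (invmx T - ctr D *m invmx Sg *m D).
Proof.
move=> pT pS pST; have pI : pd (invmx Sg) by exact: pd_inv.
have pJ : pd (invmx T) by exact: pd_inv.
have [uS [hS _]] := (pd_unit pS, pS).
have [uT [hT _]] := (pd_unit pT, pT); have [hI _] := pI; have [hJ _] := pJ.
apply/psdP; split; first by rewrite ctrB !ctrM ctrK hI hJ mulmxA.
move=> v; set w := invmx Sg *m D *m v.
have h1 := proj2 pST w; have h2 := proj2 (pd_psd pJ) (v - T *m ctr D *m w).
rewrite -/(quad _ _) in h1 h2 *.
have -> : quad (invmx T - ctr D *m invmx Sg *m D) v =
    quad (invmx T) (v - T *m ctr D *m w) + quad (Sg - D *m T *m ctr D) w.
  have wE : D *m v = Sg *m w by rewrite /w !mulmxA mulmxV // mul1mx.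
  have vE : ctr v *m ctr D = ctr w *m Sg by rewrite -ctrM wE ctrM hS.
  have wD : invmx Sg *m D *m v = w by [].
  clearbody w.
  have e1 : ctr v *m (invmx T - ctr D *m invmx Sg *m D) *m v =
      ctr v *m invmx T *m v - ctr w *m Sg *m w.
    by rewrite mulmxBr mulmxBl -vE -wD !mulmxA.
  have e2 : ctr (v - T *m ctr D *m w) *m invmx T *m (v - T *m ctr D *m w) =
      ctr v *m invmx T *m v - ctr w *m Sg *m w - ctr w *m Sg *m w
      + ctr w *m D *m T *m ctr D *m w.
    rewrite ctrB !ctrM ctrK hT !mulmxA mulmxBl mulmxK // mulmxBl !mulmxBr.
    rewrite !mulmxA mulmxKV // vE -(mulmxA (ctr w) D v) wE mulmxA opprB.
    by rewrite addrA addrAC.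
  have e3 : ctr w *m (Sg - D *m T *m ctr D) *m w =
      ctr w *m Sg *m w - ctr w *m D *m T *m ctr D *m w.
    by rewrite mulmxBr mulmxBl !mulmxA.
  rewrite /quad e1 e2 e3; move: (_ *m Sg *m w) (_ *m ctr D *m w) => X Y.
  move: (_ *m invmx T *m v) => Z; rewrite !mxE; ring.
by rewrite addr_ge0.
Qed.

Lemma psd_inv_antitone m (A B : 'M[C]_m) : pd A -> pd B -> psd (B - A) ->
  psd (invmx A - invmx B).
Proof.
move=> pA pB h; have := @psd_inv_degraded _ _ A 1%:M B pA pB.
by rewrite ctr1 mulmx1 !mul1mx mulmx1 => /(_ h).
Qed.

(* D X + noise Sg is a degraded version of X + noise T. *)
Lemma logdet_data_processing k n (T Q : 'M[C]_n) (D : 'M[C]_(k, n)) (Sg : 'M[C]_k) :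
  pd T -> psd Q -> pd Sg -> psd (Sg - D *m T *m ctr D) ->
  logdet (Sg + D *m Q *m ctr D) - logdet Sg <= logdet (T + Q) - logdet T.
Proof.
move=> pT pQ pS pST; have [L QE] := psd_factor pQ.
(* Sylvester's identity moves the noise inside: both rates become log-determinants of matrices of
   the same size, which the order can compare. *)
have gen m (M : 'M[C]_m) (X : 'M[C]_(m, n)) : pd M ->
    logdet (M + X *m ctr X) - logdet M = logdet (1%:M + ctr X *m invmx M *m X).
  move=> pM; have [uM [hM _]] := (pd_unit pM, pM).
  have pX : pd (M + X *m ctr X) by apply: pdD => //; exact: psd_gram.
  have pY : pd (1%:M + ctr X *m invmx M *m X).
    apply: pdD; first exact: pd1.
    by have := psd_conj (ctr X) (pd_psd (pd_inv pM)); rewrite ctrK.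
  have e : \det (M + X *m ctr X) = \det M * \det (1%:M + ctr X *m invmx M *m X).
    rewrite -mulmxA det_sylvester -det_mulmx; congr (\det _).
    by rewrite mulmxDr mulmx1 !mulmxA mulmxV // mul1mx.
  rewrite /logdet e (det_pd_Re pM) (det_pd_Re pY) !cRE -rmorphM /=.
  by rewrite lnM ?posrE ?Re_det_gt0 // addrAC subrr add0r.
have -> : D *m Q *m ctr D = (D *m L) *m ctr (D *m L) by rewrite QE ctrM !mulmxA.
rewrite {1}QE !gen //.
have pI : pd (invmx Sg) by exact: pd_inv.
have pJ : pd (invmx T) by exact: pd_inv.
apply: logdet_le.
- apply: pdD; [exact: pd1|].
  by have := psd_conj (ctr (D *m L)) (pd_psd pI); rewrite ctrK.
- apply: pdD; [exact: pd1|].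
  by have := psd_conj (ctr L) (pd_psd pJ); rewrite ctrK.
rewrite opprD addrACA subrr add0r ctrM.
have -> : ctr L *m invmx T *m L - ctr L *m ctr D *m invmx Sg *m (D *m L) =
    ctr L *m (invmx T - ctr D *m invmx Sg *m D) *m ctr (ctr L).
  by rewrite ctrK mulmxBr mulmxBl !mulmxA.
by apply: psd_conj; exact: psd_inv_degraded.
Qed.

End LogDet.

(** * The dual multiple-access channel *)

Section RealInequalities.
Variable R : realFieldType.
Implicit Types a b c d s x y : R.

(** Stands for letting s tend to 0 in a first-order condition with an error linear in s. *)
Lemma le0_of_small a b : (forall s, 0 < s < 1 -> a <= s * b) -> a <= 0.
Proof.
move=> H; rewrite leNgt; apply/negP => a0.
have b0 : 0 < b.
  have := H 2^-1 _; rewrite invr_gt0 ltr0n /= invf_lt1 ?ltr1n // => /(_ isT) h.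
  by have := lt_le_trans a0 h; rewrite pmulr_rgt0 // invr_gt0.
have := H (a / (a + b) / 2) _.
have -> : 0 < a / (a + b) / 2 < 1.
  rewrite !divr_gt0 ?addr_gt0 //= ltr_pdivrMr // ltr_pdivrMr ?addr_gt0 //; nra.
move=> /(_ isT); rewrite leNgt => /negP; apply.
have ab : 0 < a + b by rewrite addr_gt0.
have d0 : 0 < a / (a + b) by rewrite divr_gt0.
have dE : a / (a + b) * (a + b) = a by rewrite divfK // gt_eqF.
by move: (a / (a + b)) d0 dE => d d0 dE; nra.
Qed.

Lemma segment_le s a b c d x : 0 <= 1 - s -> 0 <= s -> a + b <= x -> c + d <= x ->
  (1 - s) * a + s * c + ((1 - s) * b + s * d) <= x.
Proof. move=> s1 s0 /(ler_wpM2l s1) h1 /(ler_wpM2l s0) h2; lra. Qed.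

Lemma regroup5 x a b c d s :
  x * (a + b) + (c + d + s) = x * a + c + (x * b + d + s).
Proof. by ring. Qed.

Lemma nonneg_sum_le0 a b : 0 <= a -> 0 <= b -> a + b <= 0 -> a = 0 /\ b = 0.
Proof. by move=> a0 b0 ab; split; lra. Qed.

Lemma variational_step mu s x y c N l1 l2 l1' l2' :
  0 <= mu - 1 -> 0 < s -> 0 < 1 - s -> 0 < 1 + s * c ->
  s * (x / (1 + s * c) - N / (1 - s)) <= l1' - l1 ->
  s * (y / (1 + s * c) - N / (1 - s)) <= l2' - l2 ->
  (mu - 1) * l1' + l2' <= (mu - 1) * l1 + l2 ->
  (mu - 1) * x + y - mu * N <= s * ((mu - 1) * x + y + mu * N * c).
Proof.
move=> mu0 s0 s1 D0 k1 k2 hopt; have k1' := ler_wpM2l mu0 k1.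
have : s * (((mu - 1) * x + y) / (1 + s * c) - mu * N / (1 - s)) <= 0.
  have -> : s * (((mu - 1) * x + y) / (1 + s * c) - mu * N / (1 - s)) =
    (mu - 1) * (s * (x / (1 + s * c) - N / (1 - s))) +
    s * (y / (1 + s * c) - N / (1 - s)) by ring.
  lra.
rewrite pmulr_rle0 // subr_le0 ler_pdivrMr // mulrAC ler_pdivlMr // => h.
lra.
Qed.

End RealInequalities.

Section DualMAC.
Variable R : realType.
Local Notation C := R[i].
Variables (n r1 r2 : nat) (G : 'M[C]_(r1, n)) (K : 'M[C]_(r2, n)) (mu P : R).
Hypotheses (mu1 : 1 <= mu) (P0 : 0 < P).

(* 1 + G^* P1 G and 1 + G^* P1 G + K^* P2 K: received covariances of the multiple-access
   channel dual to the broadcast channel, after and before user 2 is cancelled. *)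
Definition mac1 (P1 : 'M[C]_r1) : 'M[C]_n := 1%:M + ctr G *m P1 *m G.
Definition mac2 (P1 : 'M[C]_r1) (P2 : 'M[C]_r2) : 'M[C]_n :=
  mac1 P1 + ctr K *m P2 *m K.

Definition mac_rate P1 P2 : R := (mu - 1) * logdet (mac1 P1) + logdet (mac2 P1 P2).

Definition mac_feasible (P1 : 'M[C]_r1) (P2 : 'M[C]_r2) : Prop :=
  [/\ psd P1, psd P2 & rtrace P1 + rtrace P2 <= P].

Lemma psd_conjl m k (A : 'M[C]_m) (B : 'M[C]_(m, k)) :
  psd A -> psd (ctr B *m A *m B).
Proof. by move=> /(psd_conj (ctr B)); rewrite ctrK. Qed.

Lemma pd_mac1 P1 : psd P1 -> pd (mac1 P1).
Proof. by move=> p1; apply: pdD; [exact: pd1 | exact: psd_conjl]. Qed.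

Lemma pd_mac2 P1 P2 : psd P1 -> psd P2 -> pd (mac2 P1 P2).
Proof. by move=> p1 p2; apply: pdD; [exact: pd_mac1 | exact: psd_conjl]. Qed.

(** Every eigenvalue is at most the sum of all of them. The crude bound suffices because it enters
    [logdet_segment] only in a term of second order in s. *)
Lemma psd_sub_rtrace m (A : 'M[C]_m) : psd A -> psd (cR (rtrace A) *: 1%:M - A).
Proof.
move=> pA; have [U [d [UU UU' d0 AE]]] := psd_spectral pA.
have -> : rtrace A = \sum_i d i.
  rewrite AE rtraceC mulmxA UU' mul1mx /rtrace mxtrace_diag Re_sum.
  by apply: eq_bigr => i _; rewrite mxE.
set s := \sum_i d i.
have -> : cR s *: 1%:M - A =
    U *m diag_mx (\row_i cR (s - d i)) *m ctr U.
  rewrite AE -UU scalemxAl -mulmxBl; congr (_ *m _).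
  rewrite -[X in cR s *: X]mulmx1 scalemxAr -mulmxBr; congr (_ *m _).
  by apply/matrixP => i j; rewrite !mxE !cRE rmorphB /= mulrnBl mulr_natr.
apply: psd_conj.
have -> : diag_mx (\row_i cR (s - d i)) = diag_mx (\row_i cR (Num.sqrt (s - d i)))
    *m ctr (diag_mx (\row_i cR (Num.sqrt (s - d i)))).
  rewrite /ctr map_diag_mx tr_diag_mx mulmx_diag; congr diag_mx.
  apply/rowP => i; rewrite !mxE /= conj_cR !cRE -rmorphM /= -expr2 sqr_sqrtr //.
  by rewrite subr_ge0 /s (bigD1 i) //= lerDl sumr_ge0.
exact: psd_gram.
Qed.

Lemma invmx_cRZ m (c : R) (A : 'M[C]_m) : 0 < c -> pd A ->
  cR c *: invmx A = invmx (cR c^-1 *: A).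
Proof.
move=> c0 pA; rewrite invmxZ.
  by rewrite !cRE fmorphV invrK.
by apply: pd_unit; apply: pdZ => //; rewrite invr_gt0.
Qed.

(* Along the segment from A to A' the derivative of logdet at A is approached from below. *)
Lemma logdet_segment m (A A' : 'M[C]_m) (s : R) : psd (A - 1%:M) -> pd A -> psd A' ->
  0 < s < 1 ->
  s * (rtrace (invmx A *m A') / (1 + s * rtrace A') - m%:R / (1 - s)) <=
  logdet (cR (1 - s) *: A + cR s *: A') - logdet A.
Proof.
move=> A1 pA pA' /andP[s0 s1]; set c := rtrace A'; set As := _ *: A + _.
have c0 : 0 <= c by exact: rtrace_psd.
have s1' : 0 < 1 - s by rewrite subr_gt0.
have pAs : pd As.
  by apply: pdD; [exact: pdZ s1' pA | exact: psdZ (ltW s0) pA'].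
have := logdet_tangent pA pAs.
rewrite -lerBlDl -opprB lerNl => h; apply: le_trans h.
have AsE : As - A = cR s *: (A' - A).
  rewrite /As addrAC -{2}[A]scale1r -scalerBl scalerBr.
  by rewrite !cRE rmorphB /= rmorph1 addrAC subrr add0r scaleNr addrC.
rewrite -[A - As]opprB mulmxN rtraceN opprK AsE -scalemxAr rtraceZ.
rewrite ler_wpM2l ?(ltW s0) // mulmxBr rtraceB lerB //.
- have sc0 : 0 < 1 + s * c by rewrite ltr_pwDl // mulr_ge0 // ltW.
  rewrite ler_pdivrMr // mulrC -rtraceZ -subr_ge0 -rtraceB scalemxAl -mulmxBl.
  apply: rtrace_psdM; [|exact: pA'].
  rewrite (invmx_cRZ sc0 pAs); apply: psd_inv_antitone; [|exact: pA|].
    by apply: pdZ; [rewrite invr_gt0|exact: pAs].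
  (* (1 + s c) A exceeds As by s A + s c (A - 1) + s (c - A'), three positive semidefinite terms;
     the middle one is where A >= 1 enters. *)
  have -> : A - cR (1 + s * c)^-1 *: As = cR (1 + s * c)^-1 *:
      (cR s *: A + cR (s * c) *: (A - 1%:M) + cR s *: (cR c *: 1%:M - A')).
    have cN0 : 1 + (s%:C)%C * (c%:C)%C != 0 :> C.
      by rewrite -rmorphM -(rmorph1 (real_complex R)) -rmorphD fmorph_eq0 gt_eqF.
    rewrite /As !cRE fmorphV rmorphD rmorphB rmorphM rmorph1.
    by apply/matrixP => i j; rewrite !mxE; field.
  apply: psdZ; first by rewrite invr_ge0 ltW.
  apply: psdD; last exact: psdZ (ltW s0) (psd_sub_rtrace pA').
  apply: psdD; first exact: psdZ (ltW s0) (pd_psd pA).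
  by apply: psdZ; [rewrite mulr_ge0 // ltW | exact: A1].
- rewrite ler_pdivlMr // mulrC -rtraceZ -[leRHS](@rtrace1 R m).
  have <- : invmx A *m A = 1%:M by rewrite mulVmx // pd_unit.
  rewrite -subr_ge0 -rtraceB scalemxAl -mulmxBl.
  apply: rtrace_psdM; last exact: pd_psd.
  rewrite (invmx_cRZ s1' pAs); apply: psd_inv_antitone; [exact: pA| |].
    by apply: pdZ; [rewrite invr_gt0|exact: pAs].
  have -> : cR (1 - s)^-1 *: As - A = cR (s / (1 - s)) *: A'.
    have sN0 : 1 - (s%:C)%C != 0 :> C.
      by rewrite -(rmorph1 (real_complex R)) -rmorphB fmorph_eq0 gt_eqF.
    rewrite /As !cRE rmorphM fmorphV rmorphB rmorph1.
    by apply/matrixP => i j; rewrite !mxE; field.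
  by apply: psdZ; [rewrite divr_ge0 // ltW | exact: pA'].
Qed.

Lemma mac1_segment s P1 P1' :
  mac1 (cR (1 - s) *: P1 + cR s *: P1') = cR (1 - s) *: mac1 P1 + cR s *: mac1 P1'.
Proof.
rewrite /mac1 mulmxDr mulmxDl -!scalemxAr -!scalemxAl !scalerDr addrACA -scalerDl.
by congr (_ + _); rewrite !cRE -rmorphD subrK rmorph1 scale1r.
Qed.

Lemma mac2_segment s P1 P1' P2 P2' :
  mac2 (cR (1 - s) *: P1 + cR s *: P1') (cR (1 - s) *: P2 + cR s *: P2') =
  cR (1 - s) *: mac2 P1 P2 + cR s *: mac2 P1' P2'.
Proof.
rewrite /mac2 mac1_segment mulmxDr mulmxDl -!scalemxAr -!scalemxAl !scalerDr.
by rewrite addrACA.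
Qed.

Definition mac_optimal P1 P2 := mac_feasible P1 P2 /\
  forall P1' P2', mac_feasible P1' P2' -> mac_rate P1' P2' <= mac_rate P1 P2.

(** First-order optimality along the segment towards an arbitrary feasible pair. At (P1, P2) itself
    the left side equals mu n, so this says that a linear functional is maximal at the optimum. *)
Lemma mac_variational P1 P2 P1' P2' : mac_optimal P1 P2 -> mac_feasible P1' P2' ->
  (mu - 1) * rtrace (invmx (mac1 P1) *m mac1 P1') +
  rtrace (invmx (mac2 P1 P2) *m mac2 P1' P2') <= mu * n%:R.
Proof.
move=> [[p1 p2 tr12] opt] [p1' p2' tr12'].
have pA1 := pd_mac1 p1; have pA2 := pd_mac2 p1 p2.
have pB1 := pd_mac1 p1'; have pB2 := pd_mac2 p1' p2'.
set x1 := rtrace _; set x2 := rtrace _.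
have x10 : 0 <= x1 := rtrace_psdM (pd_psd (pd_inv pA1)) (pd_psd pB1).
have x20 : 0 <= x2 := rtrace_psdM (pd_psd (pd_inv pA2)) (pd_psd pB2).
set c1 := rtrace (mac1 P1'); set c2 := rtrace (mac2 P1' P2').
have c10 : 0 <= c1 := rtrace_psd (pd_psd pB1).
have c20 : 0 <= c2 := rtrace_psd (pd_psd pB2).
have mu0 : 0 <= mu - 1 by rewrite subr_ge0.
set X := _ + _; rewrite -subr_le0.
(* The coefficient of s is what remains after clearing the denominators 1 + s (c1 + c2) and 1 - s in
   [variational_step]. *)
apply: (@le0_of_small _ _ (X + mu * n%:R * (c1 + c2))) => s s01.
have /andP[s0 s1] := s01.
have s1' : 0 < 1 - s by rewrite subr_gt0.
have feas : mac_feasible (cR (1 - s) *: P1 + cR s *: P1') (cR (1 - s) *: P2 + cR s *: P2').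
  split.
  - exact: psdD (psdZ (ltW s1') p1) (psdZ (ltW s0) p1').
  - exact: psdD (psdZ (ltW s1') p2) (psdZ (ltW s0) p2').
  rewrite !rtraceD !rtraceZ.
  exact: segment_le (ltW s1') (ltW s0) tr12 tr12'.
have := opt _ _ feas; rewrite /mac_rate mac1_segment mac2_segment.
have q1 : psd (mac1 P1 - 1%:M) by rewrite /mac1 addrAC subrr add0r; exact: psd_conjl p1.
have q2 : psd (mac2 P1 P2 - 1%:M).
  by rewrite /mac2 addrAC; exact: psdD q1 (psd_conjl K p2).
have h1 := logdet_segment q1 pA1 (pd_psd pB1) s01.
have h2 := logdet_segment q2 pA2 (pd_psd pB2) s01.
rewrite -/x1 -/c1 in h1; rewrite -/x2 -/c2 in h2.
set D := 1 + s * (c1 + c2).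
have D0 : 0 < D by rewrite /D ltr_pwDl // mulr_ge0 ?addr_ge0 // ltW.
have mono x c : 0 <= x -> 0 <= c -> c <= c1 + c2 -> x / D <= x / (1 + s * c).
  move=> x0 c0 cc; rewrite ler_wpM2l // lef_pV2 ?posrE //.
    by rewrite lerD2l ler_wpM2l // ltW.
  by rewrite ltr_pwDl // mulr_ge0 // ltW.
have m1 := mono x1 c1 x10 c10 _; have m2 := mono x2 c2 x20 c20 _.
rewrite lerDl in m1; rewrite lerDr in m2.
have {}m1 := m1 c20; have {}m2 := m2 c10.
have k1 : s * (x1 / D - n%:R / (1 - s)) <=
    logdet (cR (1 - s) *: mac1 P1 + cR s *: mac1 P1') - logdet (mac1 P1).
  by apply: le_trans h1; rewrite ler_wpM2l ?lerB // ltW.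
have k2 : s * (x2 / D - n%:R / (1 - s)) <=
    logdet (cR (1 - s) *: mac2 P1 P2 + cR s *: mac2 P1' P2') - logdet (mac2 P1 P2).
  by apply: le_trans h2; rewrite ler_wpM2l ?lerB // ltW.
exact: variational_step mu0 s0 s1' D0 k1 k2.
Qed.

(** The multipliers of the semidefinite constraints are eliminated: lam minus each gradient is
    positive semidefinite and is annihilated by P1, respectively P2. [kkt_power] sums the slackness
    traces and rewrites them through the inverses. *)
Record mac_kkt (P1 : 'M[C]_r1) (P2 : 'M[C]_r2) (lam : R) : Prop := MacKKT {
  kkt_psd1 : psd P1;
  kkt_psd2 : psd P2;
  kkt_ge0 : 0 <= lam;
  kkt_grad1 : psd (cR lam *: 1%:M - (cR (mu - 1) *: (G *m invmx (mac1 P1) *m ctr G) +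
                                     G *m invmx (mac2 P1 P2) *m ctr G));
  kkt_grad2 : psd (cR lam *: 1%:M - K *m invmx (mac2 P1 P2) *m ctr K);
  kkt_slack1 : P1 *m (cR (mu - 1) *: (G *m invmx (mac1 P1) *m ctr G) +
                      G *m invmx (mac2 P1 P2) *m ctr G) = cR lam *: P1;
  kkt_slack2 : P2 *m (K *m invmx (mac2 P1 P2) *m ctr K) = cR lam *: P2;
  kkt_power : lam * P = mu * n%:R - (mu - 1) * rtrace (invmx (mac1 P1))
                        - rtrace (invmx (mac2 P1 P2)) }.

Lemma rtrace_mac1 (T : 'M[C]_n) P1 :
  rtrace (T *m mac1 P1) = rtrace T + rtrace (G *m T *m ctr G *m P1).
Proof.
rewrite /mac1 mulmxDr mulmx1 rtraceD; congr (_ + _).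
by rewrite mulmxA rtraceC !mulmxA.
Qed.

Lemma rtrace_mac2 (T : 'M[C]_n) P1 P2 : rtrace (T *m mac2 P1 P2) =
  rtrace T + rtrace (G *m T *m ctr G *m P1) + rtrace (K *m T *m ctr K *m P2).
Proof.
rewrite /mac2 mulmxDr rtraceD rtrace_mac1; congr (_ + _).
by rewrite mulmxA rtraceC !mulmxA.
Qed.

(** Rank-one matrices suffice as tests; scaled to trace P they are feasible in the dual problem. *)
Lemma psd_le_scalar m (A : 'M[C]_m) (lam : R) : ctr A = A ->
  (forall v : 'cV[C]_m, rtrace (A *m (v *m ctr v)) <= lam * rtrace (v *m ctr v)) ->
  (forall v : 'cV[C]_m, 0 <= quad A v) -> psd (cR lam *: 1%:M - A).
Proof.
move=> hA H pA; apply/psdP; split; first by rewrite ctrB ctrZr ctr1 hA.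
have tr11 (M : 'M[C]_1) : \tr M = M 0 0 by rewrite /mxtrace big_ord1.
move=> v; rewrite quadD quadN quadZ subr_ge0.
have := H v; rewrite mulmxA !(rtraceC _ (ctr v)) mulmxA /rtrace !tr11 -/(quad A v).
have -> : (ctr v *m v) 0 0 = quad 1%:M v by rewrite /quad mulmx1.
have q1 : 0 <= quad 1%:M v by have /psdP[] := psd1 R m.
rewrite (ge0_cR_Re (pA v)) (ge0_cR_Re q1) /= => h.
by rewrite !cRE -rmorphM /= lecR.
Qed.

(** By [mac_variational] the functional tr(g1 P1') + tr(g2 P2') is at most its value s0 at the
    optimum. Spending all the power on one rank-one matrix bounds g1 and g2 by lam = s0 / P. The
    traces of P1 (lam - g1) and P2 (lam - g2) are then nonnegative with sum at most lam P - s0 = 0,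
    which gives slackness. *)
Lemma mac_optimal_kkt P1 P2 : mac_optimal P1 P2 -> exists lam, mac_kkt P1 P2 lam.
Proof.
move=> opt; have [[p1 p2 tr12] _] := opt.
have var := mac_variational opt.
have pA1 := pd_mac1 p1; have pA2 := pd_mac2 p1 p2.
set T1 := invmx (mac1 P1) in var *; set T := invmx (mac2 P1 P2) in var *.
have pT1 : psd T1 := pd_psd (pd_inv pA1).
have pT : psd T := pd_psd (pd_inv pA2).
have mu0 : 0 <= mu - 1 by rewrite subr_ge0.
set g1 := cR (mu - 1) *: (G *m T1 *m ctr G) + G *m T *m ctr G.
set g2 := K *m T *m ctr K.
have pg1 : psd g1 := psdD (psdZ mu0 (psd_conj G pT1)) (psd_conj G pT).
have pg2 : psd g2 := psd_conj K pT.
have varE P1' P2' : (mu - 1) * rtrace (T1 *m mac1 P1') + rtrace (T *m mac2 P1' P2') =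
   (mu - 1) * rtrace T1 + rtrace T + (rtrace (g1 *m P1') + rtrace (g2 *m P2')).
  rewrite rtrace_mac1 rtrace_mac2 /g1 mulmxDl rtraceD -scalemxAl rtraceZ.
  exact: regroup5.
have e0 : (mu - 1) * rtrace T1 + rtrace T + (rtrace (g1 *m P1) + rtrace (g2 *m P2)) =
    mu * n%:R.
  rewrite -varE /T1 /T (mulVmx (pd_unit pA1)) (mulVmx (pd_unit pA2)) rtrace1; ring.
set s0 := rtrace (g1 *m P1) + rtrace (g2 *m P2) in e0.
have s00 : 0 <= s0 := addr_ge0 (rtrace_psdM pg1 p1) (rtrace_psdM pg2 p2).
have var' P1' P2' : mac_feasible P1' P2' ->
    rtrace (g1 *m P1') + rtrace (g2 *m P2') <= s0.
  by move=> /var; rewrite varE -e0 lerD2l.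
have rank1 m (v : 'cV[C]_m) (w := rtrace (v *m ctr v)) : v *m ctr v = 0 \/
    (0 < w /\ psd (cR (P / w) *: (v *m ctr v)) /\
     rtrace (cR (P / w) *: (v *m ctr v)) = P).
  have [w0|w0] := eqVneq w 0; [left|right].
    by move/rtrace_gram_eq0: w0 => ->; rewrite mul0mx.
  have wp : 0 < w by rewrite lt0r w0 /=; exact/rtrace_psd/psd_gram.
  split=> //; split; first by apply: psdZ; [rewrite divr_ge0 // ltW|exact: psd_gram].
  by rewrite rtraceZ -/w divfK.
exists (s0 / P); have lP : s0 / P * P = s0 by rewrite divfK // gt_eqF.
have l0 : 0 <= s0 / P by rewrite divr_ge0 // ltW.
have b1 : psd (cR (s0 / P) *: 1%:M - g1).
  have /psdP[h q] := pg1; apply: (psd_le_scalar h _ q) => v.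
  have [->|[w0 [pv tv]]] := rank1 _ v; first by rewrite mulmx0 rtrace0 mulr0.
  have := var' _ 0 (And3 pv (psd0 R r2) _); rewrite rtrace0 addr0 tv lexx => /(_ isT).
  rewrite mulmx0 rtrace0 addr0 -scalemxAr rtraceZ.
  rewrite mulrAC -ler_pdivlMr ?invr_gt0 // invrK => h'.
  rewrite mulrAC ler_pdivlMr // mulrC.
  exact: h'.
have b2 : psd (cR (s0 / P) *: 1%:M - g2).
  have /psdP[h q] := pg2; apply: (psd_le_scalar h _ q) => v.
  have [->|[w0 [pv tv]]] := rank1 _ v; first by rewrite mulmx0 rtrace0 mulr0.
  have := var' 0 _ (And3 (psd0 R r1) pv _); rewrite rtrace0 add0r tv lexx => /(_ isT).
  rewrite mulmx0 rtrace0 add0r -scalemxAr rtraceZ.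
  rewrite mulrAC -ler_pdivlMr ?invr_gt0 // invrK => h'.
  rewrite mulrAC ler_pdivlMr // mulrC.
  exact: h'.
have s1 := rtrace_psdM p1 b1; have s2 := rtrace_psdM p2 b2.
have tot : rtrace (P1 *m (cR (s0 / P) *: 1%:M - g1)) +
    rtrace (P2 *m (cR (s0 / P) *: 1%:M - g2)) <= 0.
  rewrite !mulmxBr -!scalemxAr !mulmx1 !rtraceB !rtraceZ (rtraceC P1) (rtraceC P2).
  rewrite addrACA -opprD -mulrDr subr_le0 -/s0 -[leRHS]lP.
  exact: ler_wpM2l.
have [z1 z2] := nonneg_sum_le0 s1 s2 tot.
split; [exact: p1|exact: p2|exact: l0|exact: b1|exact: b2| | |].
- have := rtrace_psdM_eq0 p1 b1 z1; rewrite mulmxBr -scalemxAr mulmx1 => H.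
  by apply/esym/eqP; rewrite -subr_eq0; apply/eqP/H.
- have := rtrace_psdM_eq0 p2 b2 z2; rewrite mulmxBr -scalemxAr mulmx1 => H.
  by apply/esym/eqP; rewrite -subr_eq0; apply/eqP/H.
- rewrite lP -/T1 -/T -e0; move: (rtrace T) (_ * _) s0 {e0 s00 var' l0 lP b1 b2 s1 s2 tot z1 z2} => x y z.
  by rewrite addrAC -!addrA; ring.
Qed.

End DualMAC.

(** * Upper bound and broadcast covariances from the KKT conditions *)

Section RateArithmetic.
Variable R : realFieldType.

(* a1, a2: rates of the two users; ds, dc, tc, t1, t2: log-determinants *)
Lemma outer_rate_arith (mu q nls a1 a2 ds dc tc t1 t2 m1 m2 : R) : 0 <= mu ->
  a1 <= ds - dc -> a2 <= tc - t2 - nls ->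
  mu * q + ((mu - 1) * t1 + tc) <= mu * dc -> mu * ds <= mu * q ->
  t1 = - m1 -> t2 = - m2 ->
  mu * a1 + a2 <= (mu - 1) * m1 + m2 - nls.
Proof. move=> mu0 /(ler_wpM2l mu0) h1 h2 h3 h4 h5 h6; subst; lra. Qed.

Lemma scale_arith (N ls ll a b c : R) : a <= b ->
  N * ll + a - (N * (ls + ll) + c) <= b - c - N * ls.
Proof. move=> h; lra. Qed.

Lemma weights_arith (mu a b : R) : mu != 0 ->
  mu * ((mu - 1) / mu * a + mu^-1 * b) = (mu - 1) * a + b.
Proof. by move=> mu0; field. Qed.

Lemma power_arith (mu lam P N t1 t2 qp qc : R) : 0 < mu -> 0 < lam ->
  lam * P = mu * N - (mu - 1) * t1 - t2 -> qp + qc <= P ->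
  lam / mu * (lam^-1 * ((mu - 1) * t1 + t2) + (qp + qc)) - N <= 0.
Proof.
move=> mu0 lam0 e h; rewrite subr_le0 mulrAC ler_pdivrMr // mulrDr.
rewrite mulrA divff ?gt_eqF // mul1r.
have := ler_wpM2l (ltW lam0) h; lra.
Qed.

Lemma bc_power_arith (mu lam P N t1 t2 : R) : 0 < lam ->
  lam * P = mu * N - (mu - 1) * t1 - t2 -> mu / lam * (N - t1) + lam^-1 * (t1 - t2) = P.
Proof.
move=> lam0 e; have lN0 : lam != 0 by rewrite gt_eqF.
by apply: (mulfI lN0); rewrite e; field.
Qed.

Lemma bc_rate_arith (mu a b : R) : mu * - - a + (- a - - b) = (mu - 1) * a + b.
Proof. by ring. Qed.

End RateArithmetic.

Lemma addr_swap (V : zmodType) (x y z : V) : x + (y + z) = x + z + y.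
Proof. by rewrite addrA addrAC. Qed.

Lemma slack_arith (R : realType) (V : lmodType R[i]) (p x y : V) (mu lam : R) :
  lam != 0 -> y = cR lam *: p - cR (mu - 1) *: x ->
  p + cR lam^-1 *: (x - y) = cR (mu / lam) *: x.
Proof.
move=> l0 ->; rewrite opprB addrA -{1}[x]scale1r -scalerDl scalerBr !scalerA.
rewrite !cRE -!rmorphM -(rmorph1 (real_complex R)) -rmorphD -rmorphM mulVf //.
by rewrite rmorph1 scale1r addrC subrK [1 + _]addrC subrK mulrC.
Qed.

Section KKTConsequences.
Variable R : realType.
Local Notation C := R[i].
Variables (n r1 r2 : nat) (G : 'M[C]_(r1, n)) (K : 'M[C]_(r2, n)) (mu P : R).
Hypotheses (mu1 : 1 <= mu) (P0 : 0 < P).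
Variables (P1 : 'M[C]_r1) (P2 : 'M[C]_r2) (lam : R).
Hypotheses (kkt : mac_kkt G K mu P P1 P2 lam) (lam0 : 0 < lam).

Let A1 := mac1 G P1.
Let A2 := mac2 G K P1 P2.
Let T1 := invmx A1.
Let T := invmx A2.

Let mu0 : 0 < mu. Proof. exact: lt_le_trans mu1. Qed.
Let mu10 : 0 <= mu - 1. Proof. by rewrite subr_ge0. Qed.

Let pA1 : pd A1. Proof. exact/pd_mac1/(kkt_psd1 kkt). Qed.
Let pA2 : pd A2. Proof. by apply: pd_mac2; [exact: kkt_psd1 kkt|exact: kkt_psd2 kkt]. Qed.
Let pT1 : pd T1. Proof. exact: pd_inv. Qed.
Let pT : pd T. Proof. exact: pd_inv. Qed.

Let T1T : psd (T1 - T).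
Proof.
apply: psd_inv_antitone pA1 pA2 _; rewrite /A2 /mac2 addrAC subrr add0r.
exact/psd_conjl/(kkt_psd2 kkt).
Qed.

Let T1_le1 : psd (1%:M - T1).
Proof.
rewrite -[X in X - _](invmx1); apply: psd_inv_antitone (pd1 _ _) pA1 _.
rewrite /A1 /mac1 addrAC subrr add0r; exact/psd_conjl/(kkt_psd1 kkt).
Qed.

Let cRM (a b : R) : cR a * cR b = cR (a * b).
Proof. by rewrite !cRE rmorphM. Qed.

(** The gradient condition makes user 1's output a degraded version of X + noise N1, and the
    hypothesis on Sz makes the enhanced output a degraded version of X + noise (s / lam) T. Up to
    the scale mu / lam, N1 + Qc is the mixture of T1 and T + lam Qc with weights (mu - 1) / mu and 1
    / mu, so concavity absorbs the terms in Qc. *)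
Lemma outer_rate_le (s : R) (Sz : 'M[C]_(r1 + r2)) (Qp Qc : 'M[C]_n)
    (Kb := col_mx G K) :
  0 < s <= 1 -> pd Sz -> psd (Sz - cR (s / lam) *: (Kb *m T *m ctr Kb)) ->
  psd Qp -> psd Qc -> rtrace Qp + rtrace Qc <= P ->
  mu * (logdet (1%:M + G *m (Qp + Qc) *m ctr G) - logdet (1%:M + G *m Qc *m ctr G)) +
  (logdet (Sz + Kb *m Qc *m ctr Kb) - logdet Sz) <= mac_rate G K mu P1 P2 - n%:R * ln s.
Proof.
move=> /andP[s0 s1] pSz hSz pQp pQc trQ.
set N1 := cR lam^-1 *: (cR (mu - 1) *: T1 + T).
have lamN0 : lam != 0 by rewrite gt_eqF.
have muN0 : mu != 0 by rewrite gt_eqF.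
have lV0 : 0 < lam^-1 by rewrite invr_gt0.
have pN1 : pd N1.
  by apply: pdZ lV0 _; rewrite addrC; exact: pdD pT (psdZ mu10 (pd_psd pT1)).
have pN1c : pd (N1 + Qc) := pdD pN1 pQc.
have pN1s : pd (N1 + (Qp + Qc)) := pdD pN1 (psdD pQp pQc).
have pTc : pd (T + cR lam *: Qc) := pdD pT (psdZ (ltW lam0) pQc).
have step1 : logdet (1%:M + G *m (Qp + Qc) *m ctr G) - logdet (1%:M + G *m Qc *m ctr G)
    <= logdet (N1 + (Qp + Qc)) - logdet (N1 + Qc).
  have -> : 1%:M + G *m (Qp + Qc) *m ctr G = 1%:M + G *m Qc *m ctr G + G *m Qp *m ctr G.
    by rewrite mulmxDr mulmxDl; exact: addr_swap.
  have -> : N1 + (Qp + Qc) = N1 + Qc + Qp by rewrite -addrA (addrC Qp).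
  apply: (logdet_data_processing pN1c pQp (pdD (pd1 _ _) (psd_conj G pQc))).
  have -> : 1%:M + G *m Qc *m ctr G - G *m (N1 + Qc) *m ctr G =
      cR lam^-1 *: (cR lam *: 1%:M - (cR (mu - 1) *: (G *m T1 *m ctr G) +
                                      G *m T *m ctr G)).
    rewrite mulmxDr mulmxDl opprD addrACA subrr addr0 scalerBr scalerA cRM mulVf //.
    rewrite scale1r; congr (_ - _).
    by rewrite /N1 -scalemxAr -scalemxAl mulmxDr mulmxDl -scalemxAr -scalemxAl.
  exact: psdZ (ltW lV0) (kkt_grad1 kkt).
have sl0 : 0 < s / lam by rewrite divr_gt0.
have step2 : logdet (Sz + Kb *m Qc *m ctr Kb) - logdet Sz <=
    logdet (T + cR lam *: Qc) - logdet T - n%:R * ln s.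
  have hSz' : psd (Sz - Kb *m (cR (s / lam) *: T) *m ctr Kb).
    by rewrite -scalemxAr -scalemxAl.
  apply: le_trans (logdet_data_processing (pdZ sl0 pT) pQc pSz hSz') _.
  have pst : pd (cR s *: T + cR lam *: Qc) := pdD (pdZ s0 pT) (psdZ (ltW lam0) pQc).
  have -> : cR (s / lam) *: T + Qc = cR lam^-1 *: (cR s *: T + cR lam *: Qc).
    by rewrite scalerDr !scalerA !cRM mulVf // scale1r mulrC.
  rewrite (logdetZ lV0 pst) (logdetZ sl0 pT) lnM ?posrE //.
  have hle : logdet (cR s *: T + cR lam *: Qc) <= logdet (T + cR lam *: Qc).
    apply: logdet_le pst pTc _; rewrite opprD addrACA subrr addr0.
    have -> : T - cR s *: T = cR (1 - s) *: T.
      by rewrite !cRE rmorphB rmorph1 scalerBl scale1r.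
    by apply: psdZ _ (pd_psd pT); rewrite subr_ge0.
  exact: scale_arith hle.
(* Scaling by lam / mu brings the trace of N1 + Qp + Qc to at most n, by [kkt_power] and the power
   constraint; its [logdet] is then at most 0. *)
set q := n%:R * ln (mu / lam).
have ml0 : 0 < mu / lam by rewrite divr_gt0.
have lm0 : 0 < lam / mu by rewrite divr_gt0.
have scale_up (X : 'M[C]_n) : pd X -> logdet X = q + logdet (cR (lam / mu) *: X).
  move=> pX; rewrite (logdetZ lm0 pX) /q -[lam / mu]invf_div lnV ?posrE //.
  by rewrite mulrN addrA subrr add0r.
have step3 : mu * q + ((mu - 1) * logdet T1 + logdet (T + cR lam *: Qc)) <=
    mu * logdet (N1 + Qc).
  have muV : 0 <= mu^-1 by rewrite invr_ge0 ltW.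
  have mE : (mu - 1) / mu + mu^-1 = 1 by rewrite -[X in _ + X]mul1r -mulrDl subrK divff.
  have h := logdet_concave (mulr_ge0 mu10 muV) muV mE pT1 pTc.
  rewrite (scale_up _ pN1c) mulrDr lerD2l.
  have {h} := ler_wpM2l (ltW mu0) h.
  have -> : mu * ((mu - 1) / mu * logdet T1 + mu^-1 * logdet (T + cR lam *: Qc)) =
     (mu - 1) * logdet T1 + logdet (T + cR lam *: Qc).
    exact: weights_arith muN0.
  move=> /le_trans; apply; rewrite le_eqVlt; apply/orP; left; apply/eqP; congr (_ * logdet _).
  have c1 : lam / mu * lam^-1 = mu^-1 by rewrite mulrAC divff // mul1r.
  have c2 : lam / mu * (lam^-1 * (mu - 1)) = (mu - 1) / mu by rewrite mulrA c1 mulrC.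
  have c3 : mu^-1 * lam = lam / mu by rewrite mulrC.
  by rewrite /N1 !scalerDr !scalerA !cRM c2 c1 c3 addrA.
have step4 : mu * logdet (N1 + (Qp + Qc)) <= mu * q.
  rewrite ler_wpM2l ?(ltW mu0) // (scale_up _ pN1s) gerDl.
  apply: le_trans (logdet_le_trace (pdZ lm0 pN1s)) _.
  rewrite rtraceZ rtraceD rtraceZ (rtraceD Qp) (rtraceD _ T) (rtraceZ _ T1).
  exact: power_arith mu0 lam0 (kkt_power kkt) trQ.
exact: outer_rate_arith (ltW mu0) step1 step2 step3 step4 (logdet_inv pA1) (logdet_inv pA2).
Qed.

(** Images of (P1, P2) under uplink-downlink duality, written with resolvents: 1 >= T1 >= T makes
    both positive semidefinite, and [kkt_power] makes their traces add up to P. *)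
Definition bc_Qc : 'M[C]_n := cR lam^-1 *: (T1 - T).
Definition bc_Qp : 'M[C]_n := cR (mu / lam) *: (1%:M - T1).

Lemma psd_bc_Qc : psd bc_Qc.
Proof. by apply: psdZ _ T1T; rewrite invr_ge0 ltW. Qed.

Lemma psd_bc_Qp : psd bc_Qp.
Proof. by apply: psdZ _ T1_le1; rewrite divr_ge0 // ltW. Qed.

Lemma rtrace_bc : rtrace bc_Qp + rtrace bc_Qc = P.
Proof.
rewrite /bc_Qp /bc_Qc !rtraceZ !rtraceB rtrace1.
exact: bc_power_arith lam0 (kkt_power kkt).
Qed.

Let uA1 : A1 \in unitmx. Proof. exact: pd_unit. Qed.
Let uA2 : A2 \in unitmx. Proof. exact: pd_unit. Qed.

Let resolvent : T1 - T = T1 *m (ctr K *m P2 *m K) *m T.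
Proof.
have -> : ctr K *m P2 *m K = A2 - A1 by rewrite /A2 /mac2 addrAC subrr add0r.
by rewrite mulmxBr mulmxBl /T mulmxK // mulVmx // mul1mx.
Qed.

(** The resolvent identity and slackness of P2 turn K Qc K^* into K T1 K^* P2; Sylvester's identity
    then recognises det (T1 A2). *)
Lemma logdet_bc_K : logdet (1%:M + K *m bc_Qc *m ctr K) = logdet T1 - logdet T.
Proof.
have lamN0 : lam != 0 by rewrite gt_eqF.
have e : K *m bc_Qc *m ctr K = K *m T1 *m ctr K *m P2.
  rewrite /bc_Qc resolvent -scalemxAr -scalemxAl.
  have -> : K *m (T1 *m (ctr K *m P2 *m K) *m T) *m ctr K =
      K *m T1 *m ctr K *m (P2 *m (K *m T *m ctr K)) by rewrite !mulmxA.
  by rewrite (kkt_slack2 kkt) -scalemxAr scalerA cRM mulVf // scale1r.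
apply/eqP; rewrite eq_sym subr_eq eq_sym; apply/eqP.
have pX : pd (1%:M + K *m bc_Qc *m ctr K).
  by apply: pdD; [exact: pd1|apply: psd_conj; exact: psd_bc_Qc].
have dE : \det T1 = \det (1%:M + K *m bc_Qc *m ctr K) * \det T.
  have -> : T1 = T1 *m A2 *m T by rewrite /T mulmxK.
  rewrite det_mulmx; congr (_ * _); rewrite e -!mulmxA det_sylvester.
  by rewrite /A2 /mac2 mulmxDr mulVmx ?uA1 // !mulmxA.
rewrite /logdet dE (det_pd_Re pX) (det_pd_Re pT) !cRE -rmorphM /=.
by rewrite lnM ?posrE ?Re_det_gt0.
Qed.

(** Slackness of P1 gives P1 (1 + G Qc G^* ) = (mu / lam) P1 G T1 G^*, so that 1 + G (Qp + Qc) G^*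
    factors as (1 + G G^* P1) (1 + G Qc G^* ) and the interference factor cancels. *)
Lemma logdet_bc_G : logdet (1%:M + G *m (bc_Qp + bc_Qc) *m ctr G) -
  logdet (1%:M + G *m bc_Qc *m ctr G) = - logdet T1.
Proof.
have lamN0 : lam != 0 by rewrite gt_eqF.
have e1 : P1 *m (1%:M + G *m bc_Qc *m ctr G) = cR (mu / lam) *: (P1 *m (G *m T1 *m ctr G)).
  have := kkt_slack1 kkt; rewrite -/A1 -/A2 -/T1 -/T => sl.
  have {}sl : P1 *m (G *m T *m ctr G) =
      cR lam *: P1 - cR (mu - 1) *: (P1 *m (G *m T1 *m ctr G)).
    by rewrite -sl mulmxDr -scalemxAr [RHS]addrAC subrr add0r.
  rewrite /bc_Qc mulmxDr mulmx1 -scalemxAr -scalemxAl -scalemxAr mulmxBr mulmxBl mulmxBr.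
  exact: slack_arith lamN0 sl.
have e2 : G *m bc_Qp *m ctr G = G *m ctr G *m P1 *m (1%:M + G *m bc_Qc *m ctr G).
  rewrite -(mulmxA _ P1) e1 /bc_Qp -!scalemxAr -scalemxAl; congr (_ *: _).
  have -> : 1%:M - T1 = (A1 - 1%:M) *m T1 by rewrite mulmxBl mulmxV // mul1mx.
  by rewrite /A1 /mac1 addrAC subrr add0r !mulmxA.
have e3 : 1%:M + G *m (bc_Qp + bc_Qc) *m ctr G =
    (1%:M + G *m (ctr G *m P1)) *m (1%:M + G *m bc_Qc *m ctr G).
  rewrite mulmxDl mul1mx mulmxA -e2 mulmxDr mulmxDl.
  exact: addr_swap.
have pX : pd (1%:M + G *m bc_Qc *m ctr G).
  by apply: pdD; [exact: pd1|apply: psd_conj; exact: psd_bc_Qc].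
rewrite {1}/logdet e3 det_mulmx det_sylvester -/A1.
rewrite -/(mac1 G P1) -/A1 (det_pd_Re pX) (det_pd_Re pA1) !cRE -rmorphM /=.
rewrite lnM ?posrE ?Re_det_gt0 // -/(logdet _) logdet_inv // opprK.
by rewrite addrK.
Qed.

Lemma bc_rate_mac : mu * (logdet (1%:M + G *m (bc_Qp + bc_Qc) *m ctr G) -
    logdet (1%:M + G *m bc_Qc *m ctr G)) + logdet (1%:M + K *m bc_Qc *m ctr K) =
  mac_rate G K mu P1 P2.
Proof.
rewrite logdet_bc_G logdet_bc_K (logdet_inv pA1) (logdet_inv pA2).
exact: bc_rate_arith.
Qed.

End KKTConsequences.

(** * Existence of the dual optimum by compactness *)

Section ContinuousMatrices.
Variable R : realType.
Local Notation C := R[i].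
Variable X : topologicalType.

Definition ccont (f : X -> C) :=
  continuous (fun x => complex.Re (f x) : R) /\ continuous (fun x => complex.Im (f x) : R).

Lemma ccont_cst (c : C) : ccont (fun=> c).
Proof. by split=> x; exact: cvg_cst. Qed.

Lemma ccontD f g : ccont f -> ccont g -> ccont (fun x => f x + g x).
Proof.
move=> [f1 f2] [g1 g2]; split=> x.
- have -> : (fun x => complex.Re (f x + g x)) = (fun x => complex.Re (f x) + complex.Re (g x)).
    by apply: funext => y; case: (f y); case: (g y).
  by apply: cvgD; [exact: f1|exact: g1].
- have -> : (fun x => complex.Im (f x + g x)) = (fun x => complex.Im (f x) + complex.Im (g x)).
    by apply: funext => y; case: (f y); case: (g y).
  by apply: cvgD; [exact: f2|exact: g2].
Qed.

Lemma ccontM f g : ccont f -> ccont g -> ccont (fun x => f x * g x).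
Proof.
move=> [f1 f2] [g1 g2]; split=> x.
- have -> : (fun x => complex.Re (f x * g x)) =
    (fun x => complex.Re (f x) * complex.Re (g x) - complex.Im (f x) * complex.Im (g x)).
    by apply: funext => y; case: (f y); case: (g y).
  by apply: cvgB; apply: cvgM; (apply: f1 || apply: f2 || apply: g1 || apply: g2).
- have -> : (fun x => complex.Im (f x * g x)) =
    (fun x => complex.Re (f x) * complex.Im (g x) + complex.Im (f x) * complex.Re (g x)).
    by apply: funext => y; case: (f y); case: (g y).
  by apply: cvgD; apply: cvgM; (apply: f1 || apply: f2 || apply: g1 || apply: g2).
Qed.

Lemma ccont_conj f : ccont f -> ccont (fun x => (f x)^*).
Proof.
move=> [f1 f2]; split=> x.
- have -> : (fun x => complex.Re (f x)^*) = (fun x => complex.Re (f x)).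
    by apply: funext => y; rewrite conjE; case: (f y).
  exact: f1.
- have -> : (fun x => complex.Im (f x)^*) = (fun x => - complex.Im (f x)).
    by apply: funext => y; rewrite conjE; case: (f y).
  by apply: cvgN; exact: f2.
Qed.

Lemma ccont_sum (I : Type) (r : seq I) (P : pred I) (F : I -> X -> C) :
  (forall i, ccont (F i)) -> ccont (fun x => \sum_(i <- r | P i) F i x).
Proof.
move=> cF; elim: r => [|i r IH].
  by under eq_fun do rewrite big_nil; exact: ccont_cst.
under eq_fun do rewrite big_cons; case: (P i) => //.
exact: ccontD.
Qed.

Lemma ccont_prod (I : Type) (r : seq I) (P : pred I) (F : I -> X -> C) :
  (forall i, ccont (F i)) -> ccont (fun x => \prod_(i <- r | P i) F i x).
Proof.
move=> cF; elim: r => [|i r IH].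
  by under eq_fun do rewrite big_nil; exact: ccont_cst.
under eq_fun do rewrite big_cons; case: (P i) => //.
exact: ccontM.
Qed.

Definition mcont m n (F : X -> 'M[C]_(m, n)) := forall i j, ccont (fun x => F x i j).

Lemma mcont_cst m n (A : 'M[C]_(m, n)) : mcont (fun=> A).
Proof. by move=> i j; exact: ccont_cst. Qed.

Lemma mcontD m n (F F' : X -> 'M[C]_(m, n)) :
  mcont F -> mcont F' -> mcont (fun x => F x + F' x).
Proof. by move=> cF cG i j; under eq_fun do rewrite mxE; exact: ccontD. Qed.

Lemma mcontM m n p (F : X -> 'M[C]_(m, n)) (F' : X -> 'M[C]_(n, p)) :
  mcont F -> mcont F' -> mcont (fun x => F x *m F' x).
Proof.
move=> cF cG i j; under eq_fun do rewrite mxE.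
by apply: ccont_sum => k; exact: ccontM.
Qed.

Lemma mcont_ctr m n (F : X -> 'M[C]_(m, n)) : mcont F -> mcont (fun x => ctr (F x)).
Proof. by move=> cF i j; under eq_fun do rewrite ctrE; exact: ccont_conj. Qed.

Lemma ccont_det n (F : X -> 'M[C]_n) : mcont F -> ccont (fun x => \det (F x)).
Proof.
move=> cF; apply: ccont_sum => s; apply: ccontM; first exact: ccont_cst.
exact: ccont_prod.
Qed.

Lemma cont_logdet n (F : X -> 'M[C]_n) : mcont F -> (forall x, pd (F x)) ->
  continuous (fun x => logdet (F x)).
Proof.
move=> cF pF x; have [h _] := ccont_det cF.
suff : {for x, continuous (@ln R \o (fun x => complex.Re (\det (F x)) : R))} by [].
apply: continuous_comp; first exact: h.
exact/continuous_ln/Re_det_gt0.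
Qed.

Lemma cont_rtrace n (F : X -> 'M[C]_n) : mcont F -> continuous (fun x => rtrace (F x)).
Proof. by move=> cF; have [] := @ccont_sum _ (index_enum _) xpredT _ (fun i => cF i i). Qed.

End ContinuousMatrices.

Section MaximizerExists.
Variable R : realType.
Local Notation C := R[i].
Variables (n r1 r2 : nat) (G : 'M[C]_(r1, n)) (K : 'M[C]_(r2, n)) (mu P : R).
Hypotheses (P0 : 0 < P).

(** Writing P1 and P2 as L L^* with the entries of L as free real coordinates turns the semidefinite
    cone into a whole Euclidean space, where only the trace bound remains as a constraint. *)
Definition cplx_mx r (x : 'rV[R]_(r * r + r * r)) : 'M[C]_r :=
  \matrix_(i, j) Complex (x 0 (lshift _ (mxvec_index i j))) (x 0 (rshift _ (mxvec_index i j))).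

Lemma cplx_mx_surj r (L : 'M[C]_r) : exists x, cplx_mx x = L.
Proof.
exists (row_mx (mxvec (map_mx (@complex.Re R) L)) (mxvec (map_mx (@complex.Im R) L))).
apply/matrixP => i j; rewrite mxE row_mxEl row_mxEr !mxvecE !mxE.
by case: (L i j).
Qed.

Let N := (r1 * r1 + r1 * r1 + (r2 * r2 + r2 * r2))%N.
Let L1 (x : 'rV[R]_N) := cplx_mx (lsubmx x).
Let L2 (x : 'rV[R]_N) := cplx_mx (rsubmx x).

Let rtrace_cplx r (x : 'rV[R]_(r * r + r * r)) k :
  x 0 k ^+ 2 <= rtrace (cplx_mx x *m ctr (cplx_mx x)).
Proof.
rewrite rtrace_gram.
have nn i j : 0 <= complex.Re (`|cplx_mx x i j| ^+ 2) by rewrite Re_ge0 // exprn_ge0.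
have E i j : complex.Re (`|cplx_mx x i j| ^+ 2) =
   x 0 (lshift _ (mxvec_index i j)) ^+ 2 + x 0 (rshift _ (mxvec_index i j)) ^+ 2.
  by rewrite -add_Re2_Im2 mxE.
have le i j : complex.Re (`|cplx_mx x i j| ^+ 2) <=
    \sum_i \sum_j complex.Re (`|cplx_mx x i j| ^+ 2).
  rewrite (bigD1 i) //= (bigD1 j) //= -addrA lerDl.
  apply: addr_ge0; first by apply: sumr_ge0 => a _; exact: nn.
  by apply: sumr_ge0 => a _; apply: sumr_ge0 => b _; exact: nn.
case: (splitP k) => l kl.
  have -> : k = lshift _ l by apply: val_inj.
  case/mxvec_indexP: l {kl} => i j; apply: le_trans (le i j).
  by rewrite E lerDl sqr_ge0.
have -> : k = rshift _ l by apply: val_inj.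
case/mxvec_indexP: l {kl} => i j; apply: le_trans (le i j).
by rewrite E lerDr sqr_ge0.
Qed.

Let mcont1 : mcont L1.
Proof.
move=> i j; split=> x /=.
- under eq_fun do rewrite !mxE /=; exact: coord_continuous.
- under eq_fun do rewrite !mxE /=; exact: coord_continuous.
Qed.

Let mcont2 : mcont L2.
Proof.
move=> i j; split=> x /=.
- under eq_fun do rewrite !mxE /=; exact: coord_continuous.
- under eq_fun do rewrite !mxE /=; exact: coord_continuous.
Qed.

Let Q1 x := L1 x *m ctr (L1 x).
Let Q2 x := L2 x *m ctr (L2 x).

Lemma mac_optimal_exists : exists P1 P2, mac_optimal G K mu P P1 P2.
Proof.
have cQ1 : mcont Q1 by apply: mcontM => //; exact: mcont_ctr.
have cQ2 : mcont Q2 by apply: mcontM => //; exact: mcont_ctr.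
have p1 x : psd (Q1 x) by exact: psd_gram.
have p2 x : psd (Q2 x) by exact: psd_gram.
have cA1 : mcont (fun x => mac1 G (Q1 x)).
  apply: mcontD; first exact: mcont_cst.
  by do 2![apply: mcontM => //; try exact: mcont_cst].
have cA2 : mcont (fun x => mac2 G K (Q1 x) (Q2 x)).
  apply: mcontD => //.
  by do 2![apply: mcontM => //; try exact: mcont_cst].
pose f x := mac_rate G K mu (Q1 x) (Q2 x).
have cf : continuous f.
  have c1 := cont_logdet cA1 (fun y => pd_mac1 G (p1 y)).
  have c2 := cont_logdet cA2 (fun y => pd_mac2 G K (p1 y) (p2 y)).
  by move=> x; apply: cvgD (c2 x); exact: cvgM (cvg_cst _) (c1 x).
pose g x := rtrace (Q1 x) + rtrace (Q2 x).
have cg : continuous g.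
  by move=> x; exact: cvgD (@cont_rtrace _ _ _ _ cQ1 x) (@cont_rtrace _ _ _ _ cQ2 x).
(* The trace of L L^* is the sum of the squared coordinates, so the trace bound confines each
   coordinate to this interval. *)
pose A := [set v : 'rV[R]_N | forall i, `[- Num.sqrt P, Num.sqrt P]%classic (v 0 i)].
pose B := g @^-1` [set y | y <= P].
have cpt : compact (A `&` B).
  apply: compact_closedI.
    by apply: (@rV_compact _ _ (fun=> `[- Num.sqrt P, Num.sqrt P]%classic)) => i;
       exact: segment_compact.
  by apply: preimage_closed => [x _|]; [exact: cg|exact: closed_le].
have AB x : B x -> A x.
  move=> Bx i /=; rewrite in_itv /= -ler_norml -sqrtr_sqr ler_sqrt ?(ltW P0) //.
  apply: le_trans Bx; rewrite /g.
  have r1' := rtrace_psd (p1 x); have r2' := rtrace_psd (p2 x).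
  case: (splitP i) => l il.
    have -> : x 0 i = lsubmx x 0 l by rewrite mxE; congr (x _ _); exact: val_inj.
    by apply: le_trans (rtrace_cplx _ _) _; rewrite lerDl.
  have -> : x 0 i = rsubmx x 0 l by rewrite mxE; congr (x _ _); exact: val_inj.
  by apply: le_trans (rtrace_cplx _ _) _; rewrite lerDr.
have ne : (A `&` B) !=set0.
  have B0 : B 0.
    rewrite /B /preimage /= /g.
    have z r (y : 'rV[R]_(r * r + r * r)) : y = 0 -> cplx_mx y = 0.
      by move=> ->; apply/matrixP => i j; rewrite !mxE.
    rewrite /Q1 /Q2 /L1 /L2 !z ?mul0mx ?rtrace0 ?addr0 ?(ltW P0) //.
      by apply/rowP => i; rewrite !mxE.
    by apply/rowP => i; rewrite !mxE.
  by exists 0; split => //; exact: AB.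
have [c] := @compact_EVT_max _ _ f _ ne cpt (continuous_subspaceT cf).
rewrite inE => -[_ Bc] fmax; exists (Q1 c), (Q2 c); split; first by split.
move=> P1' P2' [/psd_factor[M1 ->] /psd_factor[M2 ->] tr].
have [x1 E1] := cplx_mx_surj M1; have [x2 E2] := cplx_mx_surj M2.
have Q1E : Q1 (row_mx x1 x2) = M1 *m ctr M1 by rewrite /Q1 /L1 row_mxKl E1.
have Q2E : Q2 (row_mx x1 x2) = M2 *m ctr M2 by rewrite /Q2 /L2 row_mxKr E2.
have Bx : B (row_mx x1 x2) by rewrite /B /preimage /= /g Q1E Q2E.
by have := fmax (row_mx x1 x2); rewrite inE /f Q1E Q2E; apply; split => //; exact: AB.
Qed.

End MaximizerExists.

(** * Random codebooks *)

Section UniformAverage.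
Variable R : realFieldType.

Definition avg (T : finType) (f : T -> R) : R := #|T|%:R^-1 * \sum_t f t.

Lemma avg_le (T : finType) (f g : T -> R) : (forall t, f t <= g t) -> avg f <= avg g.
Proof. by move=> h; rewrite ler_wpM2l ?invr_ge0 // ler_sum. Qed.

Lemma avgD (T : finType) (f g : T -> R) : avg (fun t => f t + g t) = avg f + avg g.
Proof. by rewrite /avg big_split mulrDr. Qed.

Lemma avg_sum (T : finType) (I : Type) (r : seq I) (P : pred I) (F : I -> T -> R) :
  avg (fun t => \sum_(i <- r | P i) F i t) = \sum_(i <- r | P i) avg (F i).
Proof. by rewrite /avg exchange_big mulr_sumr. Qed.

Lemma avg_cst (T : finType) (c : R) : (0 < #|T|)%N -> avg (fun _ : T => c) = c.
Proof.
by move=> T0; rewrite /avg sumr_const -[c *+ _]mulr_natl mulKf // pnatr_eq0 -lt0n.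
Qed.

Lemma avg_le_cst (T : finType) (f : T -> R) (c : R) :
  (0 < #|T|)%N -> (forall t, f t <= c) -> avg f <= c.
Proof. by move=> T0 h; rewrite -[leRHS](avg_cst c T0); exact: avg_le. Qed.

Lemma avg_exchange (S T : finType) (F : S -> T -> R) :
  avg (fun s => avg (F s)) = avg (fun t => avg (F^~ t)).
Proof.
rewrite /avg -!mulr_sumr exchange_big !mulr_sumr.
by apply: eq_bigr => t _; rewrite mulrCA.
Qed.

Lemma exists_le_avg (T : finType) (f : T -> R) : (0 < #|T|)%N -> exists t, f t <= avg f.
Proof.
move=> T0; apply: contrapT => H.
have {}H t : avg f < f t by rewrite ltNge; apply/negP => h; apply: H; exists t.
have [t0 _] : exists t0 : T, true by case/card_gt0P: T0 => t _; exists t.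
have : \sum_(t : T) avg f < \sum_t f t.
  by rewrite (bigD1 t0) //= [ltRHS](bigD1 t0) //= ltr_leD // ler_sum // => t _; exact: ltW.
rewrite sumr_const -[avg f *+ _]mulr_natl /avg mulVKf ?ltxx //.
by rewrite pnatr_eq0 -lt0n.
Qed.

Definition upd (I T : finType) (f : {ffun I -> T}) i t : {ffun I -> T} :=
  [ffun j => if j == i then t else f j].

Lemma upd_same (I T : finType) (f : {ffun I -> T}) i t : upd f i t i = t.
Proof. by rewrite ffunE eqxx. Qed.

Lemma upd_other (I T : finType) (f : {ffun I -> T}) i t j : j != i -> upd f i t j = f j.
Proof. by rewrite ffunE => /negPf->. Qed.

(** Exchanging t with the i-th value of f is an involution on pairs (f, t). Resampling one codeword
    thus expresses its independence of the others. *)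
Lemma avg_resample (I T : finType) (i : I) (F : {ffun I -> T} -> R) : (0 < #|T|)%N ->
  avg F = avg (fun f => avg (fun t => F (upd f i t))).
Proof.
move=> T0; pose h (p : {ffun I -> T} * T) := (upd p.1 i p.2, p.1 i).
have hK : involutive h.
  move=> [f t]; rewrite /h /= upd_same; congr (_, _).
  by apply/ffunP => j; rewrite !ffunE; case: eqP => // ->.
have E : \sum_(p : {ffun I -> T} * T) F (upd p.1 i p.2) = #|T|%:R * \sum_f F f.
  transitivity (\sum_(p : {ffun I -> T} * T) F p.1).
    by rewrite [RHS](reindex_inj (inv_inj hK)).
  rewrite -(pair_bigA _ (fun f (_ : T) => F f)) /= mulr_sumr; apply: eq_bigr => f _.
  by rewrite sumr_const mulr_natl.
rewrite /avg -mulr_sumr (pair_bigA _ (fun f t => F (upd f i t))) /= E mulKf //.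
by rewrite pnatr_eq0 -lt0n.
Qed.

Lemma avg_coord (I T : finType) (i : I) (g : T -> R) : (0 < #|T|)%N ->
  avg (fun f : {ffun I -> T} => g (f i)) = avg g.
Proof.
move=> T0; rewrite (avg_resample i) //.
have I0 : (0 < #|{ffun I -> T}|)%N by rewrite card_ffun expn_gt0 T0.
rewrite -[RHS](avg_cst _ I0); congr (_ * _); apply: eq_bigr => f _.
by congr (_ * _); apply: eq_bigr => t _; rewrite upd_same.
Qed.

End UniformAverage.

Section RandomCodebook.
Variable R : realFieldType.
Variables (A U : finType) (X : Type) (good : A -> U -> bool) (word : A -> U -> X) (x0 : X).
Variables (p1 : A -> X -> R) (p2 : U -> X -> R) (k1 k2 rho : R) (M1 M2 L : nat).
Hypotheses (A0 : (0 < #|A|)%N) (U0 : (0 < #|U|)%N).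
Hypothesis hp1 : forall x, avg (p1^~ x) <= k1.
Hypothesis hp2 : forall x, avg (p2^~ x) <= k2.
Hypothesis hgood : forall a, rho <= avg (fun u => (good a u)%:R).

(** A row is the bin of one message of user 2; the encoder, knowing user 1's word a, looks there for
    a word compatible with it. *)
Definition sel (a : A) (row : {ffun 'I_L -> U}) := [pick l | good a (row l)].

Definition cword a row := if sel a row is Some l then word a (row l) else x0.

(** Upper bounds for the error: a unit charge when the bin offers no compatible word, plus a union
    bound over wrong codewords. [p1 a x] and [p2 u x] stand for the chance that a word passes its
    test when x is sent. *)
Definition cost1 (c : {ffun 'I_M1 -> A}) (b : {ffun 'I_M2 -> {ffun 'I_L -> U}}) m1 m2 : R :=
  (sel (c m1) (b m2) == None)%:R +
  \sum_(m | m != m1) p1 (c m) (cword (c m1) (b m2)).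

Definition cost2 (c : {ffun 'I_M1 -> A}) (b : {ffun 'I_M2 -> {ffun 'I_L -> U}}) m1 m2 : R :=
  (sel (c m1) (b m2) == None)%:R +
  \sum_(m | m != m2) \sum_l p2 (b m l) (cword (c m1) (b m2)).

Let row0 : (0 < #|{ffun 'I_L -> U}|)%N. Proof. by rewrite card_ffun expn_gt0 U0. Qed.
Let cb0 : (0 < #|{ffun 'I_M1 -> A}|)%N. Proof. by rewrite card_ffun expn_gt0 A0. Qed.
Let bb0 : (0 < #|{ffun 'I_M2 -> {ffun 'I_L -> U}}|)%N.
Proof. by rewrite card_ffun expn_gt0 row0. Qed.

Lemma avg_all (T : finType) (P : pred T) : (0 < #|T|)%N ->
  avg (fun row : {ffun 'I_L -> T} => [forall l, P (row l)]%:R : R) =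
  (avg (fun t => (P t)%:R)) ^+ L.
Proof.
move=> T0; rewrite /avg.
have -> : \sum_(row : {ffun 'I_L -> T}) ([forall l, P (row l)])%:R =
    (\sum_t (P t)%:R) ^+ L :> R.
  rewrite -[in RHS](card_ord L) -prodr_const bigA_distr_bigA /=.
  apply: eq_bigr => f _; case: forallP => [h|h].
    by rewrite big1 // => i _; rewrite h.
  have /existsP[l] : [exists l, ~~ P (f l)].
    by rewrite -negb_forall; apply/negP => /forallP.
  by move=> /negPf nP; rewrite (bigD1 l) //= nP mul0r.
by rewrite card_ffun card_ord natrX exprMn exprVn.
Qed.

Lemma avg_miss a : avg (fun row => (sel a row == None)%:R) <= (1 - rho) ^+ L :> R.
Proof.
have -> : (fun row => (sel a row == None)%:R : R) =
    (fun row => [forall l, ~~ good a (row l)]%:R).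
  apply: funext => row; congr (_%:R); rewrite /sel; case: pickP => [l h|h].
    by case: forallP => [/(_ l)|//]; rewrite h.
  by rewrite eqxx; apply/esym/eqP; rewrite eqb1; apply/forallP => l; rewrite h.
rewrite (@avg_all _ (fun u => ~~ good a u)) //.
have -> : avg (fun u => (~~ good a u)%:R) = 1 - avg (fun u => (good a u)%:R) :> R.
  apply/eqP; rewrite eq_sym subr_eq -avgD eq_sym; apply/eqP.
  rewrite -[RHS](avg_cst 1 U0); congr (_ * _); apply: eq_bigr => u _.
  by case: good; rewrite ?addr0 ?add0r.
rewrite lerXn2r ?nnegrE ?lerB //.
  rewrite subr_ge0; apply: avg_le_cst => // u; by case: good; rewrite ?lexx ?ler01.
rewrite subr_ge0; apply: le_trans (hgood a) _.
by apply: avg_le_cst => // u; case: good; rewrite ?lexx ?ler01.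
Qed.

Lemma sum_neq_le m (i : 'I_m) (F : 'I_m -> R) (c : R) :
  (forall j, j != i -> F j <= c) -> \sum_(j | j != i) F j <= m.-1%:R * c.
Proof.
move=> h; apply: (@le_trans _ _ (\sum_(j | j != i) c)); first exact: ler_sum.
by rewrite sumr_const cardC1 card_ord mulr_natl.
Qed.

(** The transmitted word depends on [c m1] and [b m2] only, so a wrong codeword can be resampled
    without changing it, and [hp1] or [hp2] applies to the resampled one. *)
Let avg_cost1 m1 m2 :
  avg (fun c => avg (fun b => cost1 c b m1 m2)) <= (1 - rho) ^+ L + M1.-1%:R * k1.
Proof.
rewrite /cost1.
have -> : avg (fun c : {ffun 'I_M1 -> A} =>
    avg (fun b : {ffun 'I_M2 -> {ffun 'I_L -> U}} => (sel (c m1) (b m2) == None)%:R +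
    \sum_(m | m != m1) p1 (c m) (cword (c m1) (b m2)))) =
  avg (fun c : {ffun 'I_M1 -> A} => avg (fun b : {ffun 'I_M2 -> {ffun 'I_L -> U}} =>
    (sel (c m1) (b m2) == None)%:R)) +
  avg (fun b : {ffun 'I_M2 -> {ffun 'I_L -> U}} => avg (fun c : {ffun 'I_M1 -> A} =>
    \sum_(m | m != m1) p1 (c m) (cword (c m1) (b m2)))).
  rewrite [X in _ = _ + X]avg_exchange -avgD; congr (_ * _); apply: eq_bigr => c _.
  exact: avgD.
apply: lerD; [apply: avg_le_cst => // c|apply: avg_le_cst => // b].
  by rewrite (avg_coord m2 (fun row => (sel (c m1) row == None)%:R)) // avg_miss.
rewrite avg_sum; apply: sum_neq_le => m mm1; rewrite (avg_resample m) //.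
apply: avg_le_cst => // c.
rewrite /avg; under eq_bigr => a _ do rewrite upd_same upd_other 1?eq_sym //.
exact: hp1.
Qed.

Let avg_cost2 m1 m2 :
  avg (fun c => avg (fun b => cost2 c b m1 m2)) <= (1 - rho) ^+ L + (M2.-1 * L)%:R * k2.
Proof.
rewrite /cost2; apply: avg_le_cst => // c; rewrite avgD; apply: lerD.
  by rewrite (avg_coord m2 (fun row => (sel (c m1) row == None)%:R)) // avg_miss.
rewrite avg_sum natrM -mulrA; apply: sum_neq_le => m mm2.
rewrite avg_sum; apply: (@le_trans _ _ (\sum_(l < L) k2)); last first.
  by rewrite sumr_const card_ord mulr_natl.
apply: ler_sum => l _; rewrite (avg_resample m) //; apply: avg_le_cst => // b.
rewrite {1}/avg; under eq_bigr => row _ do rewrite upd_same upd_other 1?eq_sym //.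
by rewrite -/(avg _) (avg_coord l (p2^~ _)).
Qed.

(** Averaging the sum of the two costs yields a single codebook that serves both users; the miss
    term is counted once for each, whence the 2. *)
Lemma good_codebook : exists c b,
  \sum_m1 \sum_m2 (cost1 c b m1 m2 + cost2 c b m1 m2) <=
  (M1 * M2)%:R * (2 * (1 - rho) ^+ L + M1.-1%:R * k1 + (M2.-1 * L)%:R * k2).
Proof.
pose F c b := \sum_m1 \sum_m2 (cost1 c b m1 m2 + cost2 c b m1 m2).
have [c hc] := exists_le_avg (fun c => avg (F c)) cb0.
have [b hb] := exists_le_avg (F c) bb0.
exists c, b; apply: le_trans hb (le_trans hc _); rewrite /F.
have -> : avg (fun c => avg (fun b =>
      \sum_m1 \sum_m2 (cost1 c b m1 m2 + cost2 c b m1 m2))) =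
   \sum_m1 \sum_m2 (avg (fun c => avg (fun b => cost1 c b m1 m2)) +
                    avg (fun c => avg (fun b => cost2 c b m1 m2))).
  transitivity (avg (fun c => \sum_m1 \sum_m2
      (avg (fun b => cost1 c b m1 m2) + avg (fun b => cost2 c b m1 m2)))).
    congr (_ * _); apply: eq_bigr => c' _; rewrite avg_sum; apply: eq_bigr => m1 _.
    by rewrite avg_sum; apply: eq_bigr => m2 _; rewrite avgD.
  rewrite avg_sum; apply: eq_bigr => m1 _; rewrite avg_sum.
  by apply: eq_bigr => m2 _; rewrite avgD.
apply: (@le_trans _ _ (\sum_(m1 < M1) \sum_(m2 < M2)
  (2 * (1 - rho) ^+ L + M1.-1%:R * k1 + (M2.-1 * L)%:R * k2))).
  apply: ler_sum => m1 _; apply: ler_sum => m2 _.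
  apply: le_trans (lerD (avg_cost1 m1 m2) (avg_cost2 m1 m2)) _.
  by move: (_ ^+ _) (_ * _) (_ * _) => x y z; lra.
under eq_bigr do rewrite sumr_const card_ord.
by rewrite sumr_const card_ord -mulrnA (mulnC M2 M1) [leRHS]mulr_natl.
Qed.

End RandomCodebook.

(** * Moments and lattice Gaussians *)

Section MomentCalculus.
Variables (R : realFieldType) (Om : Type) (K : finType) (xi : Om -> K -> R).
(* hasE f r: f is integrable with expectation r *)
Variables (hasE : (Om -> R) -> R -> Prop) (M : nat -> R).

(** The calculus is instantiated twice, by weighted lattice words and by the noise. Exponents up to
    4 suffice: the Gram statistics are products of two variables, and their variance squares
    them. *)
Definition mon (m : K -> nat) w := \prod_k xi w k ^+ m k.
Definition mom (m : K -> nat) := \prod_k M (m k).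

Hypothesis hasED : forall f g a b, hasE f a -> hasE g b ->
  hasE (fun w => f w + g w) (a + b).
Hypothesis hasEZ : forall c f a, hasE f a -> hasE (fun w => c * f w) (c * a).
Hypothesis hasE_mon : forall m, (forall k, (m k <= 4)%N) -> hasE (mon m) (mom m).
Hypothesis M0 : M 0%N = 1.

Lemma monD m m' w : mon m w * mon m' w = mon (fun k => m k + m' k)%N w.
Proof. by rewrite -big_split; apply: eq_bigr => k _; rewrite exprD. Qed.

Lemma mon0 w : mon (fun=> 0%N) w = 1.
Proof. by rewrite /mon big1 // => k _; rewrite expr0. Qed.

Lemma mom0 : mom (fun=> 0%N) = 1.
Proof. by rewrite /mom big1. Qed.

Lemma mom_disjoint m m' : (forall k, m k = 0%N \/ m' k = 0%N) ->
  mom (fun k => m k + m' k)%N = mom m * mom m'.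
Proof.
move=> d; rewrite -big_split; apply: eq_bigr => k _ /=.
by case: (d k) => ->; rewrite ?add0n ?addn0 M0 ?mul1r ?mulr1.
Qed.

Lemma hasE1 : hasE (fun=> 1) 1.
Proof.
have -> : (fun=> 1) = mon (fun=> 0%N) by apply: funext => w; rewrite mon0.
by rewrite -mom0; exact: hasE_mon.
Qed.

Lemma hasE_sum (I : Type) (r : seq I) (P : pred I) (F : I -> Om -> R) (a : I -> R) :
  (forall i, hasE (F i) (a i)) ->
  hasE (fun w => \sum_(i <- r | P i) F i w) (\sum_(i <- r | P i) a i).
Proof.
move=> h; elim: r => [|i r IH].
  rewrite big_nil -[X in hasE _ X](mul0r 1).
  by under eq_fun do rewrite big_nil -(mul0r 1); exact: hasEZ hasE1.
rewrite big_cons; under eq_fun do rewrite big_cons.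
by case: (P i) => //; exact: hasED.
Qed.

Lemma hasE_covariance m m' : (forall k, (m k <= 2)%N) -> (forall k, (m' k <= 2)%N) ->
  hasE (fun w => (mon m w - mom m) * (mon m' w - mom m'))
       (mom (fun k => m k + m' k)%N - mom m * mom m').
Proof.
move=> b b'.
have le4 (u : K -> nat) : (forall k, (u k <= 2)%N) -> forall k, (u k <= 4)%N.
  by move=> h k; exact: leq_trans (h k) _.
have E2 : hasE (mon (fun k => m k + m' k)%N) (mom (fun k => m k + m' k)%N).
  by apply: hasE_mon => k; rewrite (leq_add (b k) (b' k)).
have := hasED (hasED E2 (hasEZ (- mom m') (hasE_mon (le4 _ b))))
  (hasED (hasEZ (- mom m) (hasE_mon (le4 _ b'))) (hasEZ (mom m * mom m') hasE1)).
set f := (fun w => _) ; set r := _ + _ => h.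
have -> : mom (fun k => m k + m' k)%N - mom m * mom m' = r by rewrite /r; ring.
suff -> : (fun w => (mon m w - mom m) * (mon m' w - mom m')) = f by [].
by apply: funext => w; rewrite /f -monD; ring.
Qed.

(** Monomials in disjoint variables are uncorrelated, so only the diagonal of the double sum
    survives. *)
Lemma hasE_variance n (m : 'I_n -> K -> nat) (c : 'I_n -> R) (V : R) :
  (forall i k, (m i k <= 2)%N) ->
  (forall i j, i != j -> forall k, m i k = 0%N \/ m j k = 0%N) ->
  (forall i, mom (fun k => m i k + m i k)%N - mom (m i) ^+ 2 <= V) ->
  exists2 v, hasE (fun w => (\sum_i c i * (mon (m i) w - mom (m i))) ^+ 2) v &
             v <= V * \sum_i c i ^+ 2.
Proof.
move=> b d hV.
have cov i j := hasE_covariance (b i) (b j).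
have S i := hasE_sum (index_enum 'I_n) xpredT (fun j => hasEZ (c i * c j) (cov i j)).
have := hasE_sum (index_enum 'I_n) xpredT S; set v := \sum_i _.
set f := (fun w => _) => h; exists v.
  suff -> : (fun w => (\sum_i c i * (mon (m i) w - mom (m i))) ^+ 2) = f by [].
  apply: funext => w; rewrite expr2 big_distrlr /=.
  by apply: eq_bigr => i _; apply: eq_bigr => j _; ring.
rewrite /v mulr_sumr; apply: ler_sum => i _; rewrite (bigD1 i) //= big1 ?addr0.
  by rewrite -!expr2 mulrC ler_wpM2r ?sqr_ge0.
by move=> j ji; rewrite mom_disjoint ?subrr ?mulr0 //; apply: d; rewrite eq_sym.
Qed.

End MomentCalculus.

Section FiniteProduct.
Variables (R : realFieldType) (K T : finType) (w x : T -> R).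
Hypotheses (w0 : forall t, 0 < w t) (T0 : (0 < #|T|)%N).

Definition total := \sum_t w t.
Definition fmoment j := total^-1 * \sum_t w t * x t ^+ j.
Definition weight (f : {ffun K -> T}) := \prod_k w (f k).
(** Expectation under the product weights, with the normalisation kept on the right so that later
    bounds are already in units of [total ^+ #|K|]. *)
Definition fhasE (F : {ffun K -> T} -> R) r :=
  \sum_f weight f * F f = total ^+ #|K| * r.

Lemma total_gt0 : 0 < total.
Proof.
case/card_gt0P: T0 => t _; rewrite /total (bigD1 t) //= ltr_pwDl //.
by apply: sumr_ge0 => s _; exact: ltW.
Qed.

Lemma weight_gt0 f : 0 < weight f. Proof. exact: prodr_gt0. Qed.

Lemma sum_weight : \sum_f weight f = total ^+ #|K|.
Proof. by rewrite /weight -(bigA_distr_bigA (fun (_ : K) t => w t)) prodr_const. Qed.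

Lemma fhasED F G a b : fhasE F a -> fhasE G b -> fhasE (fun f => F f + G f) (a + b).
Proof.
rewrite /fhasE mulrDr => <- <-; rewrite -big_split.
by apply: eq_bigr => f _; rewrite mulrDr.
Qed.

Lemma fhasEZ c F a : fhasE F a -> fhasE (fun f => c * F f) (c * a).
Proof.
rewrite /fhasE mulrCA => <-; rewrite mulr_sumr.
by apply: eq_bigr => f _; rewrite mulrCA.
Qed.

Lemma fhasE_mon m : fhasE (mon (fun (f : {ffun K -> T}) k => x (f k)) m) (mom fmoment m).
Proof.
rewrite /fhasE /mon /mom /weight.
transitivity (\sum_(f : {ffun K -> T}) \prod_k (w (f k) * x (f k) ^+ m k)).
  by apply: eq_bigr => f _; rewrite big_split.
rewrite -(bigA_distr_bigA (fun k t => w t * x t ^+ m k)) -prodr_const -big_split /=.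
by apply: eq_bigr => k _; rewrite mulVKf // gt_eqF ?total_gt0.
Qed.

Lemma fmoment0 : fmoment 0%N = 1.
Proof.
rewrite /fmoment; under eq_bigr do rewrite expr0 mulr1.
by rewrite mulVf // gt_eqF ?total_gt0.
Qed.

Lemma chebyshev_weight (F : {ffun K -> T} -> R) v t : 0 < t ->
  fhasE (fun f => F f ^+ 2) v ->
  \sum_(f | t < `|F f|) weight f <= total ^+ #|K| * (v / t ^+ 2).
Proof.
move=> t0 h; rewrite mulrA ler_pdivlMr ?exprn_gt0 // -h mulr_suml.
rewrite [leRHS](bigID (fun f => t < `|F f|)) /= -[leLHS]addr0 lerD //.
  apply: ler_sum => f tf; rewrite ler_wpM2l ?(ltW (weight_gt0 f)) //.
  by rewrite -[F f ^+ 2]real_normK ?num_real // lerXn2r ?nnegrE ?(ltW t0) // ltW.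
by apply: sumr_ge0 => f _; rewrite mulr_ge0 ?sqr_ge0 // ltW // weight_gt0.
Qed.

End FiniteProduct.

Section GaussianCells.
Variable R : realType.
Local Notation lebesgue := (@lebesgue_measure R).

(** With variance 1/2 per real coordinate the density is a multiple of exp(- x^2), the same form as
    the lattice weights [gw]. *)
Definition nsd : R := Num.sqrt 2^-1.

Lemma nsd_neq0 : nsd != 0.
Proof. by rewrite gt_eqF // sqrtr_gt0 invr_gt0. Qed.

Lemma nsd2 : nsd ^+ 2 *+ 2 = 1.
Proof. by rewrite sqr_sqrtr ?invr_ge0 // -mulr_natr mulVf. Qed.

Local Notation c0 := (normal_peak nsd).
Local Notation gauss := (normal_prob (0 : R) nsd).

Lemma peak_gt0 : 0 < c0. Proof. exact/normal_peak_gt0/nsd_neq0. Qed.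

Lemma gauss_pdfE x : normal_pdf 0 nsd x = c0 * expR (- x ^+ 2).
Proof. by rewrite normal_pdfE ?nsd_neq0 // /normal_fun subr0 nsd2 divr1. Qed.

(** The exponent - y^2 lies below its tangent at x, which on the cell rises by at most 2 a |x|. *)
Lemma gauss_cell_le (x a : R) : 0 < a ->
  (gauss `[(x - a)%R, (x + a)%R[%classic <=
   (2 * a * c0 * expR (- x ^+ 2) * expR (2 * a * `|x|))%:E)%E.
Proof.
move=> a0; rewrite /normal_prob.
apply: (@le_trans _ _ (\int[lebesgue]_(y in `[(x - a)%R, (x + a)%R[)
   (c0 * expR (- x ^+ 2) * expR (2 * a * `|x|))%:E)%E).
  apply: ge0_le_integral => //=.
  - by move=> y _; rewrite lee_fin normal_pdf_ge0.
  - by apply/measurable_EFinP; apply: measurable_funTS; exact: measurable_normal_pdf.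
  - move=> y; rewrite in_itv /= => /andP[y1 y2]; rewrite lee_fin gauss_pdfE -mulrA.
    rewrite ler_pM2l ?peak_gt0 // -expRD ler_expR.
    have hn : `|y - x| <= a by rewrite ler_norml; apply/andP; split; lra.
    have e : - y ^+ 2 <= - x ^+ 2 + 2 * - (x * (y - x)).
      by rewrite -subr_ge0 (_ : _ - _ = (y - x) ^+ 2) ?sqr_ge0 //; ring.
    apply: (le_trans e); rewrite lerD2l -mulrA ler_pM2l //.
    apply: le_trans (ler_norm _) _; rewrite normrN normrM mulrC.
    by rewrite ler_wpM2r.
rewrite integral_cst //= lebesgue_measure_itv /= lte_fin.
have -> : (x - a < x + a)%R by lra.
rewrite -EFinB -EFinM lee_fin le_eqVlt; apply/orP; left; apply/eqP; ring.
Qed.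

(* The affine minorant of the Gaussian density at the centre of the cell integrates to
   its central value. *)
Lemma gauss_cell_ge (x a : R) : 0 < a ->
  ((2 * a * c0 * expR (- x ^+ 2) * (1 - a ^+ 2))%:E <=
   gauss `[(x - a)%R, (x + a)%R[%classic)%E.
Proof.
move=> a0; rewrite /normal_prob integral_itv_bndo_bndc; last first.
  apply/measurable_EFinP; apply: measurable_funTS; exact: measurable_normal_pdf.
pose k := c0 * expR (- x ^+ 2).
have k0 : 0 < k by rewrite mulr_gt0 ?peak_gt0 ?expR_gt0.
pose f (y : R) : R := k * (1 - a ^+ 2 - 2 * x * (y - x)).
pose F (y : R) : R := k * ((1 - a ^+ 2) * (y - x) - x * (y - x) ^+ 2).
have xa : x - a < x + a by lra.
have cf : continuous f.
  move=> y; apply: cvgM; first exact: cvg_cst.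
  apply: cvgB; first exact: cvg_cst.
  apply: cvgM; first exact: cvg_cst.
  by apply: cvgB; [exact: cvg_id|exact: cvg_cst].
have dF (y : R) : is_derive y 1 F (f y).
  rewrite /F; apply: is_derive_eq; rewrite /f /GRing.scale /=; ring.
have E : (\int[lebesgue]_(y in `[(x - a)%R, (x + a)%R]) (f y)%:E =
    (F (x + a))%:E - (F (x - a))%:E)%E.
  apply: continuous_FTC2 => //.
  - by apply: continuous_subspaceT.
  - split.
    + by move=> y _; have [] := dF y.
    + apply: cvg_at_right_filter; apply/differentiable_continuous/derivable1_diffP.
      by have [] := dF (x - a).
    + apply: cvg_at_left_filter; apply/differentiable_continuous/derivable1_diffP.
      by have [] := dF (x + a).
  - by move=> y _; rewrite derive1E; apply: derive_val.
have -> : 2 * a * c0 * expR (- x ^+ 2) * (1 - a ^+ 2) = F (x + a) - F (x - a).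
  by rewrite /F /k; ring.
rewrite EFinB -E; apply: le_integral => //.
- apply: continuous_compact_integrable; first exact: segment_compact.
  exact: continuous_subspaceT.
- apply: (integrableS _ _ (subsetT _)) => //; exact: integrable_normal_pdf.
move=> y; rewrite inE /= in_itv /= => /andP[y1 y2]; rewrite lee_fin gauss_pdfE /f /k -mulrA.
rewrite ler_pM2l ?peak_gt0 //.
have -> : - y ^+ 2 = - x ^+ 2 + (- (y - x) ^+ 2 - 2 * x * (y - x)) by ring.
rewrite expRD ler_pM2l ?expR_gt0 //.
apply: le_trans (expR_ge1Dx _).
have : (y - x) ^+ 2 <= a ^+ 2 by nra.
lra.
Qed.

Lemma gauss_cells (y0 s : R) m : 0 <= s ->
  (\sum_(k < m) gauss `[(y0 + s * k%:R)%R, (y0 + s * k.+1%:R)%R[%classic =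
   gauss `[y0, (y0 + s * m%:R)%R[%classic)%E.
Proof.
move=> s0; elim: m => [|m IH].
  by rewrite big_ord0 mulr0 addr0 set_itvco0 measure0.
rewrite big_ord_recr /= IH -measureU //.
  congr (gauss _); apply/seteqP; split => z /=; rewrite !in_itv /=.
    case=> /andP[h1 h2]; rewrite -natr1 mulrDr mulr1.
      by rewrite h1 /=; lra.
    have : 0 <= s * m%:R by rewrite mulr_ge0.
    by move: h2; rewrite -natr1 mulrDr mulr1 => h2 h3; apply/andP; split; lra.
  move=> /andP[h1 h2]; case: (ltP z (y0 + s * m%:R)) => h3.
    by left; rewrite h1.
  by right.
by apply/seteqP; split => // z /=; rewrite !in_itv /= => -[/andP[_ h1] /andP[h2 _]]; lra.
Qed.

Lemma gauss_mass (d : R) : 0 < d ->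
  exists2 X : R, 0 < X & ((1 - d)%:E <= gauss `[(- X)%R, X[%classic)%E.
Proof.
move=> d0; pose F n : set R := `[(- n%:R)%R, n%:R[%classic.
have mF n : measurable (F n) by exact: measurable_itv.
have FT : \bigcup_n F n = setT.
  apply/seteqP; split => // x _; exists (Num.truncn `|x|).+1 => //.
  have := truncnS_gt `|x|; rewrite /F /= in_itv /= ltr_norml => /andP[h1 h2].
  by rewrite (ltW h1).
have mono : nondecreasing_seq F.
  move=> m n mn; apply/subsetPset => x; rewrite /F /= !in_itv /= => /andP[h1 h2].
  have mn' : m%:R <= n%:R :> R by rewrite ler_nat.
  by rewrite (le_trans _ h1) ?lerN2 // (lt_le_trans h2).
have := @nondecreasing_cvg_mu _ _ _ gauss F mF _ mono.
rewrite FT => /(_ measurableT).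
rewrite [X in _ --> X](_ : _ = 1%E); last exact: probability_setT.
move=> cv.
have : \forall n \near \oo, ((1 - d)%:E < gauss (F n))%E.
  apply: (cv [set y | ((1 - d)%:E < y)%E]); apply: open_nbhs_nbhs; split; last by rewrite /= lte_fin; lra.
  exact: open_ereal_gt_ereal.
move=> [n0 _ /(_ n0.+1)]; rewrite /= leqnSn => /(_ isT) h.
by exists n0.+1%:R => //; exact: ltW.
Qed.

(** The points of h Z in [- h N, h N]; indices run from 0 to 2 N, and reversing them changes the
    sign. *)
Definition lat (h : R) (N : nat) (k : 'I_(N.*2.+1)) : R := h * (k%:R - N%:R).

(** After division by sqrt e the cells of width h / sqrt e around the points tile an interval, whose
    Gaussian mass is at most 1; [gauss_cell_ge] bounds each cell from below. Neither c nor N enters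
    the bound. *)
Lemma theta_le (h c e : R) N : 0 < h -> 0 < e ->
  h * c0 * (1 - h ^+ 2 / (4 * e)) * (\sum_k expR (- (@lat h N k - c) ^+ 2 / e)) <= Num.sqrt e.
Proof.
move=> h0 e0; have se0 : 0 < Num.sqrt e by rewrite sqrtr_gt0.
have see : Num.sqrt e ^+ 2 = e by rewrite sqr_sqrtr // ltW.
have seN : Num.sqrt e != 0 by rewrite gt_eqF.
pose s := h / Num.sqrt e; have s0 : 0 < s by rewrite divr_gt0.
pose x k := @lat h N k / Num.sqrt e - c / Num.sqrt e.
pose y0 := - (s * N%:R) - c / Num.sqrt e - s / 2.
have cells := gauss_cells y0 N.*2.+1 (ltW s0).
have le1 : (gauss `[y0, (y0 + s * N.*2.+1%:R)%R[%classic <= 1)%E.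
  exact: probability_le1.
have : (\sum_(k < N.*2.+1) (s * c0 * expR (- x k ^+ 2) * (1 - s ^+ 2 / 4))%:E <= 1)%E.
  apply: le_trans le1; rewrite -cells; apply: lee_sum => k _.
  have -> : y0 + s * k%:R = x k - s / 2 by rewrite /y0 /x /lat /s; field.
  have -> : y0 + s * k.+1%:R = x k + s / 2.
    by rewrite /y0 /x /lat /s -natr1; field.
  apply: le_trans (gauss_cell_ge (x k) (divr_gt0 s0 (ltr0n _ 2))).
  rewrite lee_fin le_eqVlt; apply/orP; left; apply/eqP; by field.
rewrite sumEFin lee_fin => H.
have E : \sum_(k < N.*2.+1) s * c0 * expR (- x k ^+ 2) * (1 - s ^+ 2 / 4) =
   s * c0 * (1 - s ^+ 2 / 4) * \sum_k expR (- (@lat h N k - c) ^+ 2 / e).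
  rewrite mulr_sumr; apply: eq_bigr => k _; rewrite mulrAC; congr (_ * expR _).
  by rewrite /x -mulrBl exprMn exprVn see mulNr.
rewrite E in H; have := ler_wpM2l (ltW se0) H; rewrite mulr1.
have -> : Num.sqrt e * (s * c0 * (1 - s ^+ 2 / 4) *
    (\sum_k expR (- (@lat h N k - c) ^+ 2 / e))) =
  h * c0 * (1 - h ^+ 2 / (4 * e)) * (\sum_k expR (- (@lat h N k - c) ^+ 2 / e)).
  rewrite /s; move: (\sum_k _) => S; rewrite -[X in 4 * X]see; by field.
by [].
Qed.

Definition theta h N : R := \sum_k expR (- @lat h N k ^+ 2).

(** The cells cover [- X, X[, which carries almost all the mass. N is chosen with X <= h N <= X + 1,
    so the tilt in [gauss_cell_le] is at most exp(h (X + 1)). *)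
Lemma theta_ge (d : R) : 0 < d -> exists2 X : R, 0 < X &
  forall h, 0 < h <= 1 -> exists N, 1 - d <= h * c0 * expR (h * X) * theta h N.
Proof.
move=> d0; have [X X0 hX] := gauss_mass d0; exists (X + 1); first by rewrite addr_gt0.
move=> h /andP[h0 h1].
have [N [hN1 hN2]] : exists N, X <= h * N%:R /\ h * N%:R <= X + 1.
  exists (Num.truncn (X / h)).+1; split.
    by rewrite mulrC -ler_pdivrMr // ltW // truncnS_gt.
  rewrite -natr1 mulrDr mulr1 lerD // mulrC -ler_pdivlMr //.
  by rewrite truncn_le // divr_ge0 // ltW.
exists N.
pose y0 := - (h * N%:R) - h / 2.
have cells := gauss_cells y0 N.*2.+1 (ltW h0).
have ye : y0 + h * N.*2.+1%:R = h * N%:R + h / 2.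
  by rewrite /y0 -[N.*2.+1%:R]natr1 -muln2 natrM; field.
rewrite -lee_fin; apply: (le_trans hX); apply: (@le_trans _ _ (gauss `[y0, (y0 + h * N.*2.+1%:R)%R[%classic)).
  apply: le_measure; rewrite ?inE //; try exact: measurable_itv.
  move=> z /=; rewrite !in_itv /= ye => /andP[z1 z2]; apply/andP; split; rewrite /y0; lra.
rewrite -cells.
apply: (@le_trans _ _ (\sum_(k < N.*2.+1)
   (h * c0 * expR (h * (X + 1)) * expR (- @lat h N k ^+ 2))%:E)%E); last first.
  by rewrite sumEFin lee_fin /theta mulr_sumr.
apply: lee_sum => k _.
have -> : y0 + h * k%:R = @lat h N k - h / 2 by rewrite /y0 /lat; field.
have -> : y0 + h * k.+1%:R = @lat h N k + h / 2 by rewrite /y0 /lat -natr1; field.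
apply: le_trans (gauss_cell_le _ (divr_gt0 h0 (ltr0n _ 2))) _.
rewrite lee_fin (_ : 2 * (h / 2) = h); last by field.
rewrite -!mulrA ler_pM2l // ler_pM2l ?peak_gt0 // [leRHS]mulrC ler_pM2l ?expR_gt0 //.
rewrite ler_expR ler_pM2l // (le_trans _ hN2) // /lat normrM gtr0_norm // ler_pM2l //.
rewrite ler_norml; have kN : (k%:R : R) <= N%:R * 2 by rewrite -natrM muln2 ler_nat -ltnS.
by have k0 := ler0n R k; apply/andP; split; lra.
Qed.

Lemma min_pos (es : seq R) : {in es, forall e, 0 < e} ->
  exists2 m : R, 0 < m & {in es, forall e, m <= e}.
Proof.
elim: es => [|e es IH] H; first by exists 1.
have [|m m0 hm] := IH; first by move=> x xs; apply: H; rewrite in_cons xs orbT.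
have e0 : 0 < e by apply: H; rewrite mem_head.
exists (Num.min e m); first by rewrite lt_min e0.
move=> x; rewrite in_cons ge_min => /orP[/eqP->|/hm->]; first by rewrite lexx.
by rewrite orbT.
Qed.

(** Divides [theta_le] by [theta_ge]. The box N' on the left is arbitrary because user 2's words lie
    in a larger box than the typical words that normalise the count. *)
Lemma lattice_theta (es : seq R) (d h0 : R) : {in es, forall e, 0 < e} ->
  0 < d -> 0 < h0 -> exists h N, [/\ 0 < h, h <= h0 &
    forall e c N', e \in es ->
    \sum_k expR (- (@lat h N' k - c) ^+ 2 / e) <= Num.sqrt e * (1 + d) * theta h N].
Proof.
wlog d1 : d / d <= 1.
  move=> H he d0 hh; have [d1|d1] := leP d 1; first exact: H.
  have [h [N [a b c]]] := H 1 (lexx _) he ltr01 hh; exists h, N; split=> // e x N' ees.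
  apply: le_trans (c e x N' ees) _; rewrite ler_wpM2r //.
    by apply: sumr_ge0 => k _; exact: expR_ge0.
  by rewrite ler_wpM2l ?sqrtr_ge0 // lerD2l ltW.
move=> he d0 hh; have [m m0 hm] := min_pos he.
have d8 : 0 < d / 8 by rewrite divr_gt0.
have [X X0 HX] := theta_ge d8.
pose h := Num.min (Num.min h0 1) (Num.min (d / 8 / X) (d * m / 2)).
have hp : 0 < h by rewrite /h !lt_min hh ltr01 !divr_gt0 // mulr_gt0.
have h1 : h <= 1 by rewrite /h !ge_min lexx orbT.
have hh0 : h <= h0 by rewrite /h !ge_min lexx.
have hX : h * X <= d / 8.
  by rewrite -ler_pdivlMr // /h !ge_min lexx !orbT.
have hm2 : h <= d * m / 2 by rewrite /h !ge_min lexx !orbT.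
have [N HN] := HX h (introT andP (conj hp h1)).
exists h, N; split=> // e c N' ees.
have e0 := he _ ees; have me := hm _ ees.
have := theta_le c N' hp e0; set S := \sum_k _ => HS.
have q : h ^+ 2 / (4 * e) <= d / 8.
  rewrite ler_pdivrMr ?mulr_gt0 //.
  have : h * h <= h * 1 by rewrite ler_pM2l.
  have : d * m <= d * e by rewrite ler_pM2l.
  rewrite expr2; lra.
have ex : expR (h * X) * (1 - d / 8) <= 1.
  have : 1 - h * X <= expR (- (h * X)) by exact: expR_ge1Dx.
  rewrite expRN => k1; have E0 := expR_gt0 (h * X).
  have : expR (h * X) * (1 - d / 8) <= expR (h * X) * (expR (h * X))^-1.
    by rewrite ler_pM2l //; lra.
  by rewrite divff // gt_eqF.
have T0 : 0 <= theta h N by apply: sumr_ge0 => k _; exact: expR_ge0.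
have S0 : 0 <= S by apply: sumr_ge0 => k _; exact: expR_ge0.
have hc : 0 < h * c0 by rewrite mulr_gt0 // peak_gt0.
have se0 : 0 <= Num.sqrt e by rewrite sqrtr_ge0.
(* both sides are compared through h c0 theta >= (1 - d/8)^2 *)
have k1 : (1 - d / 8) * (1 - d / 8) <= h * c0 * theta h N.
  have d81 : 0 <= 1 - d / 8 by lra.
  apply: le_trans (ler_wpM2r d81 HN) _.
  have -> : h * c0 * expR (h * X) * theta h N * (1 - d / 8) =
     h * c0 * theta h N * (expR (h * X) * (1 - d / 8)) by ring.
  by rewrite ler_piMr // mulr_ge0 // ltW.
have k2 : h * c0 * S * (1 - d / 8) <= Num.sqrt e.
  apply: le_trans HS; rewrite [leRHS]mulrAC.
  by apply: ler_wpM2l; [exact: mulr_ge0 (ltW hc) S0 | rewrite lerD2l lerN2].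
(* Three factors 1 - d/8 are lost: mass outside [- X, X[, tilt of the cells, and the cell correction
   in [theta_le]. With d <= 1 the factor 1 + d pays for them, which explains the eighths. *)
have k3 : 1 <= (1 - d / 8) * (1 - d / 8) * (1 - d / 8) * (1 + d) by nra.
rewrite -(ler_pM2l hc); move: (h * c0) hc k1 k2 => r r0 k1 k2.
have B0 : 0 <= (1 - d / 8) * (1 - d / 8) * (1 + d) by rewrite !mulr_ge0 //; lra.
have k4 : r * S * ((1 - d / 8) * (1 - d / 8) * (1 - d / 8) * (1 + d)) <=
   Num.sqrt e * (1 - d / 8) * (1 - d / 8) * (1 + d).
  have := ler_wpM2r B0 k2; rewrite !mulrA; congr (_ <= _); ring.
apply: (@le_trans _ _ (r * S * ((1 - d / 8) * (1 - d / 8) * (1 - d / 8) * (1 + d)))).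
  by rewrite ler_peMr // mulr_ge0 // ltW.
apply: le_trans k4 _.
have -> : r * (Num.sqrt e * (1 + d) * theta h N) = Num.sqrt e * (1 + d) * (r * theta h N).
  by ring.
rewrite (_ : _ * _ * _ * _ = Num.sqrt e * (1 + d) * ((1 - d / 8) * (1 - d / 8))); last by ring.
by rewrite ler_wpM2l // mulr_ge0 //; lra.
Qed.

End GaussianCells.

Section DiscreteGaussian.
Variable R : realType.

Definition gw (h : R) N (k : 'I_(N.*2.+1)) : R := expR (- lat h k ^+ 2).

Lemma gw_gt0 (h : R) N (k : 'I_(N.*2.+1)) : 0 < gw h k. Proof. exact: expR_gt0. Qed.

Lemma card_lat N : (0 < #|{: 'I_(N.*2.+1)}|)%N. Proof. by rewrite card_ord. Qed.

Lemma total_gw (h : R) N : total (@gw h N) = theta h N. Proof. by []. Qed.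

Lemma lat_rev (h : R) N (k : 'I_(N.*2.+1)) : lat h (rev_ord k) = - lat h k.
Proof.
have kN : (k <= N.*2)%N by have := ltn_ord k.
rewrite /lat /= subSS natrB // -[X in X%:R - _ - _]muln2 natrM; ring.
Qed.

Lemma fmoment_gw1 (h : R) N : fmoment (@gw h N) (@lat R h N) 1 = 0.
Proof.
rewrite /fmoment; suff -> : \sum_k gw h k * @lat R h N k ^+ 1 = 0 by rewrite mulr0.
set S := \sum_k _; suff : S = - S by move: S => x e; lra.
rewrite {1}/S (reindex_inj rev_ord_inj) /= /S -sumrN; apply: eq_bigr => k _.
by rewrite /gw lat_rev sqrrN !expr1 mulrN.
Qed.

Lemma sqrt_le_mean (x : R) : 0 <= x -> Num.sqrt x <= (1 + x) / 2.
Proof.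
move=> x0; have := sqr_ge0 (Num.sqrt x - 1); have := sqr_sqrtr x0.
by move: (Num.sqrt x) => y <-; rewrite !expr2; lra.
Qed.

Lemma sqrt_inv1D_le (n : R) : 0 < n -> Num.sqrt (1 + n)^-1 <= 1 - n / 2 + n ^+ 2 / 2.
Proof.
move=> n0; have p : 0 < 1 + n by lra.
have i0 : 0 < (1 + n)^-1 by rewrite invr_gt0.
apply: le_trans (sqrt_le_mean (ltW i0)) _.
have : (1 + n)^-1 * (1 + n) = 1 by rewrite mulVf // gt_eqF.
by move: (1 + n)^-1 i0 => i i0 ie; rewrite expr2; nra.
Qed.

Lemma sqrt_inv1B_le (n : R) : 0 < n <= 2^-1 -> Num.sqrt (1 - n)^-1 <= 1 + n / 2 + n ^+ 2.
Proof.
move=> /andP[n0 n1]; have p : 0 < 1 - n by lra.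
have i0 : 0 < (1 - n)^-1 by rewrite invr_gt0.
apply: le_trans (sqrt_le_mean (ltW i0)) _.
have : (1 - n)^-1 * (1 - n) = 1 by rewrite mulVf // gt_eqF.
have := mulr_ge0 (ltW n0) (ltW i0).
by move: (1 - n)^-1 i0 => i i0 j0 ie; rewrite expr2; nra.
Qed.

(** The second moment m2 is read off the theta bounds: for the additional widths 1 / (1 + b) with b
    = n and b = - n, the inequality exp(- b x^2) >= 1 - b x^2 gives 1 - b m2 <= sqrt(1 / (1 + b)) (1
    + d1). The two signs pin m2 near 1/2 from both sides. *)
Lemma lattice_exists (es : seq R) (d h0 : R) : {in es, forall e, 0 < e} ->
  0 < d -> 0 < h0 -> exists h N, [/\ 0 < h, h <= h0,
    `|fmoment (@gw h N) (@lat R h N) 2 - 2^-1| <= d &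
    forall e c N', e \in es ->
    \sum_k expR (- (@lat R h N' k - c) ^+ 2 / e) <= Num.sqrt e * (1 + d) * theta h N].
Proof.
move=> he d0 hh; pose n : R := Num.min (2^-1 : R) (d / 2).
have n0 : 0 < n by rewrite lt_min invr_gt0 ltr0n divr_gt0.
have n1 : n <= 2^-1 by rewrite ge_min lexx.
have nd : n <= d / 2 by rewrite ge_min lexx orbT.
(* The estimate of m2 is obtained multiplied by n; hence d1 is small relative to n, so that n^2 and
   2 d1 are each at most n d / 2. *)
pose d1 := Num.min d (n * d / 4).
have d10 : 0 < d1 by rewrite lt_min d0 divr_gt0 // mulr_gt0.
have d1d : d1 <= d by rewrite ge_min lexx.
have d1n : d1 <= n * d / 4 by rewrite ge_min lexx orbT.
have [|h [N [h_gt0 hh0 H]]] := @lattice_theta R ((1 + n)^-1 :: (1 - n)^-1 :: es) d1 h0 _ d10 hh.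
  move=> e; rewrite !in_cons => /orP[/eqP->|/orP[/eqP->|/he//]]; rewrite invr_gt0; lra.
exists h, N; split=> //; last first.
  move=> e c N' ees; apply: (@le_trans _ _ (Num.sqrt e * (1 + d1) * theta h N)).
    by apply: H; rewrite !in_cons ees !orbT.
  rewrite ler_wpM2r //; first by apply: sumr_ge0 => k _; exact: expR_ge0.
  by rewrite ler_wpM2l ?sqrtr_ge0 // lerD2l.
have T0 : 0 < theta h N by rewrite -total_gw; apply: total_gt0; [exact: gw_gt0|exact: card_lat].
set m2 := fmoment _ _ _.
have m2E : \sum_k gw h k * @lat R h N k ^+ 2 = theta h N * m2.
  by rewrite /m2 /fmoment total_gw mulVKf // gt_eqF.
have key b : 0 < 1 + b -> (1 + b)^-1 \in [:: (1 + n)^-1, (1 - n)^-1 & es] ->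
    1 - b * m2 <= Num.sqrt (1 + b)^-1 * (1 + d1).
  move=> b0 mem; have := H _ 0 N mem => hb.
  rewrite -(ler_pM2r T0); apply: le_trans hb.
  have -> : (1 - b * m2) * theta h N = \sum_k gw h k * (1 - b * @lat R h N k ^+ 2).
    rewrite mulrBl mul1r -mulrA [m2 * _]mulrC -m2E -total_gw /total mulr_sumr -sumrB.
    by apply: eq_bigr => k _; ring.
  apply: ler_sum => k _; rewrite subr0 invrK (mulrDr (- _)) mulr1 expRD ler_pM2l ?expR_gt0 //.
  by apply: le_trans (expR_ge1Dx _); rewrite lerD2l mulNr mulrC.
have kp := key n; have km := key (- n).
rewrite in_cons eqxx in kp; rewrite !in_cons eqxx orbT in km.
have {}kp := kp _ isT; have {}km := km _ isT.
have p1 : 0 < 1 + n by lra.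
have p2 : 0 < 1 - n by lra.
have {}kp := kp p1; have {}km := km p2.
have a1 := sqrt_inv1D_le n0.
have a2 : Num.sqrt (1 - n)^-1 <= 1 + n / 2 + n ^+ 2 by apply: sqrt_inv1B_le; rewrite n0.
have d11 : 0 < 1 + d1 by rewrite addr_gt0.
have kp' := le_trans kp (ler_wpM2r (ltW d11) a1).
have km' := le_trans km (ler_wpM2r (ltW d11) a2).
have nn : n ^+ 2 <= n / 2 by rewrite expr2; nra.
have nd2 : n ^+ 2 <= n * (d / 2) by rewrite expr2 ler_pM2l.
have q1 : d1 * (1 - n / 2 + n ^+ 2 / 2) <= d1.
  by rewrite ler_piMr // ?ltW //; lra.
have q2 : d1 * (1 + n / 2 + n ^+ 2) <= d1 * 2.
  by rewrite ler_wpM2l // ?ltW //; lra.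
rewrite ler_norml; apply/andP; split.
  rewrite -(ler_pM2l n0); lra.
rewrite -(ler_pM2l n0); lra.
Qed.

End DiscreteGaussian.

(** * Moments of the noise *)

Section ProductFormula.
Local Open Scope ereal_scope.
Context d (T : measurableType d) (R : realType) (P : {measure set T -> \bar R}).
Context d' (U : measurableType d') (nu : {measure set U -> \bar R}).
Variables (X : T -> U) (G : T -> R) (c : R).
Hypotheses (mX : measurable_fun setT X) (mG : measurable_fun setT G).
Hypothesis G0 : forall z, (0 <= G z)%R.
Hypothesis cyl : forall A, measurable A ->
  \int[P]_z (\1_A (X z) * G z)%:E = c%:E * nu A.

Let mfG (f : U -> R) : measurable_fun setT f ->
  measurable_fun setT (fun z => (f (X z) * G z)%:E).
Proof.
by move=> mf; apply/measurable_EFinP/measurable_funM => //; exact: measurableT_comp.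
Qed.

Let cyl_nnsfun (g : {nnsfun U >-> R}) :
  \int[P]_z (g (X z) * G z)%:E = c%:E * \int[nu]_x (g x)%:E.
Proof.
rewrite integralT_nnsfun sintegralE ge0_mule_fsumr; last first.
  move=> y; have [y0|y0] := leP 0%R y; first by rewrite mule_ge0 // lee_fin.
  rewrite preimage_nnfun0 // measure0 mule0 //.
have E z : (g (X z) * G z)%:E =
    \sum_(y \in range g) (y%:E * (\1_(g @^-1` [set y]) (X z) * G z)%:E).
  rewrite [RHS](eq_fsbigr (fun y => (y * \1_(g @^-1` [set y]) (X z) * G z)%:E)).
    by rewrite fsumEFin // {1}(fimfunE g (X z)) !fsbig_finite //= mulr_suml.
  by move=> y _; rewrite -EFinM mulrA.
under eq_integral do rewrite E.
have mI y : measurable_fun setT (fun z => (\1_(g @^-1` [set y]) (X z) * G z)%:E).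
  by apply: mfG; exact: measurable_indic.
rewrite ge0_integral_fsum //; last 2 first.
- by move=> y; apply: emeasurable_funM => //; exact: measurable_cst.
- move=> y z _; have [y0|y0] := leP 0%R y; first by rewrite mule_ge0 // lee_fin mulr_ge0.
  by rewrite preimage_nnfun0 // indic0 mul0r mule0.
apply: eq_fsbigr => y yg; have y0 : (0 <= y)%R by move: yg; rewrite inE => -[x _ <-].
rewrite ge0_integralZl_EFin //; first by rewrite cyl // muleCA.
by move=> z _; rewrite lee_fin mulr_ge0.
Qed.

(** Extends the formula from indicators to simple functions and then to monotone limits. With X the
    identity it inserts a density; with X a coordinate it peels one factor off a product. *)
Lemma ge0_integral_cylinder (f : U -> R) : measurable_fun setT f ->
  (forall x, (0 <= f x)%R) ->
  \int[P]_z (f (X z) * G z)%:E = c%:E * \int[nu]_x (f x)%:E.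
Proof.
move=> mf f0; have mf' : measurable_fun setT (EFin \o f) by exact/measurable_EFinP.
pose g := nnsfun_approx measurableT mf'.
have cvg x : EFin \o g ^~ x @ \oo --> (f x)%:E.
  by apply: (cvg_nnsfun_approx measurableT mf') => // y _; rewrite /= lee_fin.
have nd x : {homo (fun n => g n x) : m n / (m <= n)%N >-> (m <= n)%R}.
  by move=> m n mn; have /lefP := nd_nnsfun_approx measurableT mf' mn.
have c1 : \int[nu]_x (g n x)%:E @[n --> \oo] --> \int[nu]_x (f x)%:E.
  have := @cvg_monotone_convergence _ _ _ nu setT measurableT (fun n x => (g n x)%:E).
  have -> : \int[nu]_x (fun x0 => limn (fun n => (g n x0)%:E)) x = \int[nu]_x (f x)%:E.
    by apply: eq_integral => x _; apply/cvg_lim => //; exact: cvg.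
  apply.
  - by move=> n; exact/measurable_EFinP.
  - by move=> n x _; rewrite lee_fin.
  - by move=> x _ m n mn; rewrite lee_fin nd.
have c2 : \int[P]_z (g n (X z) * G z)%:E @[n --> \oo] --> \int[P]_z (f (X z) * G z)%:E.
  have := @cvg_monotone_convergence _ _ _ P setT measurableT
    (fun n z => (g n (X z) * G z)%:E).
  have -> : \int[P]_z (fun z => limn (fun n => (g n (X z) * G z)%:E)) z =
     \int[P]_z (f (X z) * G z)%:E.
    apply: eq_integral => z _; apply/cvg_lim => //.
    under eq_fun do rewrite EFinM; rewrite EFinM.
    by apply: cvgeMr => //; exact: cvg.
  apply.
  - by move=> n; exact: mfG.
  - by move=> n z _; rewrite lee_fin mulr_ge0.
  - by move=> z _ m n mn; rewrite lee_fin ler_wpM2r // nd.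
have c3 : \int[P]_z (g n (X z) * G z)%:E @[n --> \oo] --> c%:E * \int[nu]_x (f x)%:E.
  by under eq_fun do rewrite cyl_nnsfun; exact: cvgeMl.
exact: cvg_unique c2 c3.
Qed.

End ProductFormula.

Section GaussianMoments.
Variable R : realType.
Local Notation lebesgue := (@lebesgue_measure R).
Local Notation gauss := (normal_prob (0 : R) (@nsd R)).
Local Notation c0 := (normal_peak (@nsd R)).

Lemma ge0_integral_gauss (f : R -> R) : measurable_fun setT f -> (forall x, 0 <= f x) ->
  (\int[gauss]_x (f x)%:E = \int[lebesgue]_x (f x * normal_pdf 0 (@nsd R) x)%:E)%E.
Proof.
move=> mf f0.
have := @ge0_integral_cylinder _ _ R lebesgue _ _ gauss id (normal_pdf 0 (@nsd R)) 1.
move=> /(_ (@measurable_id _ _ _) (@measurable_normal_pdf R 0 _) (@normal_pdf_ge0 R _ _)).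
move=> /(_ _ _ mf f0) ->; first by rewrite mul1e.
move=> A mA; rewrite mul1e /normal_prob [RHS]integral_mkcond.
apply: eq_integral => x _; rewrite patchE indicE.
by case: ifPn => _; rewrite ?mul1r ?mul0r.
Qed.

Lemma integral_scaled_pdf (m s k : R) : 0 <= k ->
  (\int[lebesgue]_x (k * normal_pdf m s x)%:E = k%:E)%E.
Proof.
move=> k0; under eq_integral do rewrite EFinM.
have f0 x : setT x -> (0 <= (normal_pdf m s x)%:E)%E by rewrite lee_fin normal_pdf_ge0.
have mf : measurable_fun setT (fun x => (normal_pdf m s x)%:E).
  by apply/measurable_EFinP; exact: measurable_normal_pdf.
have := ge0_integralZl_EFin lebesgue measurableT f0 mf k0.
by rewrite integral_normal_pdf mule1.
Qed.

Lemma gauss_exp_sq (b : R) : b < 1 ->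
  (\int[gauss]_x (expR (b * x ^+ 2))%:E = (Num.sqrt (1 - b)^-1)%:E)%E.
Proof.
move=> b1; have b10 : 0 < 1 - b by rewrite subr_gt0.
have mf : measurable_fun setT (fun x : R => expR (b * x ^+ 2)).
  apply: measurableT_comp => //; exact: measurable_funM.
rewrite ge0_integral_gauss //.
pose r := Num.sqrt (1 - b); have r0 : 0 < r by rewrite sqrtr_gt0.
have rr : r ^+ 2 = 1 - b by rewrite sqr_sqrtr // ltW.
pose s := (@nsd R) / r.
have s0 : s != 0 by rewrite mulf_neq0 ?nsd_neq0 ?invr_neq0 ?gt_eqF.
have s2 : s ^+ 2 *+ 2 = (1 - b)^-1.
  by rewrite /s exprMn -mulrnAl (nsd2 R) mul1r exprVn rr.
have pk : normal_peak s = r * c0.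
  have E (x : R) : x ^+ 2 * pi *+ 2 = x ^+ 2 *+ 2 * pi by rewrite mulrnAl.
  rewrite /normal_peak !E s2 (nsd2 R) mul1r sqrtrM ?invr_ge0 ?(ltW b10) //.
  by rewrite sqrtrV ?(ltW b10) // -/r invfM invrK.
have rV0 : 0 <= r^-1 by rewrite invr_ge0 ltW.
rewrite sqrtrV ?(ltW b10) // -/r -(integral_scaled_pdf 0 s rV0).
apply: eq_integral => x _; rewrite gauss_pdfE normal_pdfE // pk /normal_fun subr0.
rewrite s2 invrK -(mulrA r) mulKf ?gt_eqF // mulrCA -expRD.
by congr (_ * expR _)%:E; ring.
Qed.

Lemma gauss_exp (s : R) : (\int[gauss]_x (expR (s * x))%:E = (expR (s ^+ 2 / 4))%:E)%E.
Proof.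
have mf : measurable_fun setT (fun x : R => expR (s * x)).
  by apply: measurableT_comp => //; exact: measurable_funM.
rewrite ge0_integral_gauss //.
rewrite -(integral_scaled_pdf (s / 2) (@nsd R) (expR_ge0 _)).
apply: eq_integral => x _; rewrite gauss_pdfE normal_pdfE ?nsd_neq0 // /normal_fun.
rewrite (nsd2 R) divr1 mulrCA -expRD [in RHS]mulrCA -expRD.
by congr (_ * expR _)%:E; field.
Qed.

(** The constant is 1 + 16, suited to powers up to 4: |x^j| <= 1 + x^4 and x^4 <= 16 exp(x^2 /
    2). *)
Lemma integrable_gauss_bound (f : R -> R) : measurable_fun setT f ->
  (forall x, `|f x| <= 17 * expR (2^-1 * x ^+ 2)) -> gauss.-integrable setT (EFin \o f).
Proof.
move=> mf hf.
have mg : measurable_fun setT (fun x : R => expR (2^-1 * x ^+ 2)).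
  apply: measurableT_comp => //; exact: measurable_funM.
have ig : gauss.-integrable setT (fun x => (17 * expR (2^-1 * x ^+ 2))%:E).
  apply/integrableP; split.
    by apply/measurable_EFinP; exact: measurable_funM.
  under eq_integral do rewrite /= ger0_norm ?mulr_ge0 ?expR_ge0 // EFinM.
  have f0 (x : R) : setT x -> (0 <= (expR (2^-1 * x ^+ 2))%:E)%E.
    by rewrite lee_fin expR_ge0.
  have mg' := (measurable_EFinP _ _).2 mg.
  rewrite [ltLHS](ge0_integralZl_EFin gauss measurableT f0 mg' (ler0n _ 17)).
  by rewrite gauss_exp_sq ?invf_lt1 ?ltr1n // -EFinM ltry.
apply: le_integrable ig => //; first exact/measurable_EFinP.
by move=> x _; rewrite /= lee_fin [leRHS]ger0_norm ?hf // mulr_ge0 // expR_ge0.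
Qed.

Lemma integrable_gauss_pow j : (j <= 4)%N ->
  gauss.-integrable setT (fun x => (x ^+ j)%:E).
Proof.
move=> j4; apply: integrable_gauss_bound; first exact: exprn_measurable.
move=> x; set t := x ^+ 2; have t0 : 0 <= t by exact: sqr_ge0.
have e1 : 1 <= expR (2^-1 * t).
  by rewrite -[leLHS]expR0 ler_expR mulr_ge0 ?invr_ge0.
have e2 : t ^+ 2 <= 16 * expR (2^-1 * t).
  have h := expR_ge1Dx (t / 4).
  have -> : expR (2^-1 * t) = expR (t / 4) * expR (t / 4).
    by rewrite -expRD; congr expR; field.
  have := expR_ge0 (t / 4); move: (expR (t / 4)) h => y h y0.
  rewrite expr2; nra.
have : `|x ^+ j| <= 1 + t ^+ 2.
  rewrite normrX /t -exprM; have [x1|x1] := leP `|x| 1.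
    by rewrite (le_trans (exprn_ile1 _ (normr_ge0 _) x1)) // lerDl exprn_even_ge0.
  apply: (@le_trans _ _ (`|x| ^+ 4)); first by rewrite ler_weXn2l // ltW.
  by rewrite -normrX ger0_norm ?exprn_even_ge0 // lerDr.
move=> h; apply: le_trans h _; lra.
Qed.

Definition gmoment (j : nat) : R := fine (\int[gauss]_x (x ^+ j)%:E)%E.

Lemma gmomentE j : (j <= 4)%N -> (\int[gauss]_x (x ^+ j)%:E = (gmoment j)%:E)%E.
Proof. by move=> j4; rewrite fineK // integrable_fin_num // integrable_gauss_pow. Qed.

Lemma gmoment0 : gmoment 0%N = 1.
Proof.
rewrite /gmoment; under eq_integral do rewrite expr0.
by rewrite integral_cst // mul1e [X in fine X](_ : _ = 1%E) //; exact: probability_setT.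
Qed.

(** Moments are found by squeezing: 1 + s x^j lies below an exponential with a closed-form integral,
    and small s of both signs leave only one possible value. *)
Let affine_le j (s a : R) (f : R -> R) : (j <= 4)%N -> measurable_fun setT f ->
  (\int[gauss]_x (f x)%:E = a%:E)%E -> (forall x, 1 + s * x ^+ j <= f x) ->
  (forall x, 0 <= f x) -> 1 + s * gmoment j <= a.
Proof.
move=> j4 mf fa hf f0; have i1 := integrable_gauss_pow j4.
have i0 : gauss.-integrable setT (fun x => 1%:E).
  by have := integrable_gauss_pow (isT : (0 <= 4)%N).
have iz : gauss.-integrable setT (fun x => s%:E * (x ^+ j)%:E)%E by exact: integrableZl.
have e : (\int[gauss]_x (1%:E + s%:E * (x ^+ j)%:E) = (1 + s * gmoment j)%:E)%E.
  rewrite integralD // integralZl // gmomentE // EFinD EFinM; congr (_ + _)%E.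
  rewrite -[RHS](_ : (gmoment 0%N)%:E = _); last by rewrite gmoment0.
  by rewrite -gmomentE //; apply: eq_integral => x _; rewrite expr0.
rewrite -lee_fin -e -fa; apply: le_integral => //.
- exact: integrableD.
- apply/integrableP; split; first exact/measurable_EFinP.
  under eq_integral do rewrite /= ger0_norm //.
  by rewrite fa ltry.
- by move=> x _; rewrite -EFinM -EFinD lee_fin.
Qed.

Lemma gmoment1 : gmoment 1%N = 0.
Proof.
have key s : 1 + s * gmoment 1%N <= expR (s ^+ 2 / 4).
  apply: (affine_le _ _ (gauss_exp s)) => //.
  - by apply: measurableT_comp => //; exact: measurable_funM.
  - by move=> x; rewrite expr1 expR_ge1Dx.
have small (s : R) : -1 < s < 1 -> expR (s ^+ 2 / 4) <= 1 + s ^+ 2.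
  move=> s1; set t := s ^+ 2 / 4.
  have t0 : 0 <= t by rewrite divr_ge0 // sqr_ge0.
  have t1 : t <= 4^-1.
    by rewrite /t ler_pdivrMr // mulVf //; rewrite expr2; nra.
  have := expR_ge1Dx (- t); rewrite expRN; have := expR_gt0 t.
  have -> : s ^+ 2 = 4 * t by rewrite /t; field.
  move: (expR t) => y y0 h.
  have {}h : (1 - t) * y <= 1 by rewrite -ler_pdivlMr // mul1r.
  nra.
apply/eqP; rewrite eq_le; apply/andP; split.
  apply: (@le0_of_small _ _ 1) => s s01; have /andP[s0 s1] := s01.
  have h2 := key s; have h1 : expR (s ^+ 2 / 4) <= 1 + s ^+ 2.
    by apply: small; apply/andP; split; lra.
  rewrite -(ler_pM2l s0); rewrite expr2 in h1; lra.
rewrite -oppr_le0; apply: (@le0_of_small _ _ 1) => s s01; have /andP[s0 s1] := s01.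
have := key (- s); have := small (- s); rewrite sqrrN => h1 h2.
have {}h1 : expR (s ^+ 2 / 4) <= 1 + s ^+ 2 by apply: h1; apply/andP; split; lra.
rewrite -(ler_pM2l s0); rewrite expr2 in h1; lra.
Qed.

Lemma gmoment2 : gmoment 2%N = 2^-1.
Proof.
have key b : b < 1 -> 1 + b * gmoment 2%N <= Num.sqrt (1 - b)^-1.
  move=> b1; apply: (affine_le _ _ (gauss_exp_sq b1)) => //.
  - apply: measurableT_comp => //; exact: measurable_funM.
  - by move=> x; exact: expR_ge1Dx.
apply/eqP; rewrite eq_le; apply/andP; split; rewrite -subr_le0.
  apply: (@le0_of_small _ _ 1) => s /andP[s0 s1].
  have s20 : 0 < s / 2 <= 2^-1 by rewrite divr_gt0 //=; lra.
  have := key (s / 2); have := sqrt_inv1B_le s20; rewrite expr2 => h1 h2.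
  have {}h2 := le_trans (h2 _) h1.
  have {}h2 : 1 + s / 2 * gmoment 2 <= 1 + s / 2 / 2 + s / 2 * (s / 2) by apply: h2; lra.
  rewrite -(ler_pM2l s0); nra.
apply: (@le0_of_small _ _ 1) => s /andP[s0 s1].
have := key (- s); have := sqrt_inv1D_le s0; rewrite opprK expr2 => h1 h2.
have {}h2 := le_trans (h2 _) h1.
have {}h2 : 1 + - s * gmoment 2 <= 1 - s / 2 + s * s / 2 by apply: h2; lra.
rewrite -(ler_pM2l s0); nra.
Qed.

End GaussianMoments.

Section IidNoise.
Variables (R : realType) (k : nat).
Local Notation gauss := (normal_prob (0 : R) (@nsd R)).

Let rect (A : 'I_k -> set R) := [set z : k.-tuple R | forall j, A j (tnth z j)].

Let measurable_rect A : (forall j, measurable (A j)) -> measurable (rect A).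
Proof.
move=> mA; have -> : rect A = \bigcap_(j in [set: 'I_k]) ((fun z => tnth z j) @^-1` A j).
  by apply/seteqP; split => z h j; [move=> _; exact: h | exact: (h j I)].
apply: fin_bigcap_measurable => [|j _]; first exact: finite_finset.
rewrite -[X in measurable X]setTI; exact: measurable_tnth.
Qed.

(** Rectangles are stable under intersection and generate the product sigma-algebra. *)
Lemma iid_cgauss_unique (P Q : probability (k.-tuple R) R) : iid_cgauss P -> iid_cgauss Q ->
  forall A, measurable A -> P A = Q A.
Proof.
move=> hP hQ A mA.
pose G : set (set (k.-tuple R)) := [set B | exists2 A, (forall j, measurable (A j)) & B = rect A].
have GT : G setT by exists (fun=> setT) => //; apply/seteqP; split.
apply: (@measure_unique _ _ _ G (fun=> setT)) => //.
- apply/seteqP; split => B.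
    apply: smallest_sub; first exact: smallest_sigma_algebra.
    apply: (big_ind (fun Q => Q `<=` <<s G >>)) => [C []|S S' h h' C [/h|/h']|j _ C [D mD <-]] //.
    apply: sub_sigma_algebra; exists (fun i => if i == j then D else setT).
      by move=> i; case: ifP.
    apply/seteqP; split => z; first by move=> [_ h] i; case: eqP => // ->.
    by move=> /(_ j); rewrite eqxx.
  apply: smallest_sub; first exact: sigma_algebra_measurable.
  by move=> C [D mD ->]; exact: measurable_rect.
- move=> B C [A1 m1 ->] [A2 m2 ->]; exists (fun j => A1 j `&` A2 j).
    by move=> j; exact: measurableI.
  apply/seteqP; split => z /=; first by move=> [h1 h2] j; split.
  by move=> h; split => j; have [] := h j.
- by rewrite bigcup_const //; exists 0%N.
- by move=> B [D mD ->]; exact: etrans (hP D mD) (esym (hQ D mD)).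
- by move=> i; rewrite (le_lt_trans (probability_le1 _ _)) // ltry.
Qed.

Variable P : probability (k.-tuple R) R.
Hypothesis hP : iid_cgauss P.

(** Induction on the number J of leading coordinates allowed to carry general functions, the others
    carrying indicators. For J = 0 this is the definition of the law; the step generalises one
    coordinate by [ge0_integral_cylinder]. *)
Lemma iid_ge0 (f : 'I_k -> R -> R) (m : 'I_k -> R) :
  (forall j, measurable_fun setT (f j)) -> (forall j x, 0 <= f j x) ->
  (forall j, \int[gauss]_x (f j x)%:E = (m j)%:E)%E ->
  (\int[P]_z (\prod_j f j (tnth z j))%:E = (\prod_j m j)%:E)%E.
Proof.
have mt (j : 'I_k) : measurable_fun setT (fun z : k.-tuple R => tnth z j).
  exact: measurable_tnth.
suff H (J : nat) : forall (f : 'I_k -> R -> R) (m : 'I_k -> R),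
    (forall j, measurable_fun setT (f j)) -> (forall j x, 0 <= f j x) ->
    (forall j, \int[gauss]_x (f j x)%:E = (m j)%:E)%E ->
    (forall j : 'I_k, (J <= j)%N -> exists2 A, measurable A & f j = \1_A) ->
    (\int[P]_z (\prod_j f j (tnth z j))%:E = (\prod_j m j)%:E)%E.
  move=> mf f0 fm; apply: (H k) => // j; by rewrite leqNgt ltn_ord.
elim: J => [|J IH] {}f {}m mf f0 fm hf.
  have [A hA] : exists A : 'I_k -> set R, forall j, measurable (A j) /\ f j = \1_(A j).
    exists (fun j => projT1 (cid2 (hf j isT))) => j.
    by case: cid2.
  have E z : (\prod_j f j (tnth z j))%:E = (\1_(rect A) z)%:E :> \bar R.
    congr EFin; rewrite indicE; case: (boolP (z \in rect A)) => [|zA].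
      rewrite inE => zA; rewrite big1 // => j _.
      by rewrite (hA j).2 indicE mem_set.
    have [j jA] : exists j, ~ A j (tnth z j).
      apply: contrapT => h; move/negP: zA; apply; rewrite inE => j.
      by apply: contrapT => h'; apply: h; exists j.
    by rewrite (bigD1 j) //= (hA j).2 indicE memNset // mul0r.
  under eq_integral do rewrite E.
  rewrite integral_indic //; last by apply: measurable_rect => j; exact: (hA j).1.
  rewrite setIT; apply: etrans (hP (fun j => (hA j).1)) _.
  rewrite (big_morph (@EFin R) (@EFinM R) erefl); apply: eq_bigr => j _.
  rewrite -fm (hA j).2 integral_indic ?setIT //; exact: (hA j).1.
have [kJ|Jk] := leqP k J.
  by apply: IH => // j /(leq_trans kJ); rewrite leqNgt ltn_ord.
pose j0 := Ordinal Jk.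
pose G (z : k.-tuple R) := \prod_(j | j != j0) f j (tnth z j).
have mG : measurable_fun setT G.
  rewrite /G; elim: (index_enum _) => [|j r IHr].
    by under eq_fun do rewrite big_nil; exact: measurable_cst.
  under eq_fun do rewrite big_cons; case: (j != j0) => //.
  by apply: measurable_funM => //; exact: measurableT_comp.
have := @ge0_integral_cylinder _ _ _ P _ _ gauss (fun z => tnth z j0) G
  (\prod_(j | j != j0) m j) (mt j0) mG.
have G0 z : 0 <= G z by exact: prodr_ge0.
move=> /(_ G0 _ _ (mf j0) (f0 j0)) H.
under eq_integral do rewrite (bigD1 j0) //=.
rewrite H; first by rewrite fm -EFinM [in RHS](bigD1 j0) //= mulrC.
move=> A mA.
pose f' j := if j == j0 then \1_A else f j.
pose m' j := if j == j0 then fine (gauss A) else m j.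
have gA : (\int[gauss]_x (\1_A x)%:E = (fine (gauss A))%:E)%E.
  by rewrite integral_indic // setIT fineK // fin_num_measure.
have := IH f' m'; rewrite /f' /m'; move=> /(_ _ _ _ _).
move=> IH'; transitivity ((\prod_j (if j == j0 then fine (gauss A) else m j))%:E).
  rewrite -IH'; last first.
  - move=> j Jj; case: eqP => [_|/eqP jj0]; first by exists A.
    apply: hf; rewrite ltn_neqAle Jj andbT; apply: contra jj0 => /eqP e.
    by apply/eqP/val_inj.
  - by move=> j; case: eqP.
  - by move=> j x; case: eqP.
  - by move=> j; case: eqP => // _; exact: measurable_indic.
  apply: eq_integral => z _; congr EFin; rewrite [RHS](bigD1 j0) //= eqxx.
  by congr (_ * _); apply: eq_bigr => j /negPf ->.
rewrite [in LHS](bigD1 j0) //= eqxx EFinM fineK ?fin_num_measure // muleC; congr (_%:E * _)%E.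
by apply: eq_bigr => j /negPf ->.
Qed.

Definition nhasE (F : k.-tuple R -> R) (r : R) : Prop :=
  P.-integrable setT (EFin \o F) /\ (\int[P]_z (F z)%:E = r%:E)%E.

Lemma nhasED F G a b : nhasE F a -> nhasE G b -> nhasE (fun z => F z + G z) (a + b).
Proof.
move=> [iF eF] [iG eG]; split.
  by have := integrableD measurableT iF iG.
by rewrite EFinD -eF -eG; exact: (integralD measurableT iF iG).
Qed.

Lemma nhasEZ c F a : nhasE F a -> nhasE (fun z => c * F z) (c * a).
Proof.
move=> [iF eF]; split; first by have := integrableZl measurableT c iF.
by rewrite EFinM -eF; exact: (integralZl measurableT iF).
Qed.

Lemma measurable_tnth_prod (f : 'I_k -> R -> R) : (forall j, measurable_fun setT (f j)) ->
  measurable_fun setT (fun z : k.-tuple R => \prod_j f j (tnth z j)).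
Proof.
move=> mf; elim: (index_enum _) => [|j r IHr].
  by under eq_fun do rewrite big_nil; exact: measurable_cst.
under eq_fun do rewrite big_cons; apply: measurable_funM => //.
apply: measurableT_comp => //; exact: measurable_tnth.
Qed.

(** The same induction, J now counting the coordinates that may change sign: the positive and
    negative parts of the next one both fall under the induction hypothesis. *)
Lemma iid_prod (f : 'I_k -> R -> R) (m : 'I_k -> R) :
  (forall j, gauss.-integrable setT (EFin \o f j)) ->
  (forall j, \int[gauss]_x (f j x)%:E = (m j)%:E)%E ->
  nhasE (fun z => \prod_j f j (tnth z j)) (\prod_j m j).
Proof.
suff H (J : nat) : forall (f : 'I_k -> R -> R) (m : 'I_k -> R),
    (forall j, gauss.-integrable setT (EFin \o f j)) ->
    (forall j, \int[gauss]_x (f j x)%:E = (m j)%:E)%E ->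
    (forall j : 'I_k, (J <= j)%N -> forall x, 0 <= f j x) ->
    nhasE (fun z => \prod_j f j (tnth z j)) (\prod_j m j).
  by move=> fi fm; apply: (H k) => // j; rewrite leqNgt ltn_ord.
elim: J => [|J IH] {}f {}m fi fm f0.
  have mf j : measurable_fun setT (f j).
    by have /integrableP[/measurable_EFinP] := fi j.
  have e := iid_ge0 mf (fun j => f0 j isT) fm.
  split => //; apply/integrableP; split.
    by apply/measurable_EFinP; exact: measurable_tnth_prod.
  have g0 (z : k.-tuple R) : 0 <= \prod_j f j (tnth z j).
    by apply: prodr_ge0 => j _; exact: f0.
  by under eq_integral do rewrite /= (ger0_norm (g0 _)); rewrite e ltry.
have [kJ|Jk] := leqP k J.
  by apply: IH => // j /(leq_trans kJ); rewrite leqNgt ltn_ord.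
pose j0 := Ordinal Jk.
have ip := integrable_funrpos measurableT (fi j0).
have iN := integrable_funrneg measurableT (fi j0).
pose mp := fine (\int[gauss]_x ((f j0)^\+ x)%:E)%E.
pose mn := fine (\int[gauss]_x ((f j0)^\- x)%:E)%E.
have ep : (\int[gauss]_x ((f j0)^\+ x)%:E = mp%:E)%E.
  by rewrite fineK //; exact: (integrable_fin_num measurableT ip).
have en : (\int[gauss]_x ((f j0)^\- x)%:E = mn%:E)%E.
  by rewrite fineK //; exact: (integrable_fin_num measurableT iN).
have fE x : f j0 x = (f j0)^\+ x - (f j0)^\- x.
  by rewrite -[in LHS](funrposBneg (f j0)).
have mE : m j0 = mp - mn.
  apply: EFin_inj; rewrite -fm EFinB -ep -en -(integralB measurableT ip iN).
  by apply: eq_integral => x _; rewrite /= fE.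
have split_nonneg (j : 'I_k) : (J <= j)%N -> j != j0 -> forall x, 0 <= f j x.
  move=> Jj jj0; apply: f0; rewrite ltn_neqAle Jj andbT.
  by apply: contra jj0 => /eqP e; apply/eqP/val_inj.
have up (g : R -> R) (r : R) : gauss.-integrable setT (EFin \o g) ->
    (\int[gauss]_x (g x)%:E = r%:E)%E -> (forall x, 0 <= g x) ->
    nhasE (fun z => g (tnth z j0) * \prod_(j | j != j0) f j (tnth z j))
          (r * \prod_(j | j != j0) m j).
  move=> ig eg g0.
  have := IH (fun j => if j == j0 then g else f j) (fun j => if j == j0 then r else m j).
  have -> : (fun z : k.-tuple R => \prod_j (if j == j0 then g else f j) (tnth z j)) =
      (fun z => g (tnth z j0) * \prod_(j | j != j0) f j (tnth z j)).
    apply: funext => z; rewrite (bigD1 j0) //= eqxx; congr (_ * _).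
    by apply: eq_bigr => j /negPf ->.
  have -> : \prod_j (if j == j0 then r else m j) = r * \prod_(j | j != j0) m j.
    rewrite (bigD1 j0) //= eqxx; congr (_ * _).
    by apply: eq_bigr => j /negPf ->.
  apply.
  - by move=> j; case: eqP.
  - by move=> j; case: eqP.
  - by move=> j Jj x; case: eqP => // /eqP jj0; exact: split_nonneg.
have := nhasED (up _ _ ip ep (funrpos_ge0 _)) (nhasEZ (-1) (up _ _ iN en (funrneg_ge0 _))).
have -> : mp * \prod_(j | j != j0) m j + -1 * (mn * \prod_(j | j != j0) m j) = \prod_j m j.
  by rewrite [RHS](bigD1 j0) //= mE mulN1r mulrBl.
set F := (fun z => _); suff -> : (fun z : k.-tuple R => \prod_j f j (tnth z j)) = F by [].
by apply: funext => z; rewrite /F (bigD1 j0) //= fE mulN1r mulrBl.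
Qed.

Lemma nhasE_mon (m : 'I_k -> nat) : (forall j, (m j <= 4)%N) ->
  nhasE (mon (fun (z : k.-tuple R) j => tnth z j) m) (mom (@gmoment R) m).
Proof.
move=> m4; apply: (@iid_prod (fun j x => x ^+ m j) (fun j => gmoment R (m j))) => j.
  exact: integrable_gauss_pow.
exact: gmomentE.
Qed.

Lemma nchebyshev (F : k.-tuple R -> R) (v t : R) : measurable_fun setT F -> 0 < t ->
  nhasE (fun z => F z ^+ 2) v -> (P [set z | (t < `|F z|)%R] <= (v / t ^+ 2)%:E)%E.
Proof.
move=> mF t0 [_ e]; set S := [set z | _].
have mS : measurable S.
  rewrite /S -[X in measurable X]setTI.
  have := measurable_fun_ltr (measurable_cst t) (measurableT_comp (@normr_measurable R setT) mF).
  by move=> /(_ measurableT [set true] I); rewrite setTI.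
have t20 : 0 < t ^+ 2 by rewrite exprn_gt0.
have : ((t ^+ 2)%:E * P S <= v%:E)%E.
  rewrite -e -[S]setIT -integral_indic // -ge0_integralZl_EFin //; last first.
  - by rewrite ltW.
  - exact/measurable_EFinP/measurable_indic.
  apply: ge0_le_integral => //=.
  - by move=> z _; rewrite -EFinM lee_fin mulr_ge0 ?indicE // ltW.
  - apply: emeasurable_funM; first exact: measurable_cst.
    exact/measurable_EFinP/measurable_indic.
  - by apply/measurable_EFinP; exact: measurable_funX.
  - move=> z _; rewrite -EFinM lee_fin indicE.
    case: (boolP (z \in S)) => [|_]; last by rewrite mulr0 sqr_ge0.
    rewrite inE /S /= mulr1 => tF.
    by rewrite -[F z ^+ 2]real_normK ?num_real // lerXn2r ?nnegrE ?(ltW t0) // ltW.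
rewrite -(@fineK _ (P S)) ?fin_num_measure // -EFinM !lee_fin.
by rewrite ler_pdivlMr // mulrC.
Qed.

End IidNoise.

(** * Typical sequences *)

Section Gram.
Variable R : realType.
Local Notation C := R[i].

Definition normsq (z : C) : R := complex.Re z ^+ 2 + complex.Im z ^+ 2.
Definition prt (b : bool) (z : C) : R := if b then complex.Im z else complex.Re z.

Lemma normsq_ge0 z : 0 <= normsq z. Proof. by rewrite addr_ge0 ?sqr_ge0. Qed.

Lemma normsqE z : normsq z = complex.Re (z * z^*).
Proof. by case: z => a b; rewrite conjE /normsq /=; ring. Qed.

Lemma normsq_prt z : normsq z = \sum_b prt b z ^+ 2.
Proof. by rewrite /normsq big_bool /= addrC. Qed.

(** Young's inequality; s will trade estimation error against the error of rounding to the
    lattice. *)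
Lemma normsqD_le (s : R) (z z' : C) : 0 < s ->
  normsq (z + z') <= (1 + s) * normsq z + (1 + s^-1) * normsq z'.
Proof.
move=> s0; have e : s * s^-1 = 1 by rewrite divff // gt_eqF.
have sq (x y : R) : (x + y) ^+ 2 <= (1 + s) * x ^+ 2 + (1 + s^-1) * y ^+ 2.
  have i0 : 0 < s^-1 by rewrite invr_gt0.
  rewrite -subr_ge0 (_ : _ - _ = s * (x - s^-1 * y) ^+ 2).
    by rewrite mulr_ge0 ?sqr_ge0 // ltW.
  by field; rewrite gt_eqF.
case: z => a b; case: z' => a' b'; rewrite /normsq /=.
have := lerD (sq a a') (sq b b'); lra.
Qed.

Variables (n : nat).

(** The empirical second moments of all real coordinates are within dl of those of white circular
    Gaussian vectors: 1/2 on the diagonal, 0 elsewhere. *)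
Definition gram m (dl : R) (xi : 'I_n -> 'cV[C]_m) : Prop := forall j k b b',
  `|\sum_i (prt b (xi i j 0) * prt b' (xi i k 0) - ((j == k) && (b == b'))%:R / 2)| <= n%:R * dl.

Definition cross m m' (dl : R) (xi : 'I_n -> 'cV[C]_m) (et : 'I_n -> 'cV[C]_m') : Prop :=
  forall j k b b', `|\sum_i prt b (xi i j 0) * prt b' (et i k 0)| <= n%:R * dl.

Lemma gram_col m m' dl (xi : 'I_n -> 'cV[C]_m) (et : 'I_n -> 'cV[C]_m') :
  gram dl xi -> gram dl et -> cross dl xi et -> gram dl (fun i => col_mx (xi i) (et i)).
Proof.
move=> g1 g2 c j k b b'; case: (split_ordP j) => j' ->; case: (split_ordP k) => k' ->.
- under eq_bigr do rewrite !col_mxEu; rewrite eq_lshift; exact: g1.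
- under eq_bigr do rewrite col_mxEu col_mxEd.
  rewrite eq_lrshift /=; under eq_bigr do rewrite mul0r subr0; exact: c.
- under eq_bigr do rewrite col_mxEu col_mxEd mulrC.
  rewrite eq_rlshift /=; under eq_bigr do rewrite mul0r subr0; exact: c.
- under eq_bigr do rewrite !col_mxEd; rewrite eq_rshift; exact: g2.
Qed.

(** The mean of the weighted squared norm of M xi for a white vector xi, as a weighted Frobenius
    norm. *)
Definition wfro s m (w : 'I_s -> R) (M : 'M[C]_(s, m)) : R :=
  \sum_l w l * \sum_j normsq (M l j).

(** Sensitivity of that quadratic form to the Gram tolerance. The 2 appears because the real and
    imaginary parts of an empirical correlation each combine two real products. *)
Definition wcst s m (w : 'I_s -> R) (M : 'M[C]_(s, m)) : R :=
  \sum_l w l * \sum_j \sum_k 2 * (`|complex.Re (M l j * (M l k)^*)| +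
                                  `|complex.Im (M l j * (M l k)^*)|).

Lemma wcst_ge0 s m (w : 'I_s -> R) (M : 'M[C]_(s, m)) : (forall l, 0 <= w l) -> 0 <= wcst w M.
Proof.
move=> w0; apply: sumr_ge0 => l _; rewrite mulr_ge0 // sumr_ge0 // => j _.
by rewrite sumr_ge0 // => k _; rewrite mulr_ge0 // addr_ge0.
Qed.

Lemma gram_quad s m dl (w : 'I_s -> R) (M : 'M[C]_(s, m)) (xi : 'I_n -> 'cV[C]_m) :
  (forall l, 0 <= w l) -> gram dl xi ->
  \sum_i \sum_l w l * normsq ((M *m xi i) l 0) <= n%:R * (wfro w M + dl * wcst w M).
Proof.
move=> w0 g; rewrite exchange_big /= mulrDr [n%:R * (dl * _)]mulrA /wfro /wcst !mulr_sumr.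
rewrite -big_split /=; apply: ler_sum => l _; rewrite -mulr_sumr.
rewrite [n%:R * (w l * _)]mulrCA [n%:R * dl * (w l * _)]mulrCA -mulrDr ler_wpM2l //.
pose S j k := \sum_i xi i j 0 * (xi i k 0)^*.
have -> : \sum_i normsq ((M *m xi i) l 0) =
    \sum_j \sum_k complex.Re (M l j * (M l k)^* * S j k).
  transitivity (complex.Re (\sum_i \sum_j \sum_k M l j * (M l k)^* * (xi i j 0 * (xi i k 0)^*))).
    rewrite Re_sum; apply: eq_bigr => i _; rewrite normsqE mxE rmorph_sum big_distrlr /=.
    congr complex.Re; apply: eq_bigr => j _; apply: eq_bigr => k _.
    by rewrite rmorphM /=; ring.
  rewrite exchange_big Re_sum; apply: eq_bigr => j _ /=.
  rewrite exchange_big Re_sum; apply: eq_bigr => k _ /=.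
  by rewrite -mulr_sumr.
rewrite !mulr_sumr -big_split; apply: ler_sum => j _ /=.
rewrite (_ : n%:R * normsq (M l j) =
  \sum_k n%:R * (j == k)%:R * complex.Re (M l j * (M l k)^*)); last first.
  rewrite (bigD1 j) //= eqxx mulr1 -normsqE big1 ?addr0 // => k kj.
  by rewrite eq_sym (negPf kj) mulr0 mul0r.
rewrite mulr_sumr -big_split; apply: ler_sum => k _ /=.
set c := _ * _^*.
have ReM (x y : C) : complex.Re (x * y) =
   complex.Re x * complex.Re y - complex.Im x * complex.Im y.
  by case: x; case: y.
have SRe : complex.Re (S j k) = \sum_i (prt false (xi i j 0) * prt false (xi i k 0)) +
    \sum_i (prt true (xi i j 0) * prt true (xi i k 0)).
  rewrite /S Re_sum -big_split; apply: eq_bigr => i _ /=.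
  by rewrite conjE; case: (xi i j 0) => a b; case: (xi i k 0) => a' b' /=; ring.
have SIm : complex.Im (S j k) = \sum_i (prt true (xi i j 0) * prt false (xi i k 0)) -
    \sum_i (prt false (xi i j 0) * prt true (xi i k 0)).
  rewrite /S -sumrB (big_morph (@complex.Im R) (id1 := 0) (op1 := +%R)) //; last first.
    by move=> [a b] [a' b'].
  apply: eq_bigr => i _ /=.
  by rewrite conjE; case: (xi i j 0) => a b; case: (xi i k 0) => a' b' /=; ring.
have G b b' : `|\sum_i (prt b (xi i j 0) * prt b' (xi i k 0)) -
    n%:R * (((j == k) && (b == b'))%:R / 2)| <= n%:R * dl.
  by have := g j k b b'; rewrite sumrB sumr_const card_ord -[X in _ - X]mulr_natl.
have h4 := G false false; have h3 := G true true.
have h2 := G true false; have h1 := G false true.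
rewrite !andbT in h3 h4; rewrite !andbF !mul0r !mulr0 !subr0 in h1 h2.
rewrite ReM SRe SIm; move: h1 h2 h3 h4.
move: (complex.Re c) (complex.Im c) => x y.
move: (\sum_i prt true _ * prt true _) (\sum_i prt false _ * prt false _) => s3 s4.
move: (\sum_i prt true _ * prt false _) (\sum_i prt false _ * prt true _) => s1 s2.
move: (n%:R * dl) => D; move: ((j == k)%:R : R) (n%:R : R) => d N.
move=> h1 h2 h3 h4.
have key (u v D' : R) : `|v| <= D' -> u * v <= `|u| * D'.
  by move=> h; rewrite (le_trans (ler_norm _)) // normrM ler_wpM2l.
have k1 : `|s3 + s4 - N * d| <= 2 * D.
  have -> : s3 + s4 - N * d = (s3 - N * (d / 2)) + (s4 - N * (d / 2)) by field.
  by rewrite (le_trans (ler_normD _ _)) //; lra.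
have k2 : `|s1 - s2| <= 2 * D.
  by rewrite (le_trans (ler_normB _ _)) //; lra.
have := key x _ _ k1; have := key (- y) _ _ k2; rewrite normrN; nra.
Qed.

End Gram.

Section ArrayMoments.
Variables (R : realFieldType) (Om : Type) (K : finType) (xi : Om -> K -> R).
Variables (hasE : (Om -> R) -> R -> Prop) (M : nat -> R).
Hypothesis hasED : forall f g a b, hasE f a -> hasE g b ->
  hasE (fun w => f w + g w) (a + b).
Hypothesis hasEZ : forall c f a, hasE f a -> hasE (fun w => c * f w) (c * a).
Hypothesis hasE_mon : forall m, (forall k, (m k <= 4)%N) -> hasE (mon xi m) (mom M m).
Hypotheses (M0 : M 0%N = 1) (M1 : M 1%N = 0).
Variables (n : nat) (T : finType) (idx : 'I_n -> T -> K).
Hypothesis idx_inj : forall i i' p p', idx i p = idx i' p' -> i = i' /\ p = p'.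

Let dlt (x k : K) : nat := (k == x).

Let prod_delta (F : K -> nat -> R) x : (forall k, F k 0%N = 1) ->
  \prod_k F k (dlt x k) = F x 1%N.
Proof.
move=> F0; rewrite (bigD1 x) //= {1}/dlt eqxx big1 ?mulr1 // => k /negPf kx.
by rewrite /dlt kx F0.
Qed.

Let mon_delta x w : mon xi (dlt x) w = xi w x.
Proof. by rewrite /mon (@prod_delta (fun k j => xi w k ^+ j)). Qed.

Let mom_delta x c : mom M (fun k => dlt x k * c)%N = M c.
Proof.
by rewrite /mom (@prod_delta (fun k j => M (j * c)%N)) ?mul1n.
Qed.

Let mom_pair x y c : mom M (fun k => (dlt x k + dlt y k) * c)%N =
  if x == y then M (2 * c)%N else M c ^+ 2.
Proof.
case: eqP => [->|/eqP xy].
  rewrite -(mom_delta y); apply: eq_bigr => k _; congr M.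
  by rewrite addnn -mul2n mulnAC mulnC mulnA.
transitivity (mom M (fun k => (dlt x k * c) + (dlt y k * c))%N).
  by apply: eq_bigr => k _; rewrite mulnDl.
rewrite mom_disjoint // ?mom_delta ?expr2 // => k; rewrite /dlt.
by case: (eqVneq k x) => [->|_]; [right; rewrite (negPf xy)|left].
Qed.

Lemma array_cross (c : 'I_n -> R) p :
  exists2 v, hasE (fun w => (\sum_i c i * xi w (idx i p)) ^+ 2) v &
             v <= M 2%N * \sum_i c i ^+ 2.
Proof.
have [||i|v hv vle] := hasE_variance hasED hasEZ hasE_mon M0 (m := fun i => dlt (idx i p)) c (V := M 2%N).
- by move=> i k; rewrite /dlt; case: eqP.
- move=> i j ij k; rewrite /dlt; case: (eqVneq k (idx i p)) => [->|_]; [right|by left].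
  by case: eqP => // /idx_inj[e _]; move: ij; rewrite e eqxx.
- have -> : mom M (fun k => dlt (idx i p) k + dlt (idx i p) k)%N = M 2%N.
    by rewrite -(mom_delta (idx i p)); apply: eq_bigr => k _; rewrite addnn muln2.
  by rewrite gerBl sqr_ge0.
exists v => //; move: hv; set F := (fun w => _).
suff -> : (fun w => (\sum_i c i * xi w (idx i p)) ^+ 2) = F by [].
apply: funext => w; congr (_ ^+ 2); apply: eq_bigr => i _; rewrite mon_delta.
have -> : mom M (dlt (idx i p)) = M 1%N; last by rewrite M1 subr0.
by rewrite -(mom_delta (idx i p)); apply: eq_bigr => k _; rewrite muln1.
Qed.

(** The second moment of a summand's product is M 4 if p = q and M 2 squared otherwise, hence the
    two bounds on V; distinct times use disjoint variables. *)
Lemma array_gram (V : R) p q : M 4%N <= V -> M 2%N ^+ 2 <= V ->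
  exists2 v, hasE (fun w => (\sum_i (xi w (idx i p) * xi w (idx i q) -
                                      (p == q)%:R * M 2%N)) ^+ 2) v &
             v <= V * n%:R.
Proof.
move=> V4 V2.
have momE i : mom M (fun k => dlt (idx i p) k + dlt (idx i q) k)%N = (p == q)%:R * M 2%N.
  have := mom_pair (idx i p) (idx i q) 1.
  have -> : (idx i p == idx i q) = (p == q).
    by apply/eqP/eqP => [/idx_inj[]|->].
  rewrite M1 expr0n /= => e; transitivity (if p == q then M (2 * 1)%N else 0).
    by rewrite -e; apply: eq_bigr => k _; rewrite muln1.
  by case: eqP; rewrite ?mul1r ?mul0r.
have [||i|v hv vle] := hasE_variance hasED hasEZ hasE_mon M0
    (m := fun i k => (dlt (idx i p) k + dlt (idx i q) k)%N) (fun=> 1) (V := V).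
- by move=> i k; rewrite /dlt; case: eqP; case: eqP.
- move=> i j ij k; rewrite /dlt.
  have nx a b : idx i a = idx j b -> False.
    by move=> /idx_inj[e _]; move: ij; rewrite e eqxx.
  case: (eqVneq k (idx i p)) => [->|_]; [right|].
    by do 2![case: eqP => [/nx//|_]].
  case: (eqVneq k (idx i q)) => [->|_]; [right|by left].
  by do 2![case: eqP => [/nx//|_]].
- apply: (@le_trans _ _ (mom M (fun k => (dlt (idx i p) k + dlt (idx i q) k) * 2)%N)).
    rewrite -[leRHS]subr0 lerB ?sqr_ge0 // le_eqVlt; apply/orP; left; apply/eqP.
    by apply: eq_bigr => k _; rewrite muln2 addnn.
  by rewrite mom_pair; case: eqP.
exists v; last by move: vle; rewrite expr1n sumr_const card_ord.
move: hv; set F := (fun w => _).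
suff -> : (fun w => (\sum_i (xi w (idx i p) * xi w (idx i q) - (p == q)%:R * M 2%N)) ^+ 2) = F.
  by [].
apply: funext => w; congr (_ ^+ 2).
apply: eq_bigr => i _; rewrite mul1r momE; congr (_ - _).
by rewrite -monD !mon_delta.
Qed.

End ArrayMoments.

Lemma natmul_sum (R : pzSemiRingType) m (y : R) : m%:R * y = \sum_(i < m) y.
Proof. by rewrite sumr_const card_ord mulr_natl. Qed.

Section LatticeWords.
Variables (R : realType) (n t : nat) (h : R).
Local Notation C := R[i].
Local Notation J := ('I_n * ('I_t * bool))%type.

Definition lword (N : nat) := {ffun J -> 'I_(N.*2.+1)}.

Definition cseq N (a : lword N) (i : 'I_n) : 'cV[C]_t :=
  \col_j Complex (lat h (a (i, (j, false)))) (lat h (a (i, (j, true)))).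

Lemma prt_cseq N (a : lword N) i j b : prt b (cseq a i j 0) = lat h (a (i, (j, b))).
Proof. by rewrite /cseq mxE; case: b. Qed.

Lemma sum_J (F : J -> R) : \sum_p F p = \sum_i \sum_j \sum_b F (i, (j, b)).
Proof.
under [RHS]eq_bigr => i _ do rewrite (pair_bigA _ (fun j b => F (i, (j, b)))) /=.
rewrite (pair_bigA _ (fun i q => F (i, (q.1, q.2)))) /=.
by apply: eq_bigr => -[i [j b]].
Qed.

Lemma prod_J (F : J -> R) : \prod_p F p = \prod_i \prod_j \prod_b F (i, (j, b)).
Proof.
under [RHS]eq_bigr => i _ do rewrite (pair_bigA _ (fun j b => F (i, (j, b)))) /=.
rewrite (pair_bigA _ (fun i q => F (i, (q.1, q.2)))) /=.
by apply: eq_bigr => -[i [j b]].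
Qed.

Lemma sum_normsq_cseq N (a : lword N) :
  \sum_i \sum_j normsq (cseq a i j 0) = \sum_(p : J) lat h (a p) ^+ 2.
Proof.
rewrite sum_J; apply: eq_bigr => i _; apply: eq_bigr => j _.
by rewrite normsq_prt; apply: eq_bigr => b _; rewrite prt_cseq.
Qed.

Lemma weight_cseq N (a : lword N) :
  weight (@gw R h N) a = expR (- \sum_i \sum_j normsq (cseq a i j 0)).
Proof. by rewrite sum_normsq_cseq -sumrN expR_sum. Qed.

Lemma card_J : #|{: J}| = (n * (t * 2))%N.
Proof. by rewrite !card_prod !card_ord card_bool. Qed.

(* Chernoff bound: the indicator of the ellipsoid is at most expR (s - quadratic form). *)
Lemma count_test N (e : 'I_t -> R) (d Z s : R) (c : 'I_n -> 'cV[C]_t) :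
  (forall j, 0 < e j) ->
  (forall j x, \sum_k expR (- (@lat R h N k - x) ^+ 2 / e j) <= Num.sqrt (e j) * (1 + d) * Z) ->
  #|[pred a : lword N | \sum_i \sum_j normsq (cseq a i j 0 - c i j 0) / e j <= s]|%:R <=
  expR s * (\prod_j e j * ((1 + d) * Z) ^+ (t * 2)) ^+ n.
Proof.
move=> e0 th.
pose F (p : J) (k : 'I_(N.*2.+1)) := expR (- (lat h k - prt p.2.2 (c p.1 p.2.1 0)) ^+ 2 / e p.2.1).
have E (a : lword N) : \prod_p F p (a p) =
    expR (- \sum_i \sum_j normsq (cseq a i j 0 - c i j 0) / e j).
  rewrite /F -expR_sum; congr expR; rewrite -sumrN sum_J /=.
  apply: eq_bigr => i _; rewrite -sumrN.
  apply: eq_bigr => j _; rewrite normsq_prt mulr_suml -sumrN; apply: eq_bigr => b _.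
  rewrite mulNr; congr (- (_ ^+ 2 / _)); rewrite -prt_cseq.
  by case: (cseq a i j 0) => x y; case: (c i j 0) => x' y'; case: b.
apply: (@le_trans _ _ (\sum_(a : lword N) expR s * \prod_p F p (a p))).
  rewrite -sum1_card natr_sum big_mkcond /=; apply: ler_sum => a _; rewrite E -expRD.
  case: ifP => [|_]; last exact: expR_ge0.
  by rewrite inE => as_le; rewrite -[leLHS]expR0 ler_expR subr_ge0.
rewrite -mulr_sumr ler_wpM2l ?expR_ge0 //.
rewrite -(bigA_distr_bigA F) /=.
apply: (@le_trans _ _ (\prod_(p : J) (Num.sqrt (e p.2.1) * (1 + d) * Z))).
  apply: ler_prod => p _; rewrite th andbT; apply: sumr_ge0 => k _; exact: expR_ge0.
rewrite prod_J /= prodr_const card_ord le_eqVlt; apply/orP; left; apply/eqP.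
congr (_ ^+ n); rewrite mulnC exprM -[X in _ ^+ X]card_ord -prodr_const -big_split /=; apply: eq_bigr => j _.
by rewrite prodr_const card_bool -mulrA exprMn sqr_sqrtr // ltW.
Qed.

Variables (N : nat).
Local Notation w := (@gw R h N).
Local Notation x := (@lat R h N).
Local Notation Z := (theta h N).
Local Notation M := (fmoment w x).

Let w0 k : 0 < w k. Proof. exact: gw_gt0. Qed.
Let T0 : (0 < #|{: 'I_(N.*2.+1)}|)%N. Proof. exact: card_lat. Qed.

Lemma theta_gt0 : 0 < Z. Proof. by rewrite -total_gw; exact: total_gt0. Qed.

Lemma union_weight (I : finType) (B : I -> pred (lword N)) (c : R) :
  (forall i, \sum_(a | B i a) weight w a <= c) ->
  \sum_(a | [exists i, B i a]) weight w a <= #|I|%:R * c.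
Proof.
move=> h1; apply: (@le_trans _ _ (\sum_i \sum_(a | B i a) weight w a)); last first.
  by rewrite [leRHS]mulr_natl -sumr_const; apply: ler_sum => i _; exact: h1.
have wp a : 0 <= weight w a by rewrite ltW // weight_gt0.
under [leRHS]eq_bigr do rewrite big_mkcond /=.
rewrite exchange_big /= big_mkcond /=; apply: ler_sum => a _.
case: ifP => [/existsP[i Bi]|_]; last by apply: sumr_ge0 => i _; case: ifP.
by rewrite (bigD1 i) //= Bi lerDl; apply: sumr_ge0 => k _; case: ifP.
Qed.

Let idx (i : 'I_n) (p : 'I_t * bool) : J := (i, p).
Let idx_inj i i' p p' : idx i p = idx i' p' -> i = i' /\ p = p'.
Proof. by case. Qed.

Local Notation xiw := (fun (a : lword N) p => x (a p)).

(** Half of the tolerance absorbs the fluctuation, by Chebyshev; the other half absorbs the distance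
    of the lattice second moment from 1/2. *)
Lemma weight_not_gram (dl V : R) : 0 < dl -> (0 < n)%N -> `|M 2%N - 2^-1| <= dl / 2 ->
  M 4%N <= V -> M 2%N ^+ 2 <= V ->
  \sum_(a : lword N | ~~ `[< gram dl (cseq a) >]) weight w a <=
  Z ^+ #|{: J}| * ((t * 2)%:R ^+ 2 * (4 * V / (n%:R * dl ^+ 2))).
Proof.
move=> dl0 n0 hM V4 V2; have n0' : 0 < n%:R :> R by rewrite ltr0n.
pose B (pq : ('I_t * bool) * ('I_t * bool)) (a : lword N) :=
  n%:R * dl / 2 < `|\sum_i (x (a (idx i pq.1)) * x (a (idx i pq.2)) - (pq.1 == pq.2)%:R * M 2%N)|.
have sub (a : lword N) : ~~ `[< gram dl (cseq a) >] -> [exists pq, B pq a].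
  apply: contraNT; rewrite negb_exists => /forallP H; apply/asboolP => j k b b'.
  have := H ((j, b), (k, b')); rewrite /B -leNgt /= => Hjk.
  under eq_bigr do rewrite !prt_cseq.
  have -> : \sum_i (x (a (i, (j, b))) * x (a (i, (k, b'))) - ((j == k) && (b == b'))%:R / 2) =
    \sum_i (x (a (idx i (j, b))) * x (a (idx i (k, b'))) - ((j, b) == (k, b'))%:R * M 2%N) +
    n%:R * (((j == k) && (b == b'))%:R * (M 2%N - 2^-1)).
    rewrite (natmul_sum n) -big_split; apply: eq_bigr => i _ /=.
    by rewrite xpair_eqE; ring.
  apply: le_trans (ler_normD _ _) _; rewrite [leRHS](splitr (n%:R * dl)) lerD //.
  rewrite normrM ger0_norm ?ler0n // -mulrA ler_wpM2l // normrM.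
  by case: (_ && _); rewrite ?normr0 ?normr1 ?mul0r ?mul1r // divr_ge0 // ltW.
have wp a : 0 <= weight w a by rewrite ltW // weight_gt0.
apply: (@le_trans _ _ (\sum_(a : lword N | [exists pq, B pq a]) weight w a)).
  rewrite [leRHS](bigID (fun a => ~~ `[< gram dl (cseq a) >])) /=.
  rewrite -[leLHS]addr0 lerD ?sumr_ge0 //.
  rewrite le_eqVlt; apply/orP; left; apply/eqP; apply: eq_bigl => a.
  by case: (boolP (~~ `[< gram dl (cseq a) >])) => [/sub ->|_]; rewrite ?andbT ?andbF.
have := @union_weight _ B (Z ^+ #|{: J}| * (4 * V / (n%:R * dl ^+ 2))).
have -> : #|{: ('I_t * bool) * ('I_t * bool)}|%:R = (t * 2)%:R ^+ 2 :> R.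
  by rewrite !card_prod card_ord card_bool expr2 -natrM.
move=> H; apply: le_trans (H _) _; last by rewrite mulrCA.
move=> [p q].
have [v hv vle] := array_gram (@fhasED R J _ w) (@fhasEZ R J _ w)
  (fun m _ => @fhasE_mon R J _ w x w0 T0 m) (fmoment0 x w0 T0) (fmoment_gw1 h N) idx_inj p q V4 V2.
have t0 : 0 < n%:R * dl / 2 by rewrite divr_gt0 // mulr_gt0.
apply: le_trans (chebyshev_weight w0 t0 hv) _; rewrite total_gw.
have Zp : 0 <= Z ^+ #|{: J}| by rewrite exprn_ge0 // ltW // theta_gt0.
rewrite ler_wpM2l // ler_pdivrMr ?exprn_gt0 //; apply: le_trans vle _.
rewrite le_eqVlt; apply/orP; left; apply/eqP; field.
by rewrite !gt_eqF.
Qed.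

Lemma weight_not_cross m (dl : R) (y : 'I_n -> 'cV[C]_m) : 0 < dl -> (0 < n)%N ->
  M 2%N <= 1 -> (forall j b, \sum_i prt b (y i j 0) ^+ 2 <= n%:R) ->
  \sum_(a : lword N | ~~ `[< cross dl y (cseq a) >]) weight w a <=
  Z ^+ #|{: J}| * ((m * 2 * (t * 2))%:R * (n%:R * dl ^+ 2)^-1).
Proof.
move=> dl0 n0 M21 hy; have n0' : 0 < n%:R :> R by rewrite ltr0n.
pose B (pq : ('I_m * bool) * ('I_t * bool)) (a : lword N) :=
  n%:R * dl < `|\sum_i prt pq.1.2 (y i pq.1.1 0) * x (a (idx i pq.2))|.
have sub (a : lword N) : ~~ `[< cross dl y (cseq a) >] -> [exists pq, B pq a].
  apply: contraNT; rewrite negb_exists => /forallP H; apply/asboolP => j k b b'.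
  have := H ((j, b), (k, b')); rewrite /B -leNgt /= => Hjk.
  by under eq_bigr do rewrite !prt_cseq.
have wp a : 0 <= weight w a by rewrite ltW // weight_gt0.
apply: (@le_trans _ _ (\sum_(a : lword N | [exists pq, B pq a]) weight w a)).
  rewrite [leRHS](bigID (fun a => ~~ `[< cross dl y (cseq a) >])) /=.
  rewrite -[leLHS]addr0 lerD ?sumr_ge0 //.
  rewrite le_eqVlt; apply/orP; left; apply/eqP; apply: eq_bigl => a.
  by case: (boolP (~~ `[< cross dl y (cseq a) >])) => [/sub ->|_]; rewrite ?andbT ?andbF.
have := @union_weight _ B (Z ^+ #|{: J}| * (n%:R * dl ^+ 2)^-1).
have -> : #|{: ('I_m * bool) * ('I_t * bool)}| = (m * 2 * (t * 2))%N.
  by rewrite !card_prod !card_ord card_bool.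
move=> H; apply: le_trans (H _) _; last by rewrite mulrCA.
move=> [[j b] q].
have [v hv vle] := array_cross (@fhasED R J _ w) (@fhasEZ R J _ w)
  (fun m _ => @fhasE_mon R J _ w x w0 T0 m) (fmoment0 x w0 T0) (fmoment_gw1 h N) idx_inj
  (fun i => prt b (y i j 0)) q.
have t0 : 0 < n%:R * dl by rewrite mulr_gt0.
apply: le_trans (chebyshev_weight w0 t0 hv) _; rewrite total_gw.
have Zp : 0 <= Z ^+ #|{: J}| by rewrite exprn_ge0 // ltW // theta_gt0.
rewrite ler_wpM2l // ler_pdivrMr ?exprn_gt0 //.
have vn : v <= n%:R.
  apply: le_trans vle _; apply: le_trans (ler_wpM2r _ M21) _.
    by apply: sumr_ge0 => i _; exact: sqr_ge0.
  by rewrite mul1r.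
apply: le_trans vn _; rewrite le_eqVlt; apply/orP; left; apply/eqP; field.
by rewrite !gt_eqF.
Qed.

(* Change of measure: a set carrying half of the Gaussian weight has almost full entropy. *)
Lemma count_typical (S : pred (lword N)) (dl : R) :
  \sum_(a | ~~ S a) weight w a <= Z ^+ #|{: J}| / 2 ->
  (forall a, S a -> gram dl (cseq a)) ->
  Z ^+ #|{: J}| / 2 * expR (n%:R * (t%:R * (1 - 2 * dl))) <= #|S|%:R.
Proof.
move=> hS gS; have E0 := expR_gt0 (n%:R * (t%:R * (1 - 2 * dl))).
(* The Gram condition forces total energy at least n t (1 - 2 dl), so no word of S weighs more than
   this exponential. *)
have : \sum_(a | S a) weight w a <= #|S|%:R * expR (- (n%:R * (t%:R * (1 - 2 * dl)))).
  rewrite mulr_natl -sumr_const; apply: ler_sum => a Sa.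
  rewrite weight_cseq ler_expR lerN2 exchange_big /= mulrCA (natmul_sum t).
  apply: ler_sum => j _.
  have gp b : n%:R * (2^-1 - dl) <= \sum_i prt b (cseq a i j 0) ^+ 2.
    have := gS a Sa j j b b; rewrite !eqxx /= mul1r sumrB sumr_const card_ord.
    rewrite -[X in _ - X]mulr_natl ler_norml => /andP[h1 _].
    under eq_bigr do rewrite expr2.
    rewrite mulrBr; lra.
  under eq_bigr do rewrite normsq_prt; rewrite exchange_big /= big_bool /=.
  have := gp true; have := gp false.
  move: (\sum_i _) (\sum_i _) => u v; lra.
have := sum_weight J w; rewrite total_gw (bigID S) /= => tot h1.
rewrite expRN in h1; rewrite ler_pdivlMr // in h1.
apply: le_trans h1; rewrite ler_pM2r //.
lra.
Qed.

End LatticeWords.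

Section FiniteUnionBound.
Local Open Scope ereal_scope.
Context d (T : measurableType d) (R : realType) (P : probability T R).

Lemma union_bound_sum (I : finType) (B : I -> set T) (c : I -> R) :
  (forall i, measurable (B i)) -> (forall i, P (B i) <= (c i)%:E) ->
  P (\bigcup_(i in [set: I]) B i) <= (\sum_i c i)%:E.
Proof.
move=> mB hB.
have -> : \bigcup_(i in [set: I]) B i = \big[setU/set0]_i B i.
  apply/seteqP; split => z.
    by move=> [i _ Bi]; rewrite (bigD1 i) //=; left.
  move: z; apply: (big_ind (fun A => A `<=` \bigcup_(i in [set: I]) B i)).
  - by move=> z [].
  - by move=> A A' h h' z [/h|/h'].
  - by move=> i _ z Bi; exists i.
have H (s : seq I) : measurable (\big[setU/set0]_(i <- s) B i) /\
    P (\big[setU/set0]_(i <- s) B i) <= \sum_(i <- s) (c i)%:E.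
  elim: s => [|i s [mA hA]]; first by rewrite !big_nil; split; [exact: measurable0|rewrite measure0].
  rewrite !big_cons; split; first exact: measurableU.
  by apply: le_trans (measureU2 _ (mB i) mA) _; exact: leeD (hB i) hA.
have [_ h] := H (index_enum I); by apply: le_trans h _; rewrite sumEFin.
Qed.

Lemma union_bound (I : finType) (B : I -> set T) (c : R) :
  (forall i, measurable (B i)) -> (forall i, P (B i) <= c%:E) ->
  P (\bigcup_(i in [set: I]) B i) <= (#|I|%:R * c)%:E.
Proof.
move=> mB hB; apply: le_trans (union_bound_sum mB hB) _.
by rewrite sumr_const mulr_natl.
Qed.

End FiniteUnionBound.

Lemma gmoment4_ge0 (R : realType) : 0 <= gmoment R 4.
Proof. by apply: fine_ge0; apply: integral_ge0 => x _; rewrite lee_fin exprn_even_ge0. Qed.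

Section NoiseConcentration.
Variables (R : realType) (n r : nat).
Local Notation C := R[i].
Local Notation tup := ((n * r * 2).-tuple R).

Let idx (i : 'I_n) (p : 'I_r * bool) : 'I_(n * r * 2) :=
  mxvec_index (mxvec_index i p.1) (if p.2 then ord_max else ord0 : 'I_2).

Lemma mxvec_index_inj m k (i i' : 'I_m) (j j' : 'I_k) :
  mxvec_index i j = mxvec_index i' j' -> i = i' /\ j = j'.
Proof. by move=> /cast_ord_inj/enum_rank_inj[]. Qed.

Let idx_inj i i' p p' : idx i p = idx i' p' -> i = i' /\ p = p'.
Proof.
case: p => j b; case: p' => j' b' /mxvec_index_inj[/mxvec_index_inj[/= -> ->]].
by case: b; case: b'.
Qed.

Lemma prt_noise (z : tup) i j b : prt b (noise_seq z i j 0) = tnth z (idx i (j, b)).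
Proof. by rewrite /noise_seq mxE; case: b. Qed.

Variable P : probability tup R.
Hypothesis hP : iid_cgauss P.

Let mt k : measurable_fun setT (fun z : tup => tnth z k).
Proof. exact: measurable_tnth. Qed.

Let msum (F : 'I_n -> tup -> R) : (forall i, measurable_fun setT (F i)) ->
  measurable_fun setT (fun z => \sum_i F i z).
Proof. by move=> mF; exact: measurable_sum. Qed.

Let mlt (F : tup -> R) (c : R) : measurable_fun setT F ->
  measurable [set z | (c < `|F z|)%R].
Proof.
move=> mF; rewrite -[X in measurable X]setTI.
have := measurable_fun_ltr (measurable_cst c) (measurableT_comp (@normr_measurable R setT) mF).
by move=> /(_ measurableT [set true] I); rewrite setTI.
Qed.

Lemma gram_noise_bad (dl : R) : 0 < dl -> (0 < n)%N ->
  measurable [set z : tup | ~ gram dl (noise_seq z)] /\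
  (P [set z | ~ gram dl (noise_seq z)] <=
   ((r * 2)%:R ^+ 2 * ((gmoment R 4 + 1) / (n%:R * dl ^+ 2)))%:E)%E.
Proof.
move=> dl0 n0; have n0' : 0 < n%:R :> R by rewrite ltr0n.
pose F (pq : ('I_r * bool) * ('I_r * bool)) (z : tup) :=
  \sum_i (tnth z (idx i pq.1) * tnth z (idx i pq.2) - (pq.1 == pq.2)%:R * gmoment R 2).
have mF pq : measurable_fun setT (F pq).
  by apply: msum => i; apply: measurable_funB => //; exact: measurable_funM.
have mB pq : measurable [set z | (n%:R * dl < `|F pq z|)%R] by exact: mlt.
have E : [set z : tup | ~ gram dl (noise_seq z)] =
    \bigcup_(pq in [set: ('I_r * bool) * ('I_r * bool)]) [set z | (n%:R * dl < `|F pq z|)%R].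
  have FE z j k b b' : \sum_i (prt b (noise_seq z i j 0) * prt b' (noise_seq z i k 0) -
      ((j == k) && (b == b'))%:R / 2) = F ((j, b), (k, b')) z.
    by rewrite /F gmoment2; apply: eq_bigr => i _; rewrite !prt_noise xpair_eqE.
  apply/seteqP; split => z /=.
    move=> ng; apply: contrapT => H; apply: ng => j k b b'; rewrite FE leNgt.
    by apply/negP => h; apply: H; exists ((j, b), (k, b')).
  move=> [[[j b] [k b']] _ /=] h g; move: h; rewrite ltNge => /negP; apply.
  by have := g j k b b'; rewrite FE.
rewrite E; split; first exact: fin_bigcup_measurable.
have -> : (r * 2)%:R ^+ 2 = #|{: ('I_r * bool) * ('I_r * bool)}|%:R :> R.
  by rewrite !card_prod card_ord card_bool expr2 -natrM.
have g40 := gmoment4_ge0 R.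
have V4 : gmoment R 4 <= gmoment R 4 + 1 by rewrite lerDl.
have V2 : gmoment R 2 ^+ 2 <= gmoment R 4 + 1.
  rewrite gmoment2; have : (2^-1 : R) ^+ 2 <= 1 by rewrite exprn_ile1 ?invr_ge0 // invf_le1 ?ler1n.
  lra.
apply: union_bound => // -[p q].
have [v hv vle] := @array_gram R tup 'I_(n * r * 2) (fun z k => tnth z k) (nhasE P) (@gmoment R)
  (@nhasED _ _ P) (@nhasEZ _ _ P) (nhasE_mon hP) (gmoment0 R) (gmoment1 R) n _ idx idx_inj
  (gmoment R 4 + 1) p q V4 V2.
apply: le_trans (nchebyshev (mF (p, q)) _ hv) _; first by rewrite mulr_gt0.
rewrite lee_fin ler_pdivrMr ?exprn_gt0 ?mulr_gt0 //.
have -> : (gmoment R 4 + 1) / (n%:R * dl ^+ 2) * (n%:R * dl) ^+ 2 = (gmoment R 4 + 1) * n%:R.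
  by field; rewrite !gt_eqF.
exact: vle.
Qed.

Lemma cross_noise_bad m (dl : R) (y : 'I_n -> 'cV[C]_m) : 0 < dl -> (0 < n)%N ->
  (forall j b, \sum_i prt b (y i j 0) ^+ 2 <= n%:R) ->
  measurable [set z : tup | ~ cross dl y (noise_seq z)] /\
  (P [set z | ~ cross dl y (noise_seq z)] <=
   ((m * 2 * (r * 2))%:R * (n%:R * dl ^+ 2)^-1)%:E)%E.
Proof.
move=> dl0 n0 hy; have n0' : 0 < n%:R :> R by rewrite ltr0n.
pose F (pq : ('I_m * bool) * ('I_r * bool)) (z : tup) :=
  \sum_i prt pq.1.2 (y i pq.1.1 0) * tnth z (idx i pq.2).
have mF pq : measurable_fun setT (F pq).
  by apply: msum => i; exact: measurable_funM.
have mB pq : measurable [set z | (n%:R * dl < `|F pq z|)%R] by exact: mlt.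
have E : [set z : tup | ~ cross dl y (noise_seq z)] =
    \bigcup_(pq in [set: ('I_m * bool) * ('I_r * bool)]) [set z | (n%:R * dl < `|F pq z|)%R].
  have FE z j k b b' : \sum_i (prt b (y i j 0) * prt b' (noise_seq z i k 0)) =
      F ((j, b), (k, b')) z.
    by rewrite /F; apply: eq_bigr => i _; rewrite !prt_noise.
  apply/seteqP; split => z /=.
    move=> ng; apply: contrapT => H; apply: ng => j k b b'; rewrite FE leNgt.
    by apply/negP => h; apply: H; exists ((j, b), (k, b')).
  move=> [[[j b] [k b']] _ /=] h g; move: h; rewrite ltNge => /negP; apply.
  by have := g j k b b'; rewrite FE.
rewrite E; split; first exact: fin_bigcup_measurable.
have -> : (m * 2 * (r * 2))%:R = #|{: ('I_m * bool) * ('I_r * bool)}|%:R :> R.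
  by rewrite !card_prod !card_ord card_bool.
apply: union_bound => // -[[j b] q].
have [v hv vle] := @array_cross R tup 'I_(n * r * 2) (fun z k => tnth z k) (nhasE P) (@gmoment R)
  (@nhasED _ _ P) (@nhasEZ _ _ P) (nhasE_mon hP) (gmoment0 R) (gmoment1 R) n _ idx idx_inj
  (fun i => prt b (y i j 0)) q.
apply: le_trans (nchebyshev (mF ((j, b), q)) _ hv) _; first by rewrite mulr_gt0.
rewrite lee_fin ler_pdivrMr ?exprn_gt0 ?mulr_gt0 //.
have -> : (n%:R * dl ^+ 2)^-1 * (n%:R * dl) ^+ 2 = n%:R.
  by field; rewrite !gt_eqF.
apply: le_trans vle _; rewrite gmoment2; have := hy j b.
have : 0 <= \sum_i prt b (y i j 0) ^+ 2 by apply: sumr_ge0 => i _; exact: sqr_ge0.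
by move: (\sum_i _) => s s0 sn; rewrite mulrC; lra.
Qed.

End NoiseConcentration.

(** * Block coding *)

Section BlockCode.
Variables (R : realType) (n t r1 r2 : nat).
Local Notation C := R[i].
Variables (G : 'M[C]_(r1, t)) (K : 'M[C]_(r2, t)).

(** Exchange of the codeword average with the noise integral: a bound valid for every fixed received
    word bounds the average acceptance probability. *)
Lemma avg_prob d (T : measurableType d) (Q : probability T R) (A : finType)
    (S : A -> set T) (k : R) : (0 < #|A|)%N -> (forall a, measurable (S a)) ->
  (forall z, avg (fun a => (z \in S a)%:R) <= k) -> avg (fun a => fine (Q (S a))) <= k.
Proof.
move=> A0 mS hS.
have i0 : 0 <= #|A|%:R^-1 :> R by rewrite invr_ge0.
rewrite -lee_fin.
have -> : (avg (fun a => fine (Q (S a))))%:E =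
    (\int[Q]_z (avg (fun a => (z \in S a)%:R : R))%:E)%E.
  rewrite /avg EFinM -sumEFin.
  under [in RHS]eq_integral do rewrite EFinM -sumEFin.
  rewrite (ge0_integralZl_EFin Q measurableT _ _ i0); last 2 first.
  - by move=> z _; apply: sume_ge0 => a _; rewrite lee_fin.
  - apply: emeasurable_sum => a; apply/measurable_EFinP.
    exact: (measurable_indic (mS a)).
  have mi a : measurable_fun setT (fun z : T => ((z \in S a)%:R : R)%:E).
    by apply/measurable_EFinP; exact: (measurable_indic (mS a)).
  congr (_ * _)%E; rewrite ge0_integral_sum //.
  apply: eq_bigr => a _; rewrite fineK ?fin_num_measure //.
  by rewrite -[in LHS](setIT (S a)) -integral_indic.
apply: (@le_trans _ _ (\int[Q]_z (cst k%:E) z)%E).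
  have f0 z : 0 <= avg (fun a => (z \in S a)%:R) :> R.
    by rewrite mulr_ge0 // sumr_ge0.
  apply: ge0_le_integral => //.
  - by move=> z _; rewrite lee_fin.
  - apply/measurable_EFinP; apply: measurable_funM => //.
    by apply: measurable_sum => a; exact: (measurable_indic (mS a)).
  - by move=> z _; rewrite lee_fin.
rewrite integral_cst //; rewrite [X in (_ * X)%E](_ : _ = 1%E) ?mule1 //; exact: probability_setT.
Qed.

Lemma measurable_decision d (T : measurableType d) (I : finType) (B : eqType)
    (b : I -> T -> bool) (F : {ffun I -> bool} -> B) (y : B) :
  (forall i, measurable [set z | b i z]) ->
  measurable [set z | F [ffun i => b i z] = y].
Proof.
move=> mb.
have -> : [set z | F [ffun i => b i z] = y] =
    \bigcup_(f in [set f : {ffun I -> bool} | F f = y])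
    \bigcap_(i in [set: I]) [set z | b i z = f i].
  apply/seteqP; split => z /=.
    by move=> e; exists [ffun i => b i z] => // i _ /=; rewrite ffunE.
  move=> [f /= <- H]; congr F; apply/ffunP => i; rewrite ffunE; exact: H.
apply: fin_bigcup_measurable => [|f _]; first exact: finite_finset.
apply: fin_bigcap_measurable => [|i _]; first exact: finite_finset.
case: (f i); first exact: mb.
have -> : [set z | b i z = false] = ~` [set z | b i z].
  by apply/seteqP; split => z /=; [move=> ->|move/negP/negPf].
exact: measurableC.
Qed.

Lemma measurable_negb d (T : measurableType d) (b : T -> bool) :
  measurable [set z | b z] -> measurable [set z | ~~ b z].
Proof.
move=> mb; have -> : [set z | ~~ b z] = ~` [set z | b z].
  by apply/seteqP; split => z /negP.
exact: measurableC.
Qed.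

(** The codebook costs need a law fixed in advance. If no law satisfies [iid_cgauss], any measure
    will do, and a Dirac mass is taken. *)
Lemma iid_canonical k : exists Q : probability (k.-tuple R) R,
  forall P, iid_cgauss P -> forall A, measurable A -> P A = Q A.
Proof.
have [[P0 h0]|no] := EM (exists P : probability (k.-tuple R) R, iid_cgauss P).
  by exists P0 => P hP; exact: iid_cgauss_unique.
exists (@dirac _ (k.-tuple R) [tuple 0 | i < k] R) => P hP.
by exfalso; apply: no; exists P.
Qed.

Lemma rtrace_col m (v : 'cV[C]_m) : rtrace (v *m ctr v) = \sum_j normsq (v j 0).
Proof.
rewrite rtrace_gram; apply: eq_bigr => j _; rewrite big_ord1.
by rewrite -add_Re2_Im2.
Qed.

(** Subtracting the mean only lowers the trace of the covariance. *)
Lemma power_ok_of_words M1 M2 (enc : 'I_M1 -> 'I_M2 -> 'I_n -> 'cV[C]_t) (Pw : R) :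
  (0 < M1)%N -> (0 < M2)%N ->
  (forall m1 m2, \sum_i \sum_j normsq (enc m1 m2 i j 0) <= n%:R * Pw) -> power_ok enc Pw.
Proof.
move=> M10 M20 h; rewrite /power_ok; set c := cR _; set mean := (fun i => _).
have cp : 0 < (M1 * M2)%:R :> R by rewrite ltr0n muln_gt0 M10.
have rsum (I : Type) (s : seq I) (F : I -> 'M[C]_t) :
    rtrace (\sum_(i <- s) F i) = \sum_(i <- s) rtrace (F i).
  exact: (big_morph _ (@rtraceD R t) (rtrace0 _ _)).
apply: (@le_trans _ _ (\sum_i ((M1 * M2)%:R^-1 *
    \sum_m1 \sum_m2 \sum_j normsq (enc m1 m2 i j 0)))).
  apply: ler_sum => i _; rewrite rtraceB rtraceZ rsum.
  have -> : \sum_(m1 < M1) rtrace (\sum_(m2 < M2) enc m1 m2 i *m ctr (enc m1 m2 i)) =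
      \sum_m1 \sum_m2 \sum_j normsq (enc m1 m2 i j 0).
    apply: eq_bigr => m1 _; rewrite rsum; apply: eq_bigr => m2 _; exact: rtrace_col.
  by rewrite gerBl; exact/rtrace_psd/psd_gram.
rewrite -mulr_sumr ler_pdivrMl // mulrC -[leRHS]mulrC natrM.
rewrite exchange_big /=.
apply: (@le_trans _ _ (\sum_(m1 < M1) \sum_(m2 < M2) n%:R * Pw)).
  apply: ler_sum => m1 _; rewrite exchange_big /=; apply: ler_sum => m2 _; exact: h.
by rewrite -(natmul_sum M1) -(natmul_sum M2) mulrA.
Qed.

Variables (A U : finType) (word : A -> U -> 'I_n -> 'cV[C]_t) (good : A -> U -> bool).
Variables (T1 : A -> ('I_n -> 'cV[C]_r1) -> bool) (T2 : U -> ('I_n -> 'cV[C]_r2) -> bool).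
Variables (k1 k2 rho nu Pw : R).
Hypotheses (A0 : (0 < #|A|)%N) (U0 : (0 < #|U|)%N) (nu0 : 0 <= nu) (Pw0 : 0 <= Pw).
Hypothesis mT1 : forall a x, measurable [set z : (n * r1 * 2).-tuple R | T1 a (out_seq G x z)].
Hypothesis mT2 : forall u x, measurable [set z : (n * r2 * 2).-tuple R | T2 u (out_seq K x z)].
Hypothesis hk1 : forall y, avg (fun a => (T1 a y)%:R) <= k1.
Hypothesis hk2 : forall y, avg (fun u => (T2 u y)%:R) <= k2.
Hypothesis hgood : forall a, rho <= avg (fun u => (good a u)%:R).
Hypothesis hn1 : forall P, iid_cgauss P -> forall a u, good a u ->
  (P [set z | ~~ T1 a (out_seq G (word a u) z)] <= nu%:E)%E.
Hypothesis hn2 : forall P, iid_cgauss P -> forall a u, good a u ->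
  (P [set z | ~~ T2 u (out_seq K (word a u) z)] <= nu%:E)%E.
Hypothesis hpow : forall a u, good a u ->
  \sum_i \sum_j normsq (word a u i j 0) <= n%:R * Pw.
Variables (M1 M2 L : nat) (eps : R).
Hypotheses (M10 : (0 < M1)%N) (M20 : (0 < M2)%N).
Hypothesis heps : nu + (2 * (1 - rho) ^+ L + M1.-1%:R * k1 + (M2.-1 * L)%:R * k2) <= eps.

(** If nothing passes, message 0 is returned; the failure of the right word's own test already
    accounts for that event. *)
Definition first_of M (M0 : (0 < M)%N) (f : {ffun 'I_M -> bool}) : 'I_M :=
  odflt (Ordinal M0) [pick m | f m].

Lemma first_of_neq M (M0 : (0 < M)%N) (f : {ffun 'I_M -> bool}) m :
  first_of M0 f != m -> ~~ f m \/ exists2 m', m' != m & f m'.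
Proof.
rewrite /first_of; case: pickP => [m' fm' /= m'm|nf _]; first by right; exists m'.
by left; rewrite nf.
Qed.

Lemma decode_error k r M (H : 'M[C]_(r, t)) (P : probability ((n * r * 2).-tuple R) R)
    (b : 'I_M -> ('I_n -> 'cV[C]_r) -> bool) (M0 : (0 < M)%N) x m (q : 'I_M -> R) :
  (forall m', measurable [set z | b m' (out_seq H x z)]) ->
  (forall m', (P [set z | b m' (out_seq H x z)] <= (q m')%:E)%E) ->
  (P [set z | ~~ b m (out_seq H x z)] <= k%:E)%E ->
  (P [set z | first_of M0 [ffun m' => b m' (out_seq H x z)] != m] <=
   (k + \sum_(m' | m' != m) q m')%:E)%E.
Proof.
move=> mb hq hk.
pose B m' := [set z | b m' (out_seq H x z)].
have mU (s : seq 'I_M) : measurable (\big[setU/set0]_(m' <- s | m' != m) B m') /\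
    (P (\big[setU/set0]_(m' <- s | m' != m) B m') <= (\sum_(m' <- s | m' != m) q m')%:E)%E.
  elim: s => [|m' s [ms hs]]; first by rewrite !big_nil; split; [exact: measurable0|rewrite measure0].
  rewrite !big_cons; case: ifP => // _; split; first exact: measurableU (mb m') ms.
  by apply: le_trans (measureU2 _ (mb m') ms) _; rewrite EFinD; exact: leeD (hq m') hs.
have [mU1 hU1] := mU (index_enum 'I_M).
have mN : measurable [set z | ~~ b m (out_seq H x z)].
  have -> : [set z | ~~ b m (out_seq H x z)] = ~` B m.
    by apply/seteqP; split => z /negP.
  by apply: measurableC; exact: mb.
have -> : (k + \sum_(m' | m' != m) q m')%:E = (k%:E + (\sum_(m' | m' != m) q m')%:E)%E.
  by rewrite EFinD.
apply: le_trans (leeD hk hU1); apply: le_trans (measureU2 _ mN mU1).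
apply: le_measure; rewrite ?inE.
- have -> : [set z | first_of M0 [ffun m' => b m' (out_seq H x z)] != m] =
      ~` [set z | first_of M0 [ffun m' => b m' (out_seq H x z)] = m].
    by apply/seteqP; split => z /=; [move/eqP|move=> h; apply/eqP].
  apply: measurableC.
  exact: (measurable_decision (b := fun m' z => b m' (out_seq H x z))).
- exact: measurableU mN mU1.
- move=> z /= /first_of_neq; rewrite ffunE => -[nb|[m' mm']]; first by left.
  by rewrite ffunE => bm'; right; rewrite (bigD1 m') //=; left.
Qed.

Lemma block_code : exists (enc : 'I_M1 -> 'I_M2 -> 'I_n -> 'cV[C]_t)
    (dec1 : ('I_n -> 'cV[C]_r1) -> 'I_M1) (dec2 : ('I_n -> 'cV[C]_r2) -> 'I_M2),
  [/\ power_ok enc Pw,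
      dec_measurable G [set x | exists m1 m2, x = enc m1 m2] dec1 /\
      dec_measurable K [set x | exists m1 m2, x = enc m1 m2] dec2 &
      forall P1 P2, iid_cgauss P1 -> iid_cgauss P2 ->
        (err_prob G enc dec1 (fun m1 _ => m1) P1 <= eps%:E)%E /\
        (err_prob K enc dec2 (fun _ m2 => m2) P2 <= eps%:E)%E].
Proof.
have [Q1 hQ1] := iid_canonical (n * r1 * 2).
have [Q2 hQ2] := iid_canonical (n * r2 * 2).
pose p1 a x := fine (Q1 [set z | T1 a (out_seq G x z)]).
pose p2 u x := fine (Q2 [set z | T2 u (out_seq K x z)]).
have hp1 x : avg (p1^~ x) <= k1.
  apply: avg_prob => // z; apply: le_trans (hk1 (out_seq G x z)).
  by apply: avg_le => a; rewrite ler_nat leq_eqVlt; apply/orP; left; apply/eqP; congr nat_of_bool;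
     apply/idP/idP; rewrite inE.
have hp2 x : avg (p2^~ x) <= k2.
  apply: avg_prob => // z; apply: le_trans (hk2 (out_seq K x z)).
  by apply: avg_le => a; rewrite ler_nat leq_eqVlt; apply/orP; left; apply/eqP; congr nat_of_bool;
     apply/idP/idP; rewrite inE.
have [c [b hcb]] := @good_codebook R A U ('I_n -> 'cV[C]_t) good word (fun=> 0) p1 p2 k1 k2 rho
  M1 M2 L A0 U0 hp1 hp2 hgood.
(* The zero word is sent when the bin has no compatible entry; it satisfies the power constraint. *)
pose enc m1 m2 := cword good word (fun=> 0) (c m1) (b m2).
pose b1 m y := T1 (c m) y.
pose b2 m y := [exists l, T2 (b m l) y].
pose dec1 y := first_of M10 [ffun m => b1 m y].
pose dec2 y := first_of M20 [ffun m => b2 m y].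
have mb1 m x : measurable [set z | b1 m (out_seq G x z)] by exact: mT1.
have b2E m x : [set z | b2 m (out_seq K x z)] =
    \bigcup_(l in [set: 'I_L]) [set z | T2 (b m l) (out_seq K x z)].
  apply/seteqP; split => z /=; first by move=> /existsP[l h]; exists l.
  by move=> [l _ h]; apply/existsP; exists l.
have mb2 m x : measurable [set z | b2 m (out_seq K x z)].
  by rewrite b2E; apply: fin_bigcup_measurable => [|l _]; [exact: finite_finset|exact: mT2].
exists enc, dec1, dec2; split.
- apply: power_ok_of_words => // m1 m2; rewrite /enc /cword /sel.
  case: pickP => [l /hpow//|_].
  rewrite big1 ?mulr_ge0 // => i _; rewrite big1 // => j _.
  by rewrite mxE /normsq /= expr0n addr0.
- split; move=> x _ m.
    exact: (measurable_decision (b := fun m' z => b1 m' (out_seq G x z))).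
  exact: (measurable_decision (b := fun m' z => b2 m' (out_seq K x z))).
move=> P1 P2 iP1 iP2.
have mdec1 x m : measurable [set z | dec1 (out_seq G x z) != m].
  apply: (@measurable_negb _ _ (fun z => dec1 (out_seq G x z) == m)).
  have := measurable_decision (first_of M10) m (mb1^~ x).
  by congr measurable; apply/seteqP; split => z /=; [move=> h; apply/eqP|move/eqP].
have mdec2 x m : measurable [set z | dec2 (out_seq K x z) != m].
  apply: (@measurable_negb _ _ (fun z => dec2 (out_seq K x z) == m)).
  have := measurable_decision (first_of M20) m (mb2^~ x).
  by congr measurable; apply/seteqP; split => z /=; [move=> h; apply/eqP|move/eqP].
have c1ge m1 m2 : 0 <= cost1 good word (fun=> 0) p1 c b m1 m2.
  by rewrite addr_ge0 // sumr_ge0 // => m _; rewrite fine_ge0.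
have c2ge m1 m2 : 0 <= cost2 good word (fun=> 0) p2 c b m1 m2.
  rewrite addr_ge0 // sumr_ge0 // => m _; rewrite sumr_ge0 // => l _.
  by rewrite fine_ge0.
have e1 m1 m2 : (P1 [set z | dec1 (out_seq G (enc m1 m2) z) != m1] <=
    (nu + cost1 good word (fun=> 0) p1 c b m1 m2)%:E)%E.
  (* In a miss the cost is at least 1, and any probability is below it. *)
  case E : (sel good (c m1) (b m2)) => [l|]; last first.
    apply: le_trans (probability_le1 _ _) _; first exact: mdec1.
    rewrite lee_fin /cost1 E eqxx addrCA lerDl addr_ge0 //.
    by rewrite sumr_ge0 // => m _; rewrite fine_ge0.
  have gl : good (c m1) (b m2 l) by move: E; rewrite /sel; case: pickP => // l' h [<-].
  have encE : enc m1 m2 = word (c m1) (b m2 l) by rewrite /enc /cword E.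
  have := @decode_error nu r1 M1 G P1 b1 M10 (enc m1 m2) m1 (fun m => p1 (c m) (enc m1 m2)).
  move=> /(_ _ _ _)/le_trans; apply.
  - by move=> m; exact: mb1.
  - by move=> m; rewrite (hQ1 _ iP1) // /p1 fineK // fin_num_measure.
  - by rewrite encE; exact: hn1.
  - by rewrite /cost1 E /= add0r.
have e2 m1 m2 : (P2 [set z | dec2 (out_seq K (enc m1 m2) z) != m2] <=
    (nu + cost2 good word (fun=> 0) p2 c b m1 m2)%:E)%E.
  case E : (sel good (c m1) (b m2)) => [l|]; last first.
    apply: le_trans (probability_le1 _ _) _; first exact: mdec2.
    rewrite lee_fin /cost2 E eqxx addrCA lerDl addr_ge0 //.
    by rewrite sumr_ge0 // => m _; rewrite sumr_ge0 // => l _; rewrite fine_ge0.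
  have gl : good (c m1) (b m2 l) by move: E; rewrite /sel; case: pickP => // l' h [<-].
  have encE : enc m1 m2 = word (c m1) (b m2 l) by rewrite /enc /cword E.
  have := @decode_error nu r2 M2 K P2 b2 M20 (enc m1 m2) m2
    (fun m => \sum_l p2 (b m l) (enc m1 m2)).
  move=> /(_ _ _ _)/le_trans; apply.
  - by move=> m; exact: mb2.
  - move=> m; rewrite b2E; apply: union_bound_sum => [l'|l']; first exact: mT2.
    by rewrite (hQ2 _ iP2) // /p2 fineK // fin_num_measure.
  - rewrite encE; apply: le_trans (hn2 iP2 gl); apply: le_measure; rewrite ?inE.
    + by apply: measurable_negb; exact: mb2.
    + by apply: measurable_negb; exact: mT2.
    + by move=> z /=; apply: contra => h; apply/existsP; exists l.
  - by rewrite /cost2 E /= add0r.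
have fin (F : 'I_M1 -> 'I_M2 -> \bar R) (cost : 'I_M1 -> 'I_M2 -> R) :
    (forall m1 m2, (F m1 m2 <= (nu + cost m1 m2)%:E)%E) ->
    \sum_m1 \sum_m2 cost m1 m2 <= (M1 * M2)%:R *
      (2 * (1 - rho) ^+ L + M1.-1%:R * k1 + (M2.-1 * L)%:R * k2) ->
    (((M1 * M2)%:R^-1)%:E * (\sum_(m1 < M1) \sum_(m2 < M2) F m1 m2) <= eps%:E)%E.
  move=> hF hc; have cp : 0 < (M1 * M2)%:R :> R by rewrite ltr0n muln_gt0 M10.
  rewrite lee_pdivrMl //.
  apply: (@le_trans _ _ (\sum_(m1 < M1) \sum_(m2 < M2) (nu + cost m1 m2)%:E)%E).
    by apply: lee_sum => m1 _; apply: lee_sum => m2 _; exact: hF.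
  under eq_bigr do rewrite sumEFin; rewrite sumEFin -EFinM lee_fin.
  apply: le_trans (ler_wpM2l (ltW cp) heps); rewrite mulrDr.
  have -> : \sum_(m1 < M1) \sum_(m2 < M2) (nu + cost m1 m2) =
      (M1 * M2)%:R * nu + \sum_m1 \sum_m2 cost m1 m2.
    under eq_bigr do rewrite big_split /= -(natmul_sum M2).
    by rewrite big_split /= -(natmul_sum M1) natrM mulrA.
  by rewrite lerD2l.
split.
- apply: (fin _ _ e1); apply: le_trans hcb; apply: ler_sum => m1 _; apply: ler_sum => m2 _.
  by rewrite lerDl c2ge.
- apply: (fin _ _ e2); apply: le_trans hcb; apply: ler_sum => m1 _; apply: ler_sum => m2 _.
  by rewrite lerDr c1ge.
Qed.

End BlockCode.

(* eps0: rate loss, eps: error probability *)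
Definition reliable_code (R : realType) (n t r1 r2 : nat) (G : 'M[R[i]]_(r1, t))
    (K : 'M[R[i]]_(r2, t)) (Pw I1 I2 eps0 eps : R) : Prop :=
  exists (M1 M2 : nat) (enc : 'I_M1 -> 'I_M2 -> 'I_n -> 'cV[R[i]]_t)
    (dec1 : ('I_n -> 'cV[R[i]]_r1) -> 'I_M1) (dec2 : ('I_n -> 'cV[R[i]]_r2) -> 'I_M2),
  [/\ (0 < M1)%N /\ (0 < M2)%N,
      n%:R * (I1 - eps0) <= ln (M1%:R : R) /\ n%:R * (I2 - eps0) <= ln (M2%:R : R),
      power_ok enc Pw,
      dec_measurable G [set x | exists m1 m2, x = enc m1 m2] dec1 /\
      dec_measurable K [set x | exists m1 m2, x = enc m1 m2] dec2 &
      forall P1 P2, iid_cgauss P1 -> iid_cgauss P2 ->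
        (err_prob G enc dec1 (fun m1 _ => m1) P1 <= eps%:E)%E /\
        (err_prob K enc dec2 (fun _ m2 => m2) P2 <= eps%:E)%E].

Section LatticeRounding.
Variable R : realType.
Local Notation C := R[i].

(** Finitely many reals are rounded at once, so a single box size serves them all. *)
Lemma lattice_round (I : finType) (f : I -> R) (h : R) : 0 < h ->
  exists Bd (s : I -> 'I_(Bd.*2.+1)), forall i, `|f i - lat h (s i)| <= h.
Proof.
move=> h0; pose B := (\sum_i (Num.truncn (`|f i| / h)).+1)%N.
have fB i : `|f i / h| <= B%:R.
  rewrite normrM normfV (gtr0_norm h0).
  have /andP[_ /ltW h1] := truncn_itv (divr_ge0 (normr_ge0 (f i)) (ltW h0)).
  by apply: le_trans h1 _; rewrite ler_nat /B (bigD1 i) //= leq_addr.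
exists B, (fun i => inord (Num.truncn (f i / h + B%:R))) => i.
have := fB i; rewrite ler_norml => /andP[lo hi].
have y0 : 0 <= f i / h + B%:R by rewrite -lerBlDr sub0r.
have /andP[t1 t2] := truncn_itv y0.
rewrite /lat inordK; last first.
  by rewrite ltnS -(ler_nat R); apply: le_trans t1 _; rewrite -addnn natrD lerD2r.
have -> : f i - h * ((Num.truncn (f i / h + B%:R))%:R - B%:R) =
    h * (f i / h + B%:R - (Num.truncn (f i / h + B%:R))%:R).
  by field; rewrite gt_eqF.
rewrite normrM (gtr0_norm h0) ger_pMr // ger0_norm ?subr_ge0 //.
by rewrite lerBlDl; apply: le_trans (ltW t2) _; rewrite -natr1 ?[1 + _]addrC.
Qed.

Variables (n t : nat) (h : R).

(** Adding indices adds lattice points exactly once the box sizes are added too, since each index is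
    measured from its own centre. *)
Definition ladd N B (g : lword n t N) (s : lword n t B) : lword n t (N + B) :=
  [ffun p => inord (g p + s p)].

Lemma val_ladd N B (g : lword n t N) (s : lword n t B) p : ladd g s p = (g p + s p)%N :> nat.
Proof.
by rewrite ffunE inordK // doubleD ltnS leq_add // -ltnS ltn_ord.
Qed.

Lemma ladd_inj N B (s : lword n t B) : injective (fun g : lword n t N => ladd g s).
Proof.
move=> g g' /= /ffunP E; apply/ffunP => p; apply/val_inj/eqP => /=.
by have := congr1 val (E p); rewrite /= !val_ladd => /eqP; rewrite eqn_add2r.
Qed.

Lemma cseq_ladd N B (g : lword n t N) (s : lword n t B) i :
  cseq h (ladd g s) i = cseq h g i + cseq h s i.
Proof.
apply/matrixP => j k; rewrite !mxE /lat !val_ladd !natrD.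
by apply/eqP; rewrite eq_complex /= -!mulrDr; apply/andP; split; apply/eqP; congr (_ * _);
   rewrite opprD addrACA.
Qed.

End LatticeRounding.

Section TestMeasurability.
Context d (T : measurableType d) (R : realType).
Local Notation C := R[i].

Definition cmeasurable (f : T -> C) :=
  measurable_fun setT (fun z => complex.Re (f z)) /\
  measurable_fun setT (fun z => complex.Im (f z)).

Lemma cmeasurable_cst c : cmeasurable (fun=> c).
Proof. by split; exact: measurable_cst. Qed.

Lemma cmeasurableD f g : cmeasurable f -> cmeasurable g -> cmeasurable (fun z => f z + g z).
Proof.
move=> [f1 f2] [g1 g2]; split.
  suff -> : (fun z => complex.Re (f z + g z)) =
    (fun z => complex.Re (f z) + complex.Re (g z)) by exact: measurable_funD.
  by apply/funext => z; case: (f z) (g z) => [? ?] [? ?].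
suff -> : (fun z => complex.Im (f z + g z)) =
  (fun z => complex.Im (f z) + complex.Im (g z)) by exact: measurable_funD.
by apply/funext => z; case: (f z) (g z) => [? ?] [? ?].
Qed.

Lemma cmeasurableM f g : cmeasurable f -> cmeasurable g -> cmeasurable (fun z => f z * g z).
Proof.
move=> [f1 f2] [g1 g2]; split.
  suff -> : (fun z => complex.Re (f z * g z)) =
    (fun z => complex.Re (f z) * complex.Re (g z) - complex.Im (f z) * complex.Im (g z)).
    by apply: measurable_funB; exact: measurable_funM.
  by apply/funext => z; case: (f z) (g z) => [? ?] [? ?].
suff -> : (fun z => complex.Im (f z * g z)) =
  (fun z => complex.Re (f z) * complex.Im (g z) + complex.Im (f z) * complex.Re (g z)).
  by apply: measurable_funD; exact: measurable_funM.
by apply/funext => z; case: (f z) (g z) => [? ?] [? ?].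
Qed.

Lemma cmeasurable_sum (I : Type) (s : seq I) (f : I -> T -> C) :
  (forall i, cmeasurable (f i)) -> cmeasurable (fun z => \sum_(i <- s) f i z).
Proof.
move=> mf; elim: s => [|i s IH].
  under [X in cmeasurable X]funext do rewrite big_nil; exact: cmeasurable_cst.
by under [X in cmeasurable X]funext do rewrite big_cons; exact: cmeasurableD.
Qed.

Lemma measurable_normsq f : cmeasurable f -> measurable_fun setT (fun z => normsq (f z)).
Proof.
by move=> [f1 f2]; apply: measurable_funD; exact: measurable_funX.
Qed.

End TestMeasurability.

Section EllipsoidTest.
Variables (R : realType) (n t r : nat).
Local Notation C := R[i].
Local Notation tup := ((n * r * 2).-tuple R).
Variables (e : 'I_t -> R) (W : 'M[C]_(t, r)) (s : R).

Definition etest (v : 'I_n -> 'cV[C]_t) (y : 'I_n -> 'cV[C]_r) : bool :=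
  \sum_i \sum_j normsq (v i j 0 - (W *m y i) j 0) / e j <= s.

Lemma cmeasurable_noise i j : cmeasurable (fun z : tup => noise_seq z i j 0).
Proof.
split.
  have -> : (fun z : tup => complex.Re (noise_seq z i j 0)) =
    (fun z => tnth z (mxvec_index (mxvec_index i j) ord0)).
    by apply/funext => z; rewrite mxE.
  exact: measurable_tnth.
have -> : (fun z : tup => complex.Im (noise_seq z i j 0)) =
  (fun z => tnth z (mxvec_index (mxvec_index i j) ord_max)).
  by apply/funext => z; rewrite mxE.
exact: measurable_tnth.
Qed.

Lemma measurable_etest v (H : 'M[C]_(r, t)) x :
  measurable [set z : tup | etest v (out_seq H x z)].
Proof.
have mF : measurable_fun setT (fun z : tup => \sum_i \sum_j
    normsq (v i j 0 - (W *m out_seq H x z i) j 0) / e j).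
  apply: measurable_sum => i; apply: measurable_sum => j.
  apply: measurable_funM; last exact: measurable_cst.
  apply: measurable_normsq.
  have -> : (fun z : tup => v i j 0 - (W *m out_seq H x z i) j 0) =
      (fun z => v i j 0 + \sum_k (- W j k) * ((H *m x i) k 0 + noise_seq z i k 0)).
    apply/funext => z; rewrite [in LHS]mxE; congr (_ + _).
    by rewrite -sumrN; apply: eq_bigr => k _; rewrite [in LHS]mxE mulNr.
  apply: cmeasurableD; first exact: cmeasurable_cst.
  apply: cmeasurable_sum => k; apply: cmeasurableM; first exact: cmeasurable_cst.
  apply: cmeasurableD; first exact: cmeasurable_cst.
  exact: cmeasurable_noise.
have := measurable_fun_ler mF (measurable_cst s).
move=> /(_ measurableT [set true] I); rewrite setTI.
by congr measurable.
Qed.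

Lemma gram_sum_le m (dl : R) (x : 'I_n -> 'cV[C]_m) : gram dl x -> dl <= 2^-1 ->
  forall j b, \sum_i prt b (x i j 0) ^+ 2 <= n%:R.
Proof.
move=> g dl2 j b; have := g j j b b; rewrite !eqxx /= mul1r sumrB sumr_const card_ord.
rewrite -[X in _ - X]mulr_natl ler_norml => /andP[_ h1].
under eq_bigr do rewrite expr2.
have : n%:R * dl <= n%:R * 2^-1 :> R by rewrite ler_wpM2l.
lra.
Qed.

Definition noise_cst (m : nat) : R :=
  (r * 2)%:R ^+ 2 * (gmoment R 4 + 1) + (m * 2 * (r * 2))%:R.

(** Passing is implied by a Gram condition on signal and noise jointly; the signal part holds by
    choice, so only the noise and its correlation with the signal can fail. *)
Lemma noise_test m (dl : R) (P : probability tup R) (x : 'I_n -> 'cV[C]_m) (b : tup -> bool) :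
  iid_cgauss P -> 0 < dl -> dl <= 2^-1 -> (0 < n)%N -> gram dl x ->
  measurable [set z | b z] ->
  (forall z, gram dl (fun i => col_mx (x i) (noise_seq z i)) -> b z) ->
  (P [set z | ~~ b z] <= (noise_cst m / (n%:R * dl ^+ 2))%:E)%E.
Proof.
move=> iP dl0 dl2 n0 gx mb hb.
have [mg pg] := gram_noise_bad iP dl0 n0.
have [mc pc] := cross_noise_bad iP dl0 n0 (gram_sum_le gx dl2).
have : (P ([set z | ~ gram dl (noise_seq z)] `|` [set z | ~ cross dl x (noise_seq z)]) <=
    (noise_cst m / (n%:R * dl ^+ 2))%:E)%E.
  apply: le_trans (measureU2 _ mg mc) _; apply: le_trans (leeD pg pc) _.
  by rewrite -EFinD lee_fin /noise_cst [leRHS]mulrDl mulrA.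
apply: le_trans; apply: le_measure; rewrite ?inE.
- exact: measurable_negb.
- exact: measurableU mg mc.
- move=> z /= /negP nb; apply: contrapT => /not_orP[/contrapT g /contrapT c].
  by apply: nb; apply: hb; exact: gram_col.
Qed.

End EllipsoidTest.

Section CodingArithmetic.
Variable R : realType.

(** Compares the words passing a test with the lower bound on typical words. The powers of Z and the
    factor exp(n t) cancel, leaving the product of the error variances to the power n. *)
Lemma count_ratio n t (p d Z tau dl : R) : 0 <= p -> 0 <= d -> 0 <= Z ->
  expR (n%:R * (t%:R + tau)) * (p * ((1 + d) * Z) ^+ (t * 2)) ^+ n <=
  2 * expR (n%:R * (tau + 2 * t%:R * dl + 2 * t%:R * d)) * p ^+ n *
    (Z ^+ (n * (t * 2)) / 2 * expR (n%:R * (t%:R * (1 - 2 * dl)))).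
Proof.
move=> p0 d0 Z0.
have h1 : ((1 + d) ^+ (t * 2)) ^+ n <= expR (n%:R * (2 * t%:R * d)).
  rewrite -exprM.
  apply: le_trans (lerXn2r _ _ _ (expR_ge1Dx d)) _; rewrite ?nnegrE ?expR_ge0 ?addr_ge0 //.
  rewrite -expRM_natr -mulr_natr mulnC !natrM.
  by rewrite ler_expR le_eqVlt; apply/orP; left; apply/eqP; ring.
have -> : 2 * expR (n%:R * (tau + 2 * t%:R * dl + 2 * t%:R * d)) * p ^+ n *
    (Z ^+ (n * (t * 2)) / 2 * expR (n%:R * (t%:R * (1 - 2 * dl)))) =
    expR (n%:R * (t%:R + tau)) * (p ^+ n * (expR (n%:R * (2 * t%:R * d)) *
      (Z ^+ (t * 2)) ^+ n)).
  have -> : expR (n%:R * (tau + 2 * t%:R * dl + 2 * t%:R * d)) =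
      expR (n%:R * (t%:R + tau)) * expR (n%:R * (2 * t%:R * d)) /
      expR (n%:R * (t%:R * (1 - 2 * dl))).
    by rewrite -expRN -!expRD; congr expR; ring.
  rewrite -exprM (mulnC _ n); field.
  by rewrite gt_eqF // expR_gt0.
rewrite ler_wpM2l ?expR_ge0 // exprMn ler_wpM2l ?exprn_ge0 //.
by rewrite exprMn exprMn ler_wpM2r // !exprn_ge0.
Qed.

Lemma messages_count n (M : R) (I eps ka p : R) : M <= expR (n%:R * (I - eps)) ->
  p = expR (- I) ->
  M * (2 * expR (n%:R * ka) * p ^+ n) <= 2 * expR (- (n%:R * (eps - ka))).
Proof.
move=> hM ->; have -> : 2 * expR (- (n%:R * (eps - ka))) =
    expR (n%:R * (I - eps)) * (2 * expR (n%:R * ka) * expR (- I) ^+ n).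
  rewrite -expRM_natr mulrCA -mulrA -!expRD; congr (_ * expR _); ring.
by rewrite ler_wpM2r // !mulr_ge0 ?exprn_ge0 ?expR_ge0.
Qed.

Lemma miss_le n L (rho : R) : 0 <= rho -> rho <= 1 -> n%:R <= L%:R * rho ->
  (1 - rho) ^+ L <= expR (- n%:R).
Proof.
move=> r0 r1 hL; apply: (@le_trans _ _ (expR (- rho) ^+ L)).
  by rewrite lerXn2r ?nnegrE ?expR_ge0 ?subr_ge0 // expR_ge1Dx.
by rewrite -expRM_natl ler_expR mulrN lerN2.
Qed.

Lemma expRN_le_inv (x : R) : 0 < x -> expR (- x) <= x^-1.
Proof.
move=> x0; rewrite expRN lef_pV2 ?posrE ?expR_gt0 //.
by apply: le_trans (expR_ge1Dx x); rewrite lerDr.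
Qed.

Lemma expRN_le_invsq (x : R) : 0 < x -> expR (- x) <= 4 / x ^+ 2.
Proof.
move=> x0; have x2 : 0 < x / 2 by rewrite divr_gt0.
have -> : expR (- x) = expR (- (x / 2)) ^+ 2 by rewrite -expRM_natr; congr expR; field.
have -> : 4 / x ^+ 2 = ((x / 2)^-1) ^+ 2 by field; rewrite gt_eqF.
apply: lerXn2r (expRN_le_inv x2); by rewrite nnegrE ?expR_ge0 // invr_ge0 ltW.
Qed.

(** The last term carries a factor n + 1 from the bins, so its exponential is bounded by an inverse
    square instead of an inverse. *)
Lemma error_vanishes n (nu c : R) : (0 < n)%N -> 0 < c ->
  nu / n%:R + (2 * expR (- n%:R) + 2 * expR (- (n%:R * c)) +
    n.+1%:R * (2 * expR (- (n%:R * c)))) <= (nu + 2 + 2 / c + 16 / c ^+ 2) / n%:R.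
Proof.
move=> n0 c0; have n0' : 0 < n%:R :> R by rewrite ltr0n.
have nc : 0 < n%:R * c by rewrite mulr_gt0.
have h1 := expRN_le_inv n0'; have h2 := expRN_le_inv nc; have h3 := expRN_le_invsq nc.
have -> : (nu + 2 + 2 / c + 16 / c ^+ 2) / n%:R =
    nu / n%:R + (2 * n%:R^-1 + 2 / c / n%:R + 16 / c ^+ 2 / n%:R) by ring.
rewrite lerD2l; apply: lerD; first apply: lerD; first by rewrite ler_pM2l.
  by rewrite -mulrA -invfM [c * _]mulrC ler_pM2l.
have n1 : n.+1%:R <= 2 * n%:R :> R by rewrite -natrM ler_nat mul2n -addnn -addn1 leq_add2l.
apply: (@le_trans _ _ ((2 * n%:R) * (2 * (4 / (n%:R * c) ^+ 2)))).
  by apply: ler_pM; rewrite ?ler0n ?mulr_ge0 ?expR_ge0 // ler_pM2l.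
by rewrite le_eqVlt; apply/orP; left; apply/eqP; field; rewrite !gt_eqF.
Qed.

End CodingArithmetic.

(** * Dirty-paper coding *)

Lemma avg_count (R : realFieldType) (T : finType) (b : pred T) :
  avg (fun a => (b a)%:R) = #|b|%:R / #|T|%:R :> R.
Proof.
rewrite /avg mulrC -natr_sum; congr (_%:R / _).
rewrite -sum1_card [RHS]big_mkcond /=; by apply: eq_bigr => a _; rewrite unfold_in; case: (b a).
Qed.

Lemma mxBE (V : zmodType) m n (A B : 'M[V]_(m, n)) i j : (A - B) i j = A i j - B i j.
Proof. by rewrite !mxE. Qed.

Lemma mxDE (V : nmodType) m n (A B : 'M[V]_(m, n)) i j : (A + B) i j = A i j + B i j.
Proof. by rewrite !mxE. Qed.

Section DirtyPaperMatrices.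
Variables (R : realType) (t r1 r2 : nat).
Local Notation C := R[i].
Variables (G : 'M[C]_(r1, t)) (K : 'M[C]_(r2, t)) (Lp Lc : 'M[C]_t).
Variables (W1 : 'M[C]_(t, r1)) (W2 : 'M[C]_(t, r2)).

(** The estimation errors as linear maps of the joint vector (a, g, noise), the form that
    [gram_quad] handles. *)
Definition est1 : 'M[C]_(t, t + t + r1) :=
  row_mx (row_mx (1%:M - W1 *m G *m Lp) (- (W1 *m G *m Lc))) (- W1).
Definition est2 : 'M[C]_(t, t + t + r2) :=
  row_mx (row_mx 0 (1%:M - W2 *m K *m Lc)) (- W2).

Lemma est1E (a g : 'cV[C]_t) (z : 'cV[C]_r1) : a - W1 *m (G *m (Lp *m a + Lc *m g) + z) =
  est1 *m col_mx (col_mx a g) z.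
Proof.
rewrite /est1 !mul_row_col !mulmxDr mulmxBl !mulNmx mul1mx !mulmxA !opprD.
move: (W1 *m G *m Lp *m a) (W1 *m G *m Lc *m g) (W1 *m z) => x y w.
apply/matrixP => i j; rewrite !mxE; ring.
Qed.

(* The interference W2 K Lp a, known to the encoder, is cancelled by the shift s. *)
Lemma est2E (a g s : 'cV[C]_t) (z : 'cV[C]_r2) : g + s - W2 *m (K *m (Lp *m a + Lc *m g) + z) =
  est2 *m col_mx (col_mx a g) z + (s - W2 *m K *m Lp *m a).
Proof.
rewrite /est2 !mul_row_col !mulmxDr mulmxBl mul0mx add0r !mulNmx mul1mx !mulmxA !opprD.
move: (W2 *m K *m Lp *m a) (W2 *m K *m Lc *m g) (W2 *m z) => x y w.
apply/matrixP => i j; rewrite !mxE; ring.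
Qed.

End DirtyPaperMatrices.

Section DirtyPaperBlock.
Variables (R : realType) (n t r1 r2 : nat).
Local Notation C := R[i].
Variables (G : 'M[C]_(r1, t)) (K : 'M[C]_(r2, t)) (Lp Lc : 'M[C]_t).
Variables (W1 : 'M[C]_(t, r1)) (W2 : 'M[C]_(t, r2)) (e1 e2 : 'I_t -> R).
Variables (h dl tau d sg V Pw : R) (N : nat).
Local Notation M := (fmoment (@gw R h N) (@lat R h N)).
Local Notation Z := (theta h N).
Local Notation J := ('I_n * ('I_t * bool))%type.
Local Notation cs := (cseq h).
Hypotheses (n0 : (0 < n)%N) (h0 : 0 < h) (dl0 : 0 < dl) (dl2 : dl <= 2^-1) (d0 : 0 <= d).
Hypotheses (sg0 : 0 < sg) (e1p : forall j, 0 < e1 j) (e2p : forall j, 0 < e2 j).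
Hypotheses (hM2 : `|M 2%N - 2^-1| <= dl / 2) (V4 : M 4%N <= V) (V2 : M 2%N ^+ 2 <= V).
Hypothesis hth1 : forall N' j x,
  \sum_k expR (- (@lat R h N' k - x) ^+ 2 / e1 j) <= Num.sqrt (e1 j) * (1 + d) * Z.
Hypothesis hth2 : forall N' j x,
  \sum_k expR (- (@lat R h N' k - x) ^+ 2 / e2 j) <= Num.sqrt (e2 j) * (1 + d) * Z.
Hypothesis hng : (t * 2)%:R ^+ 2 * (4 * V / (n%:R * dl ^+ 2)) <= 4^-1.
Hypothesis hnc : (t * 2 * (t * 2))%:R * (n%:R * dl ^+ 2)^-1 <= 4^-1.
Hypothesis hpow : wfro (fun=> 1) (row_mx Lp Lc) + dl * wcst (fun=> 1) (row_mx Lp Lc) <= Pw.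
Hypothesis htest1 : wfro (fun j => (e1 j)^-1) (est1 G Lp Lc W1) +
  dl * wcst (fun j => (e1 j)^-1) (est1 G Lp Lc W1) <= t%:R + tau.
Hypothesis htest2 : (1 + sg) * (wfro (fun j => (e2 j)^-1) (est2 K Lc W2) +
  dl * wcst (fun j => (e2 j)^-1) (est2 K Lc W2)) +
  (1 + sg^-1) * \sum_j (2 * h ^+ 2) / e2 j <= t%:R + tau.

Let n0' : 0 < n%:R :> R. Proof. by rewrite ltr0n. Qed.
Let Z0 : 0 < Z. Proof. exact: theta_gt0. Qed.
Let w0 (a : lword n t N) : 0 <= weight (@gw R h N) a.
Proof. by rewrite ltW // weight_gt0 // => k; exact: gw_gt0. Qed.

Let S (a : lword n t N) : bool := `[< gram dl (cs a) >].
Let typ (a g : lword n t N) : bool := S g && `[< cross dl (cs a) (cs g) >].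
(** Lower bound from [count_typical], common to the typical a and to the g jointly typical with a
    given a. *)
Let Y : R := Z ^+ #|{: J}| / 2 * expR (n%:R * (t%:R * (1 - 2 * dl))).

(** Quarters, because for jointly typical words two exceptional sets must together stay within the
    half allowed by [count_typical]. *)
Let notS : \sum_(a | ~~ S a) weight (@gw R h N) a <= Z ^+ #|{: J}| / 4.
Proof.
apply: le_trans (weight_not_gram t dl0 n0 hM2 V4 V2) _.
by rewrite ler_wpM2l // exprn_ge0 // ltW.
Qed.

Let notC a : S a -> \sum_(g : lword n t N | ~~ `[< cross dl (cs a) (cs g) >]) weight (@gw R h N) g <=
  Z ^+ #|{: J}| / 4.
Proof.
move=> /asboolP ga.
have M1 : M 2%N <= 1.
  move: hM2; rewrite ler_norml => /andP[_]; move: dl2; lra.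
apply: le_trans (weight_not_cross t dl0 n0 M1 (gram_sum_le ga dl2)) _.
by rewrite ler_wpM2l // exprn_ge0 // ltW.
Qed.

Let count_S : Y <= #|S|%:R.
Proof.
apply: count_typical => [|a /asboolP//].
apply: le_trans notS _; rewrite ler_wpM2l ?exprn_ge0 ?(ltW Z0) //.
by rewrite lef_pV2 ?posrE // ler_nat.
Qed.

Let count_typ a : S a -> Y <= #|typ a|%:R.
Proof.
move=> Sa; apply: count_typical => [|g /andP[/asboolP]//].
have -> : Z ^+ #|{: J}| / 2 = Z ^+ #|{: J}| / 4 + Z ^+ #|{: J}| / 4 by field.
apply: le_trans (lerD notS (notC Sa)).
rewrite big_mkcond /= [X in _ <= X + _]big_mkcond [X in _ <= _ + X]big_mkcond -big_split /=.
apply: ler_sum => g _; rewrite /typ negb_and; case: (~~ S g); case: (~~ _) => /=;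
  by rewrite ?addr0 ?add0r ?lerDl.
Qed.

Let Y0 : 0 < Y.
Proof. by rewrite !mulr_gt0 ?expR_gt0 ?exprn_gt0 ?invr_gt0. Qed.

(** Total loss in the exponent: test threshold, Gram tolerance and theta comparison. *)
Let ka := tau + 2 * t%:R * dl + 2 * t%:R * d.
Let q (e : 'I_t -> R) : R := 2 * expR (n%:R * ka) * (\prod_j e j) ^+ n.

Let count_etest r N' (e : 'I_t -> R) (W : 'M[C]_(t, r)) y : (forall j, 0 < e j) ->
  (forall j x, \sum_k expR (- (@lat R h N' k - x) ^+ 2 / e j) <= Num.sqrt (e j) * (1 + d) * Z) ->
  #|[pred v : lword n t N' | etest e W (n%:R * (t%:R + tau)) (cs v) y]|%:R <= q e * Y.
Proof.
move=> ep hth.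
apply: le_trans (count_test (n%:R * (t%:R + tau)) (fun i => W *m y i) ep hth) _.
rewrite /q /Y card_J; apply: count_ratio => //; last exact: ltW.
by apply: prodr_ge0 => j _; exact: ltW.
Qed.

Variables (eps0 eps : R).
Let I1 := - \sum_j ln (e1 j).
Let I2 := - \sum_j ln (e2 j).
Let nu : R := Num.max (noise_cst R r1 (t + t)) (noise_cst R r2 (t + t)) / dl ^+ 2.
Hypothesis heps : nu / n%:R + (2 * expR (- n%:R) + 2 * expR (- (n%:R * (eps0 - ka))) +
    n.+1%:R * (2 * expR (- (n%:R * (eps0 - ka))))) <= eps.

Let prodE (e : 'I_t -> R) : (forall j, 0 < e j) -> \prod_j e j = expR (- - \sum_(j < t) ln (e j)).
Proof.
by move=> ep; rewrite opprK expR_sum; apply: eq_bigr => j _; rewrite lnK ?posrE.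
Qed.

Lemma dirty_paper_block : reliable_code n G K Pw I1 I2 eps0 eps.
Proof.
(* The scaled interference is rounded for all words a simultaneously, so one alphabet U contains
   every shifted word. *)
have [B [s0 hs0]] := @lattice_round R (lword n t N * J)%type
  (fun ap => prt ap.2.2.2 ((W2 *m K *m Lp *m cs ap.1 ap.2.1) ap.2.2.1 0)) h h0.
pose sft (a : lword n t N) : lword n t B := [ffun p => s0 (a, p)].
have hsft a i j : normsq ((cs (sft a) i - W2 *m K *m Lp *m cs a i) j 0) <= 2 * h ^+ 2.
  have hb b : prt b ((cs (sft a) i - W2 *m K *m Lp *m cs a i) j 0) ^+ 2 <= h ^+ 2.
    have -> : prt b ((cs (sft a) i - W2 *m K *m Lp *m cs a i) j 0) =
        - (prt b ((W2 *m K *m Lp *m cs a i) j 0) - lat h (s0 (a, (i, (j, b))))).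
      rewrite opprB -[s0 _](ffunE (fun p => s0 (a, p))) -prt_cseq.
      rewrite mxBE; move: (cs _ i j 0) ((_ *m _) j 0) => [x x'] [y y'].
      by case: b.
    have := hs0 (a, (i, (j, b))) => /= hb.
    rewrite sqrrN -[leLHS]real_normK ?num_real //; apply: lerXn2r hb => //; exact: ltW.
  rewrite normsq_prt big_bool mulr_natl mulr2n; exact: lerD (hb true) (hb false).
pose A := {a : lword n t N | S a}.
pose U := lword n t (N + B).
have cA : #|{: A}| = #|S| by rewrite card_sig.
have A0 : (0 < #|{: A}|)%N by rewrite -(ltr0n R) cA; exact: lt_le_trans Y0 count_S.
pose good (a : A) (u : U) := [exists g, (u == ladd g (sft (val a))) && typ (val a) g].
pose word (a : A) (u : U) i := Lp *m cs (val a) i + Lc *m (cs u i - cs (sft (val a)) i).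
pose T1 (a : A) := etest e1 W1 (n%:R * (t%:R + tau)) (cs (val a)).
pose T2 (u : U) := etest e2 W2 (n%:R * (t%:R + tau)) (cs u).
have wordE a g i : word a (ladd g (sft (val a))) i = Lp *m cs (val a) i + Lc *m cs g i.
  by rewrite /word cseq_ladd addrK.
have q0 (e : 'I_t -> R) : (forall j, 0 < e j) -> 0 <= q e.
  move=> ep; rewrite !mulr_ge0 ?expR_ge0 ?exprn_ge0 //.
  by apply: prodr_ge0 => j _; exact: ltW.
have hk1 y : avg (fun a => (T1 a y)%:R) <= q e1.
  rewrite avg_count ler_pdivrMr ?ltr0n //.
  apply: (@le_trans _ _ (q e1 * Y)); last by rewrite cA ler_wpM2l // q0.
  apply: le_trans (count_etest W1 y e1p (hth1 N)); rewrite ler_nat.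
  rewrite -(fintype.card_image val_inj); apply/subset_leq_card/fintype.subsetP => v /fintype.imageP[a Ta ->].
  exact: Ta.
have goodY a : Y <= #|good a|%:R.
  apply: le_trans (count_typ (valP a)) _; rewrite ler_nat.
  rewrite -(fintype.card_image (@ladd_inj n t N B (sft (val a)))).
  apply/subset_leq_card/fintype.subsetP => u /fintype.imageP[g Tg ->]; apply/existsP; exists g.
  by rewrite eqxx.
have [a0 _] := card_gt0P A0.
have U0 : (0 < #|{: U}|)%N.
  rewrite -(ltr0n R); apply: lt_le_trans Y0 (le_trans (goodY a0) _).
  by rewrite ler_nat max_card.
have U0' : 0 < #|{: U}|%:R :> R by rewrite ltr0n.
(* Lower bound for the chance that a uniform u is compatible with a given a. The same factor appears
   in the acceptance rate of user 2's test, and bins of about n / rho words cancel it. *)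
pose rho := Y / #|{: U}|%:R.
have rho0 : 0 < rho by rewrite divr_gt0.
have rho1 : rho <= 1.
  by rewrite ler_pdivrMr // mul1r; apply: le_trans (goodY a0) _; rewrite ler_nat max_card.
have hk2 y : avg (fun u => (T2 u y)%:R) <= q e2 * rho.
  rewrite avg_count mulrA ler_wpM2r ?invr_ge0 ?(ltW U0') //.
  exact: (count_etest W2 y e2p (hth2 (N + B))).
have hgood a : rho <= avg (fun u => (good a u)%:R).
  by rewrite avg_count ler_wpM2r ?invr_ge0 ?(ltW U0').
have gramxi a u : good a u -> exists g, [/\ u = ladd g (sft (val a)),
    gram dl (cs g) & gram dl (fun i => col_mx (cs (val a) i) (cs g i))].
  move=> /existsP[g /andP[/eqP -> /andP[/asboolP gg /asboolP cg]]]; exists g; split=> //.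
  by apply: gram_col => //; apply/asboolP; exact: (valP a).
have nu0 : 0 <= nu / n%:R.
  rewrite !divr_ge0 ?exprn_ge0 ?(ltW dl0) // le_max /noise_cst.
  by rewrite !addr_ge0 // mulr_ge0 ?exprn_ge0 // addr_ge0 //; exact: gmoment4_ge0.
have nuE r : noise_cst R r (t + t) <= Num.max (noise_cst R r1 (t + t)) (noise_cst R r2 (t + t)) ->
    ((noise_cst R r (t + t) / (n%:R * dl ^+ 2))%:E <= (nu / n%:R)%:E)%E.
  move=> hr; rewrite lee_fin /nu -mulrA -invfM [dl ^+ 2 * _]mulrC.
  by rewrite ler_wpM2r // invr_ge0 mulr_ge0 ?exprn_ge0 ?(ltW n0') ?(ltW dl0).
have hn1 P : iid_cgauss P -> forall a u, good a u ->
    (P [set z | ~~ T1 a (out_seq G (word a u) z)] <= (nu / n%:R)%:E)%E.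
  move=> iP a u /gramxi[g [-> gg gx]].
  apply: le_trans (nuE r1 _); last by rewrite le_max lexx.
  apply: (noise_test iP dl0 dl2 n0 gx); first exact: measurable_etest.
  move=> z gz; rewrite /T1 /etest; apply: le_trans (ler_wpM2l (ltW n0') htest1).
  have e1i j : 0 <= (e1 j)^-1 by rewrite invr_ge0 ltW.
  apply: le_trans (gram_quad (est1 G Lp Lc W1) e1i gz).
  apply: ler_sum => i _; apply: ler_sum => j _; rewrite mulrC -est1E /out_seq wordE.
  by rewrite mxBE.
have hn2 P : iid_cgauss P -> forall a u, good a u ->
    (P [set z | ~~ T2 u (out_seq K (word a u) z)] <= (nu / n%:R)%:E)%E.
  move=> iP a u /gramxi[g [-> gg gx]].
  apply: le_trans (nuE r2 _); last by rewrite le_max lexx orbT.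
  apply: (noise_test iP dl0 dl2 n0 gx); first exact: measurable_etest.
  move=> z gz; rewrite /T2 /etest; apply: le_trans (ler_wpM2l (ltW n0') htest2).
  have e2i j : 0 <= (e2 j)^-1 by rewrite invr_ge0 ltW.
  have gq := gram_quad (est2 K Lc W2) e2i gz.
  have sg1 : 0 <= 1 + sg by rewrite addr_ge0 // ltW.
  rewrite mulrDr [n%:R * (_ * _)]mulrCA [n%:R * (_ * _)]mulrCA.
  apply: le_trans (lerD (ler_wpM2l sg1 gq) (lexx _)).
  rewrite (natmul_sum n) !mulr_sumr -big_split /=; apply: ler_sum => i _.
  rewrite !mulr_sumr -big_split /=; apply: ler_sum => j _.
  have -> : cs (ladd g (sft (val a))) i j 0 -
      (W2 *m out_seq K (word a (ladd g (sft (val a)))) z i) j 0 =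
      (est2 K Lc W2 *m col_mx (col_mx (cs (val a) i) (cs g i)) (noise_seq z i)) j 0 +
      (cs (sft (val a)) i - W2 *m K *m Lp *m cs (val a) i) j 0.
    rewrite /out_seq wordE cseq_ladd.
    by rewrite -[LHS]mxBE -[RHS]mxDE est2E.
  have := hsft (val a) i j.
  move: ((est2 K Lc W2 *m _) j 0) ((cs (sft (val a)) i - W2 *m K *m Lp *m cs (val a) i) j 0) => x y hy.
  have sg2 : 0 <= 1 + sg^-1 by rewrite addr_ge0 // invr_ge0 ltW.
  have -> : (1 + sg) * ((e2 j)^-1 * normsq x) + (1 + sg^-1) * (2 * h ^+ 2 / e2 j) =
    ((1 + sg) * normsq x + (1 + sg^-1) * (2 * h ^+ 2)) / e2 j by ring.
  have hx := normsqD_le x y sg0.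
  rewrite ler_wpM2r //; apply: le_trans hx _; by rewrite lerD2l ler_wpM2l.
have hp a u : good a u -> \sum_i \sum_j normsq (word a u i j 0) <= n%:R * Pw.
  move=> /gramxi[g [-> gg gx]]; apply: le_trans (ler_wpM2l (ltW n0') hpow).
  have w1 (j : 'I_t) : 0 <= (fun=> 1 : R) j by exact: ler01.
  apply: le_trans (gram_quad (row_mx Lp Lc) w1 gx).
  apply: ler_sum => i _; apply: ler_sum => j _.
  by rewrite mul1r mul_row_col wordE.
have Pw0 : 0 <= Pw.
  apply: le_trans hpow; rewrite addr_ge0 //.
    by apply: sumr_ge0 => l _; rewrite mul1r; apply: sumr_ge0 => j _; exact: normsq_ge0.
  by rewrite mulr_ge0 ?(ltW dl0) // wcst_ge0.
(* One message more than the integer part is used: m1 + 1 exceeds the exponential, which gives the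
   rate, while the m1 wrong messages stay below it. *)
pose m1 := Num.truncn (expR (n%:R * (I1 - eps0))).
pose m2 := Num.truncn (expR (n%:R * (I2 - eps0))).
(* L rho >= n makes a miss at most exp(- n) likely, and L rho <= n + 1 keeps the union bound over a
   bin cheap. *)
pose L := (Num.truncn (n%:R / rho)).+1.
have /andP[m1l m1u] := truncn_itv (expR_ge0 (n%:R * (I1 - eps0))).
have /andP[m2l m2u] := truncn_itv (expR_ge0 (n%:R * (I2 - eps0))).
have /andP[Ll Lu] := truncn_itv (divr_ge0 (ltW n0') (ltW rho0)).
have Lrho1 : n%:R <= L%:R * rho by rewrite -ler_pdivrMr // ltW.
have Lrho2 : L%:R * rho <= n.+1%:R.
  rewrite -[L%:R]natr1 mulrDl mul1r -[n.+1%:R]natr1; apply: lerD => //.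
  by rewrite -ler_pdivlMr.
have bud : nu / n%:R + (2 * (1 - rho) ^+ L + m1.+1.-1%:R * q e1 +
    (m2.+1.-1 * L)%:R * (q e2 * rho)) <= eps.
  apply: le_trans heps; rewrite lerD2l; apply: lerD; first apply: lerD.
  - by rewrite ler_pM2l //; apply: miss_le => //; exact: ltW.
  - exact: messages_count m1l (prodE e1p).
  - have -> : (m2.+1.-1 * L)%:R * (q e2 * rho) = (L%:R * rho) * (m2%:R * q e2).
      by rewrite natrM /=; ring.
    apply: ler_pM => //; first by rewrite mulr_ge0 // ltW.
      by rewrite mulr_ge0 // q0.
    exact: messages_count m2l (prodE e2p).
have := @block_code R n t r1 r2 G K A U word good T1 T2 (q e1) (q e2 * rho) rho (nu / n%:R) Pw
  A0 U0 nu0 Pw0 (fun a x => measurable_etest _ _ _ _ _ _) (fun a x => measurable_etest _ _ _ _ _ _)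
  hk1 hk2 hgood hn1 hn2 hp m1.+1 m2.+1 L eps (ltn0Sn _) (ltn0Sn _) bud.
move=> [enc [dec1 [dec2 [c1 c2 c3]]]].
exists m1.+1, m2.+1, enc, dec1, dec2; split => //.
have rate x m : expR x < m.+1%:R -> x <= ln (m.+1%:R : R).
  by move=> hx; rewrite -ler_expR lnK ?posrE ?ltr0n // ltW.
by split; apply: rate.
Qed.

End DirtyPaperBlock.

Section DirtyPaperAsymptotics.
Variables (R : realType) (t r1 r2 : nat).
Local Notation C := R[i].

Lemma archi_mul (X c : R) : 0 < c -> exists N0, forall n, (N0 <= n)%N -> X <= c * n%:R.
Proof.
move=> c0; exists (Num.truncn (`|X| / c)).+1 => n hn.
have /andP[_ /ltW h1] := truncn_itv (divr_ge0 (normr_ge0 X) (ltW c0)).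
apply: le_trans (ler_norm X) _; rewrite mulrC -ler_pdivrMr //.
by apply: le_trans h1 _; rewrite ler_nat.
Qed.

Lemma small_mul (x w c : R) : 0 <= x -> 0 <= w -> 0 <= c -> x <= c / (w + 1) -> x * w <= c.
Proof.
move=> x0 w0 c0; rewrite ler_pdivlMr ?ltr_wpDl // => h; apply: le_trans h.
by rewrite ler_wpM2l // lerDl.
Qed.

Variables (G : 'M[C]_(r1, t)) (K : 'M[C]_(r2, t)) (Lp Lc : 'M[C]_t).
Variables (W1 : 'M[C]_(t, r1)) (W2 : 'M[C]_(t, r2)) (e1 e2 : 'I_t -> R) (Pw : R).
Hypotheses (e1p : forall j, 0 < e1 j) (e2p : forall j, 0 < e2 j).
Hypothesis hpow : wfro (fun=> 1) (row_mx Lp Lc) < Pw.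
Hypothesis hw1 : wfro (fun j => (e1 j)^-1) (est1 G Lp Lc W1) <= t%:R.
Hypothesis hw2 : wfro (fun j => (e2 j)^-1) (est2 K Lc W2) <= t%:R.

(** Parameters are fixed in the order tau, dl, sg, then the lattice (h, N), and the block length
    last; the rounding error of user 2 constrains h through sg. *)
Lemma dirty_paper_rates (eps : R) : 0 < eps ->
  exists N0 : nat, forall n : nat, (N0 <= n)%N -> (0 < n)%N ->
  reliable_code n G K Pw (- \sum_j ln (e1 j)) (- \sum_j ln (e2 j)) eps eps.
Proof.
move=> eps0.
pose cP := wcst (fun=> 1) (row_mx Lp Lc).
pose c1 := wcst (fun j => (e1 j)^-1) (est1 G Lp Lc W1).
pose c2 := wcst (fun j => (e2 j)^-1) (est2 K Lc W2).
have cP0 : 0 <= cP by exact: wcst_ge0.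
have c10 : 0 <= c1 by apply: wcst_ge0 => j; rewrite invr_ge0 ltW.
have c20 : 0 <= c2 by apply: wcst_ge0 => j; rewrite invr_ge0 ltW.
have t0 : 0 <= 2 * t%:R :> R by rewrite mulr_ge0.
(* The exponent loss ka amounts to at most 5 tau / 2, which is below eps / 2. *)
pose tau := eps / 8; have tau0 : 0 < tau by rewrite divr_gt0.
have tau4 : 0 < tau / 4 by rewrite divr_gt0.
pose gap := Pw - wfro (fun=> 1) (row_mx Lp Lc).
have gap0 : 0 < gap by rewrite subr_gt0.
have pos (c w : R) : 0 < c -> 0 <= w -> 0 < c / (w + 1).
  by move=> c0 w0; rewrite divr_gt0 // ltr_wpDl.
have [dl dl0 hdl] : exists2 dl : R, 0 < dl & {in [:: 2^-1; gap / (cP + 1); tau / (c1 + 1);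
    1 / (c2 + 1); (tau / 4) / (c2 + 1); tau / (2 * t%:R + 1)], forall x, dl <= x}.
  apply: min_pos => x; rewrite !inE => /or4P[/eqP->|/eqP->|/eqP->|].
  - by rewrite invr_gt0.
  - exact: pos.
  - exact: pos.
  move=> /or3P[] /eqP ->; by apply: pos; rewrite ?divr_gt0 ?mulr_ge0.
have dl2 : dl <= 2^-1 by apply: hdl; rewrite !inE eqxx.
have dlP : dl * cP <= gap.
  by apply: (small_mul (ltW dl0) cP0 (ltW gap0)); apply: hdl; rewrite !inE eqxx ?orbT.
have dl1 : dl * c1 <= tau.
  by apply: (small_mul (ltW dl0) c10 (ltW tau0)); apply: hdl; rewrite !inE eqxx ?orbT.
have dl21 : dl * c2 <= 1.
  by apply: (small_mul (ltW dl0) c20 (ltW ltr01)); apply: hdl; rewrite !inE eqxx ?orbT.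
have dl22 : dl * c2 <= tau / 4.
  by apply: (small_mul (ltW dl0) c20 (ltW tau4)); apply: hdl; rewrite !inE eqxx ?orbT.
have dlt : dl * (2 * t%:R) <= tau.
  by apply: (small_mul (ltW dl0) t0 (ltW tau0)); apply: hdl; rewrite !inE eqxx ?orbT.
(* The t + 1 bounds [wfro] plus the Gram error, as dl c2 <= 1; the factor 1 + sg then costs at most
   tau / 4. *)
pose sg := (tau / 4) / (t%:R + 1).
have sg0 : 0 < sg by apply: pos => //; rewrite divr_gt0.
pose E := (1 + sg^-1) * \sum_j 2 / e2 j.
have E0 : 0 <= E.
  rewrite mulr_ge0 ?addr_ge0 ?invr_ge0 ?(ltW sg0) //.
  by apply: sumr_ge0 => j _; rewrite divr_ge0 // ltW.
have [h0 h0p hh0] : exists2 h0 : R, 0 < h0 & {in [:: 1; (tau / 4) / (E + 1)], forall x, h0 <= x}.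
  apply: min_pos => x; rewrite !inE => /orP[] /eqP -> //.
  by apply: pos => //; rewrite divr_gt0.
have h01 : h0 <= 1 by apply: hh0; rewrite !inE eqxx.
have h0E : h0 * E <= tau / 4.
  by apply: (small_mul (ltW h0p) E0 (ltW tau4)); apply: hh0; rewrite !inE eqxx ?orbT.
have d0 : 0 < dl / 2 by rewrite divr_gt0.
have es0 : {in codom e1 ++ codom e2, forall e, 0 < e}.
  by move=> e; rewrite mem_cat => /orP[] /codomP[j ->].
have [h [N [hp hh hM hth]]] := lattice_exists es0 d0 h0p.
pose V := Num.max (fmoment (@gw R h N) (@lat R h N) 4) (fmoment (@gw R h N) (@lat R h N) 2 ^+ 2).
pose ka := tau + 2 * t%:R * dl + 2 * t%:R * (dl / 2).
have kale : ka <= eps / 2.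
  rewrite /ka; move: dlt; rewrite /tau; lra.
pose c := eps - ka.
have cp : 0 < c by rewrite /c; move: kale eps0; lra.
pose nu := Num.max (noise_cst R r1 (t + t)) (noise_cst R r2 (t + t)) / dl ^+ 2.
have q4 : 0 < 4^-1 :> R by rewrite invr_gt0.
have [N1 hN1] := archi_mul ((t * 2)%:R ^+ 2 * (4 * V / dl ^+ 2)) q4.
have [N2 hN2] := archi_mul ((t * 2 * (t * 2))%:R / dl ^+ 2) q4.
have [N3 hN3] := archi_mul (nu + 2 + 2 / c + 16 / c ^+ 2) eps0.
exists (maxn N1 (maxn N2 N3)) => n; rewrite !geq_max => /and3P[n1 n2 n3] n0.
have n0' : 0 < n%:R :> R by rewrite ltr0n.
apply: (@dirty_paper_block R n t r1 r2 G K Lp Lc W1 W2 e1 e2 h dl tau (dl / 2) sg V Pw N) => //.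
- exact: ltW.
- by rewrite le_max lexx.
- by rewrite le_max lexx orbT.
- by move=> N' j x; apply: hth; rewrite mem_cat codom_f.
- by move=> N' j x; apply: hth; rewrite mem_cat codom_f orbT.
- have -> : (t * 2)%:R ^+ 2 * (4 * V / (n%:R * dl ^+ 2)) =
      (t * 2)%:R ^+ 2 * (4 * V / dl ^+ 2) / n%:R by field; rewrite !gt_eqF.
  by rewrite ler_pdivrMr // hN1.
- have -> : (t * 2 * (t * 2))%:R / (n%:R * dl ^+ 2) =
      (t * 2 * (t * 2))%:R / dl ^+ 2 / n%:R by field; rewrite !gt_eqF.
  by rewrite ler_pdivrMr // hN2.
- by rewrite -lerBrDl.
- exact: lerD.
- have h2 : h ^+ 2 <= h0.
    rewrite expr2; apply: le_trans (ler_wpM2l (ltW hp) (le_trans hh h01)) _.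
    by rewrite mulr1.
  have -> : (1 + sg^-1) * (\sum_j 2 * h ^+ 2 / e2 j) = h ^+ 2 * E.
    rewrite /E [RHS]mulrCA; congr (_ * _); rewrite mulr_sumr; apply: eq_bigr => j _; ring.
  have hE : h ^+ 2 * E <= tau / 4 by apply: le_trans (ler_wpM2r E0 h2) h0E.
  have sgt : sg * (t%:R + 1) = tau / 4 by rewrite /sg mulfVK // gt_eqF // ltr_wpDl.
  have : sg * (wfro (fun j => (e2 j)^-1) (est2 K Lc W2) + dl * c2) <= tau / 4.
    by rewrite -sgt ler_pM2l //; apply: lerD.
  move: hw2 dl22 hE tau0; rewrite -/c2.
  move: (wfro _ _) (dl * c2) (h ^+ 2 * E) => w x y; lra.
- apply: le_trans (error_vanishes nu n0 cp) _.
  by rewrite ler_pdivrMr // hN3.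
Qed.

End DirtyPaperAsymptotics.

(** * Linear MMSE estimation and achievable rates *)

Section LinearEstimation.
Variable R : realType.
Local Notation C := R[i].

Lemma wfroE s m (w : 'I_s -> R) (M : 'M[C]_(s, m)) :
  wfro w M = \sum_l w l * complex.Re ((M *m ctr M) l l).
Proof.
apply: eq_bigr => l _; congr (_ * _); rewrite mxE Re_sum.
by apply: eq_bigr => j _; rewrite ctrE normsqE.
Qed.

(** Each error component is divided by its own variance, so the mean of the test statistic per
    channel use is the dimension; this is the t in the thresholds. *)
Lemma wfro_diag s m (e : 'I_s -> R) (M : 'M[C]_(s, m)) : (forall l, 0 < e l) ->
  M *m ctr M = diag_mx (\row_l cR (e l)) -> wfro (fun l => (e l)^-1) M = s%:R.
Proof.
move=> ep hM; rewrite wfroE hM -[RHS]mulr1 (natmul_sum s); apply: eq_bigr => l _.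
by rewrite !mxE eqxx mulr1n /= mulVf // gt_eqF.
Qed.

Lemma wfro1 s m (M : 'M[C]_(s, m)) : wfro (fun=> 1) M = rtrace (M *m ctr M).
Proof.
by rewrite wfroE /rtrace /mxtrace Re_sum; apply: eq_bigr => l _; rewrite mul1r.
Qed.

Lemma det_1Ddiag n (dd : 'I_n -> R) :
  \det (1%:M + diag_mx (\row_i cR (dd i))) = cR (\prod_i (1 + dd i)).
Proof.
have -> : 1%:M + diag_mx (\row_i cR (dd i)) = diag_mx (\row_i cR (1 + dd i)).
  apply/matrixP => i j; rewrite !mxE; case: (i == j); last by rewrite !mulr0n addr0.
  by rewrite !mulr1n !cRE rmorphD rmorph1.
rewrite det_diag cRE rmorph_prod; apply: eq_bigr => i _; by rewrite mxE cRE.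
Qed.

(* The linear MMSE estimator of a white vector observed through B in noise N; after
   rotating the input by U its error covariance is diagonal. *)
Lemma mmse_estimator t r (B : 'M[C]_(r, t)) (N : 'M[C]_r) : pd N ->
  exists (U : 'M[C]_t) (W : 'M[C]_(t, r)) (e : 'I_t -> R),
  [/\ U *m ctr U = 1%:M, forall j, 0 < e j,
      (1%:M - W *m (B *m U)) *m ctr (1%:M - W *m (B *m U)) + W *m N *m ctr W =
      diag_mx (\row_j cR (e j)) &
      - \sum_j ln (e j) = logdet (N + B *m ctr B) - logdet N].
Proof.
move=> pN; have uN := pd_unit pN; have [hN _] := pN.
have hNi : ctr (invmx N) = invmx N by rewrite ctr_inv hN.
have psB : psd (ctr B *m invmx N *m B).
  have := psd_conj (ctr B) (pd_psd (pd_inv pN)); by rewrite ctrK.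
have [U [dd [U1 U2 d0 SE]]] := psd_spectral psB.
have d1 j : 0 < 1 + dd j by rewrite ltr_wpDr.
pose D := diag_mx (\row_j cR (dd j)).
pose E := diag_mx (\row_j cR (1 + dd j)^-1).
have BNB : ctr (B *m U) *m invmx N *m (B *m U) = D.
  rewrite ctrM -!mulmxA (mulmxA (ctr B)) (mulmxA _ B) SE -/D !mulmxA U2 mul1mx.
  by rewrite -mulmxA U2 mulmx1.
have hE : ctr E = E.
  by apply/matrixP => i j; rewrite ctrE !mxE eq_sym; case: eqP => [->|_];
     rewrite ?mulr1n ?mulr0n ?conj_cR ?rmorph0.
have ED : E + E *m D = 1%:M.
  rewrite /E /D mulmx_diag; apply/matrixP => i j; rewrite !mxE; case: eqP => [->|_];
    last by rewrite !mulr0n addr0.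
  rewrite !mulr1n !cRE -rmorphM -rmorphD /= -[X in X + _]mulr1 -mulrDr mulVf ?gt_eqF //.
have WB : E *m ctr (B *m U) *m invmx N *m (B *m U) = E *m D by rewrite -BNB !mulmxA.
have WNW : E *m ctr (B *m U) *m invmx N *m N *m ctr (E *m ctr (B *m U) *m invmx N) =
    E *m D *m E.
  move: (B *m U) BNB {WB} => X BNB.
  by rewrite mulmxKV // !ctrM ctrK hE hNi -BNB !mulmxA.
exists U, (E *m ctr (B *m U) *m invmx N), (fun j => (1 + dd j)^-1); split=> //.
- by move=> j; rewrite invr_gt0.
- rewrite WB -{1}ED addrK -{1}ED addrK hE.
  rewrite WNW.
  by rewrite -mulmxDl ED mul1mx.
- have detE : \det (N + B *m ctr B) = \det N * \det (1%:M + ctr B *m invmx N *m B).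
    rewrite -mulmxA -det_sylvester -det_mulmx mulmxDr mulmx1 !mulmxA mulmxV //.
    by rewrite mul1mx.
  have detS : \det (1%:M + ctr B *m invmx N *m B) = cR (\prod_j (1 + dd j)).
    by rewrite SE det_sylvester mulmxA U2 mul1mx det_1Ddiag.
  have p0 : 0 < \prod_j (1 + dd j) by apply: prodr_gt0.
  rewrite /logdet detE detS mulrC Re_cRM lnM ?posrE ?Re_det_gt0 // addrK.
  have -> : \prod_j (1 + dd j) = expR (\sum_j ln (1 + dd j)).
    by rewrite expR_sum; apply: eq_bigr => j _; rewrite lnK ?posrE.
  by rewrite expRK -sumrN; apply: eq_bigr => j _; rewrite lnV ?posrE // opprK.
Qed.

Lemma dirty_paper_achievable t r1 r2 (G : 'M[C]_(r1, t)) (K : 'M[C]_(r2, t))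
    (Qp Qc : 'M[C]_t) (Pw : R) : psd Qp -> psd Qc -> rtrace Qp + rtrace Qc < Pw ->
  bc_achievable G K Pw
    (logdet (1%:M + G *m (Qp + Qc) *m ctr G) - logdet (1%:M + G *m Qc *m ctr G),
     logdet (1%:M + K *m Qc *m ctr K)).
Proof.
move=> pQp pQc hP.
have [Lp0 QpE] := psd_factor pQp; have [Lc0 QcE] := psd_factor pQc.
have pdG Q : psd Q -> pd (1%:M + G *m Q *m ctr G) by move=> pQ; exact: pdD (pd1 _ _) (psd_conj _ pQ).
have pdK Q : psd Q -> pd (1%:M + K *m Q *m ctr K) by move=> pQ; exact: pdD (pd1 _ _) (psd_conj _ pQ).
(* User 2 sees unit noise only, its interference being cancelled; user 1 treats user 2's signal as
   noise, of covariance 1 + G Qc G^*. *)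
have [U2 [W2 [e2 [UU2 e2p M2 I2]]]] := mmse_estimator (K *m Lc0) (pd1 R r2).
have [U1 [W1 [e1 [UU1 e1p M1 I1]]]] := mmse_estimator (G *m Lp0) (pdG _ pQc).
(* Rotating the factors diagonalises the error covariances and leaves Qp and Qc unchanged. *)
pose Lc := Lc0 *m U2; pose Lp := Lp0 *m U1.
have LcE : Lc *m ctr Lc = Qc by rewrite /Lc ctrM mulmxA -(mulmxA Lc0) UU2 mulmx1.
have LpE : Lp *m ctr Lp = Qp by rewrite /Lp ctrM mulmxA -(mulmxA Lp0) UU1 mulmx1.
have hw1 : wfro (fun j => (e1 j)^-1) (est1 G Lp Lc W1) <= t%:R.
  rewrite (wfro_diag e1p) // -M1 /est1 !ctr_row_mx !mul_row_col !ctrN !mulNmx !mulmxN !opprK.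
  rewrite -addrA; congr (_ + _); first by rewrite /Lp !mulmxA.
  rewrite -LcE mulmxDr mulmxDl mulmx1 addrC; congr (_ + _).
  by rewrite !ctrM !mulmxA.
have hw2 : wfro (fun j => (e2 j)^-1) (est2 K Lc W2) <= t%:R.
  rewrite (wfro_diag e2p) // -M2 /est2 !ctr_row_mx !mul_row_col !ctrN !mulNmx !mulmxN !opprK.
  by rewrite mul0mx add0r mulmx1 /Lc !mulmxA.
have hpow : wfro (fun=> 1) (row_mx Lp Lc) < Pw.
  by rewrite wfro1 ctr_row_mx mul_row_col LcE LpE rtraceD.
have GE : 1%:M + G *m (Qp + Qc) *m ctr G =
    1%:M + G *m Qc *m ctr G + G *m Lp0 *m ctr (G *m Lp0).
  by rewrite mulmxDr mulmxDl [G *m Qp *m _ + _]addrC addrA {1}QpE ctrM !mulmxA.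
have I1E : - \sum_j ln (e1 j) =
    logdet (1%:M + G *m (Qp + Qc) *m ctr G) - logdet (1%:M + G *m Qc *m ctr G).
  by rewrite GE; exact: I1.
have I2E : - \sum_j ln (e2 j) = logdet (1%:M + K *m Qc *m ctr K).
  by rewrite I2 logdet1 subr0 QcE ctrM !mulmxA.
split; last split => /=.
- rewrite /= subr_ge0; apply: logdet_le; [exact: pdG|exact: pdG _ (psdD pQp pQc)|].
  by rewrite GE addrC addKr; exact: psd_gram.
- rewrite -(logdet1 R r2); apply: logdet_le; [exact: pd1|exact: pdK|].
  by rewrite addrC addKr; exact: psd_conj.
- move=> eps eps0; rewrite -I1E -I2E; exact: (dirty_paper_rates e1p e2p hpow hw1 hw2 eps0).
Qed.

End LinearEstimation.

(** * Rate regions *)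

Section SupportFunction.
Variables (R : realType) (mu : R).

Lemma sub_cl_hull (A : set (R * R)) : A `<=` cl_hull A.
Proof.
move=> p Ap; apply: subset_closure; exists 1%N, (fun=> 1), (fun=> p).
rewrite !big_ord1 !mul1r; do !split => //; by case: p Ap.
Qed.

Lemma wmax_ub (S : set (R * R)) p : S p -> ((mu * p.1 + p.2)%:E <= wmax mu S)%E.
Proof. by move=> Sp; apply: ereal_sup_ubound; exists p. Qed.

Lemma le_wmax (S S' : set (R * R)) : S `<=` S' -> (wmax mu S <= wmax mu S')%E.
Proof. by move=> SS; apply: ereal_sup_le => x [p /SS Sp <-]; exists p. Qed.

Lemma cl_hullS (A B : set (R * R)) : A `<=` B -> cl_hull A `<=` cl_hull B.
Proof.
move=> AB; apply: closure_subset => p [k [w [x [w0 [w1 [Ax ->]]]]]].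
by exists k, w, x; do !split => //; move=> j; exact: AB.
Qed.

(** A half-plane is convex and closed, so it contains the closed hull of any set inside it. *)
Lemma wmax_cl_hull_le (A : set (R * R)) (c : R) :
  (forall p, A p -> mu * p.1 + p.2 <= c) -> (wmax mu (cl_hull A) <= c%:E)%E.
Proof.
move=> hA; apply: ge_ereal_sup => _ [p hp <-]; rewrite lee_fin.
pose f (p : R * R) := mu * p.1 + p.2.
have cf : continuous f.
  move=> q; apply: cvgD; last exact: cvg_snd.
  by apply: cvgM; [exact: cvg_cst|exact: cvg_fst].
have cl : closed [set q | f q <= c].
  by apply: (preimage_closed _ (@closed_le R c)) => q _; exact: cf.
have sub : convex_hull2 A `<=` [set q | f q <= c].
  move=> _ [k [w [x [w0 [w1 [Ax ->]]]]]] /=.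
  rewrite /f /= -[c]mul1r -w1 mulr_suml mulr_sumr -big_split /=.
  by apply: ler_sum => j _; rewrite mulrCA -mulrDr ler_wpM2l //; exact: hA.
by have := closure_subset sub hp; rewrite -((closure_id _).1 cl).
Qed.

Lemma lee_ln_approx (x y : \bar R) (k : R) : 0 <= k ->
  (forall s, 0 < s < 1 -> (x <= y + (- k * ln s)%:E)%E) -> (x <= y)%E.
Proof.
move=> k0 h; apply/lee_addgt0Pr => e e0.
have k1 : 0 < k + 1 by rewrite ltr_wpDl.
have s01 : 0 < expR (- (e / (k + 1))) < 1.
  by rewrite expR_gt0 expR_lt1 oppr_lt0 divr_gt0.
apply: le_trans (h _ s01) _; apply: leeD => //; rewrite lee_fin expRK mulrNN.
by rewrite mulrA ler_pdivrMr // mulrC ler_wpM2l ?(ltW e0) // lerDl.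
Qed.

End SupportFunction.

Section OuterRegions.
Variables (R : realType) (npt nct npr ncr : nat).
Local Notation C := R[i].
Variables (Hpp : 'M[C]_(npr, npt)) (Hcp : 'M[C]_(npr, nct)) (Hcc : 'M[C]_(ncr, nct)).
Variables (Pp Pc mu alpha : R).
Hypothesis alpha0 : 0 < alpha.
Local Notation t := (npt + nct)%N.
Local Notation G := (Gmx alpha Hpp Hcp).
Local Notation K := (Kmx npt alpha Hcc).
Local Notation Kb := (Kbarmx alpha Hpp Hcp Hcc).

Let isq_conj r (H : 'M[C]_(r, nct)) S :
  isq alpha *: H *m S *m ctr (isq alpha *: H) = cR alpha^-1 *: (H *m S *m ctr H).
Proof.
rewrite /isq ctrZr -!scalemxAl -scalemxAr scalerA; congr (_ *: _).
by rewrite !cRE -rmorphM /= -invfM -expr2 sqr_sqrtr // ltW.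
Qed.

(* Data processing: user 2 sees the last block of the enhanced output. *)
Lemma enhanced_rate_ge (Qz : 'M[C]_(npr, ncr)) (Qc : 'M[C]_t) : admissible Qz -> psd Qc ->
  logdet (1%:M + K *m Qc *m ctr K) <=
  logdet (Sigmaz Qz + Kb *m Qc *m ctr Kb) - logdet (Sigmaz Qz).
Proof.
move=> aQ pQ; pose D : 'M[C]_(ncr, npr + ncr) := row_mx 0 1%:M.
have DK : D *m Kb = K by rewrite /D /Kbarmx mul_row_col mul0mx mul1mx add0r.
have DS : D *m Sigmaz Qz *m ctr D = 1%:M.
  rewrite /D /Sigmaz mul_row_block !mul0mx !mul1mx !add0r ctr_row_mx ctr0 ctr1.
  by rewrite mul_row_col mulmx0 mulmx1 add0r.
have h0 : psd (1%:M - D *m Sigmaz Qz *m ctr D) by rewrite DS subrr; exact: psd0.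
have := logdet_data_processing aQ (psd_conj Kb pQ) (pd1 R ncr) h0.
have -> : D *m (Kb *m Qc *m ctr Kb) *m ctr D = K *m Qc *m ctr K.
  by rewrite -DK ctrM !mulmxA.
by rewrite logdet1 subr0.
Qed.

Lemma wmax_partout_le (Qz : 'M[C]_(npr, ncr)) : admissible Qz ->
  (wmax mu (Rpartout Hpp Hcp Hcc Pp Pc alpha) <= wmax mu (Rout Hpp Hcp Hcc Pp Pc alpha Qz))%E.
Proof.
move=> aQ; apply/le_wmax/cl_hullS => p [p1 [p2 [Qp [Scc [pQp [pS [hP [h1 h2]]]]]]]].
split; first exact: p1.
split; first exact: p2.
(* E embeds the last nct inputs: the partial region is the case in which user 2's covariance is
   supported on them. *)
pose E : 'M[C]_(t, nct) := col_mx 0 1%:M.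
have EE : ctr E *m E = 1%:M.
  by rewrite /E ctr_col_mx ctr0 ctr1 mul_row_col mul0mx mulmx1 add0r.
have GE : G *m E = isq alpha *: Hcp by rewrite /Gmx /E mul_row_col mulmx0 mulmx1 add0r.
have KE : K *m E = isq alpha *: Hcc by rewrite /Kmx /E mul_row_col mulmx0 mulmx1 add0r.
have pQc := psd_conj E pS.
have GQ : G *m (E *m Scc *m ctr E) *m ctr G = cR alpha^-1 *: (Hcp *m Scc *m ctr Hcp).
  by rewrite -isq_conj -GE ctrM !mulmxA.
have KQ : K *m (E *m Scc *m ctr E) *m ctr K = cR alpha^-1 *: (Hcc *m Scc *m ctr Hcc).
  by rewrite -isq_conj -KE ctrM !mulmxA.
exists Qp, (E *m Scc *m ctr E).
split; first exact: pQp.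
split; first exact: pQc.
split; last split.
- by rewrite -mulmxA rtraceC -mulmxA EE mulmx1.
- by rewrite mulmxDr mulmxDl GQ addrA.
- apply: le_trans h2 _; rewrite -KQ; exact: enhanced_rate_ge.
Qed.

(** The origin belongs to the region; this settles the case of a vanishing multiplier. *)
Lemma partout_ge0 : 0 <= Pp + alpha * Pc ->
  (0%:E <= wmax mu (Rpartout Hpp Hcp Hcc Pp Pc alpha))%E.
Proof.
move=> P0; have -> : 0%:E = (mu * (0 : R, 0 : R).1 + (0 : R, 0 : R).2)%:E.
  by rewrite /= mulr0 addr0.
apply/wmax_ub/sub_cl_hull; split=> //; split=> //; exists 0, 0.
split; first exact: psd0.
split; first exact: psd0.
rewrite !rtrace0 addr0 !mulmx0 !mul0mx !scaler0 !addr0 subrr logdet1 /=.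
by split; [exact: P0|split].
Qed.

End OuterRegions.

(** * The least favourable noise correlation *)

Section WorstNoise.
Variable R : realType.
Local Notation C := R[i].

Lemma scaled_rate_arith (mu a b ls gs gc k gs' gc' k' : R) : 0 <= mu ->
  a * ls + gs <= gs' -> gc' <= gc -> b * ls + k <= k' ->
  mu * (gs - gc) + k <= mu * (gs' - gc') + k' + - (mu * a + b) * ls.
Proof. by move=> mu0 h1 h2 h3; have := ler_wpM2l mu0 (lerB h1 h2); lra. Qed.

Lemma psd_conj_le0 m n (A : 'M[C]_n) (B : 'M[C]_(m, n)) : pd A ->
  rtrace (B *m A *m ctr B) <= 0 -> B = 0.
Proof.
move=> pA h; have [L uL AE] := pd_factor pA.
have BE : B *m A *m ctr B = (B *m L) *m ctr (B *m L) by rewrite AE ctrM !mulmxA.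
have h0 : rtrace ((B *m L) *m ctr (B *m L)) = 0.
  by rewrite -BE; apply/le_anti; rewrite h rtrace_psd //; exact: psd_conj (pd_psd pA).
by rewrite -(mulmxK uL B) (rtrace_gram_eq0 h0) mul0mx.
Qed.

Variables (n r1 r2 : nat) (G : 'M[C]_(r1, n)) (K : 'M[C]_(r2, n)) (mu P : R).
Hypothesis mu1 : 1 <= mu.
Variables (P1 : 'M[C]_r1) (P2 : 'M[C]_r2) (lam : R).
Hypothesis kkt : mac_kkt G K mu P P1 P2 lam.

Let mu10 : 0 <= mu - 1. Proof. by rewrite subr_ge0. Qed.
Let T1 := invmx (mac1 G P1).
Let T := invmx (mac2 G K P1 P2).
Let pT1 : pd T1. Proof. exact/pd_inv/pd_mac1/(kkt_psd1 kkt). Qed.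
Let pT : pd T. Proof. by apply/pd_inv/pd_mac2; [exact: kkt_psd1 kkt|exact: kkt_psd2 kkt]. Qed.

(** With lam = 0 the gradients are positive semidefinite together with their negatives, so their
    traces vanish; T being positive definite, G and K vanish. *)
Lemma kkt_lam0 : lam = 0 -> G = 0 /\ K = 0.
Proof.
move=> l0; have := kkt_grad1 kkt; have := kkt_grad2 kkt.
have cR0 : cR (0 : R) = 0 by [].
rewrite l0 cR0 !scale0r !sub0r => /rtrace_psd h2 /rtrace_psd h1.
move: h2 h1; rewrite !rtraceN !oppr_ge0 rtraceD => h2 h1; split; last exact: psd_conj_le0 h2.
apply: (psd_conj_le0 pT); apply: le_trans h1; rewrite lerDr.
apply: rtrace_psd; apply: psdZ => //; exact: psd_conj (pd_psd pT1).
Qed.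

Hypothesis lam0 : 0 < lam.

Lemma kkt_grad1_mac2 : psd (cR lam *: 1%:M - G *m T *m ctr G).
Proof.
have := psdD (kkt_grad1 kkt) (psdZ mu10 (psd_conj G (pd_psd pT1))).
by rewrite -/T1 -/T opprD addrA addrAC subrK.
Qed.

(** The off-diagonal block of (s / lam) Kb T Kb^*. Subtracting that matrix from [Sigmaz] leaves a
    block diagonal one, and its blocks are the ones controlled by the two gradient conditions. *)
Definition worst_Qz (s : R) : 'M[C]_(r1, r2) := cR (s / lam) *: (G *m T *m ctr K).

Let X1 := cR lam *: 1%:M - G *m T *m ctr G.
Let X2 := cR lam *: 1%:M - K *m T *m ctr K.
Let E1 : 'M[C]_(r1 + r2, r1) := col_mx 1%:M 0.
Let E2 : 'M[C]_(r1 + r2, r2) := col_mx 0 1%:M.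
Let Kb := col_mx G K.

Let worst_SigmazE s : Sigmaz (worst_Qz s) - cR (s / lam) *: (Kb *m T *m ctr Kb) =
  cR (1 - s) *: 1%:M + cR (s / lam) *: (E1 *m X1 *m ctr E1 + E2 *m X2 *m ctr E2).
Proof.
have E1E : E1 *m X1 *m ctr E1 = block_mx X1 0 0 0.
  by rewrite /E1 ctr_col_mx ctr0 ctr1 !mul_col_mx mul1mx !mul0mx !mul_mx_row mulmx1 mulmx0 /block_mx row_mx0.
have E2E : E2 *m X2 *m ctr E2 = block_mx 0 0 0 X2.
  by rewrite /E2 ctr_col_mx ctr0 ctr1 !mul_col_mx mul1mx !mul0mx !mul_mx_row mulmx1 mulmx0 /block_mx row_mx0.
have KE : Kb *m T *m ctr Kb = block_mx (G *m T *m ctr G) (G *m T *m ctr K)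
    (K *m T *m ctr G) (K *m T *m ctr K).
  by rewrite /Kb ctr_col_mx !mul_col_mx !mul_mx_row.
have [hT _] := pT.
have cW : ctr (worst_Qz s) = cR (s / lam) *: (K *m T *m ctr G).
  by rewrite /worst_Qz ctrZr !ctrM ctrK hT !mulmxA.
have sE : cR (1 - s) + cR (s / lam) * cR lam = 1.
  by rewrite !cRE -rmorphM -rmorphD /= mulfVK ?gt_eqF // subrK.
have diag r (Y : 'M[C]_r) : cR (1 - s) *: 1%:M + cR (s / lam) *: (cR lam *: 1%:M - Y) =
    1%:M - cR (s / lam) *: Y.
  by rewrite scalerBr scalerA addrA -scalerDl sE scale1r.
rewrite E1E E2E KE /Sigmaz cW scalar_mx_block add_block_mx !scale_block_mx opp_block_mx.
rewrite !add_block_mx !addr0 !add0r !scaler0 !addr0 !diag.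
by rewrite /worst_Qz !subrr.
Qed.

(** The summand (1 - s) 1 gives strict positivity; the gradient conditions alone would give only a
    semidefinite matrix. *)
Lemma worst_noise s : 0 < s < 1 -> admissible (worst_Qz s) /\
  psd (Sigmaz (worst_Qz s) - cR (s / lam) *: (Kb *m T *m ctr Kb)).
Proof.
move=> /andP[s0 s1]; have sl : 0 <= s / lam by rewrite divr_ge0 // ltW.
have pX : psd (E1 *m X1 *m ctr E1 + E2 *m X2 *m ctr E2).
  by apply: psdD; apply: psd_conj; [exact: kkt_grad1_mac2|exact: kkt_grad2 kkt].
have pB : pd (Sigmaz (worst_Qz s) - cR (s / lam) *: (Kb *m T *m ctr Kb)).
  rewrite worst_SigmazE; apply: pdD (psdZ sl pX); apply: pdZ (pd1 _ _).
  by rewrite subr_gt0.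
split; last exact: pd_psd.
have := pdD pB (psdZ sl (psd_conj Kb (pd_psd pT))).
by rewrite subrK.
Qed.

(* Scaling the covariances by s < 1 leaves the strict power slack needed for coding. *)
Lemma wmax_bc_ge : 0 < P ->
  ((mac_rate G K mu P1 P2)%:E <= wmax mu (closure (bc_achievable G K P)))%E.
Proof.
move=> P0; apply: (@lee_ln_approx _ _ _ (mu * r1%:R + r2%:R)).
  by rewrite addr_ge0 // mulr_ge0 // (le_trans ler01).
move=> s /andP[s0 s1].
rewrite -(bc_rate_mac kkt lam0).
set Qp := bc_Qp _ _ _ _; set Qc := bc_Qc _ _ _ _ _.
have pQp : psd Qp by exact: (psd_bc_Qp mu1 kkt lam0).
have pQc : psd Qc by exact: (psd_bc_Qc kkt lam0).
have pd_out r (H : 'M[C]_(r, n)) Q : psd Q -> pd (1%:M + H *m Q *m ctr H).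
  by move=> pQ; exact: pdD (pd1 _ _) (psd_conj _ pQ).
have ps (Q : 'M[C]_n) : psd Q -> psd (cR s *: Q) by exact: psdZ (ltW s0).
have scale_ge r (H : 'M[C]_(r, n)) Q : psd Q ->
    r%:R * ln s + logdet (1%:M + H *m Q *m ctr H) <= logdet (1%:M + H *m (cR s *: Q) *m ctr H).
  move=> pQ; rewrite -(logdetZ s0 (pd_out _ H _ pQ)).
  apply: logdet_le; [exact: pdZ (pd_out _ _ _ pQ)|exact: pd_out (ps _ pQ)|].
  rewrite -scalemxAr -scalemxAl scalerDr opprD addrACA subrr addr0.
  have -> : 1%:M - cR s *: 1%:M = cR (1 - s) *: (1%:M : 'M[C]_r).
    by rewrite !cRE rmorphB rmorph1 scalerBl scale1r.
  by apply: psdZ (psd1 _ _); rewrite subr_ge0 ltW.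
have scale_le r (H : 'M[C]_(r, n)) Q : psd Q ->
    logdet (1%:M + H *m (cR s *: Q) *m ctr H) <= logdet (1%:M + H *m Q *m ctr H).
  move=> pQ; apply: logdet_le; [exact: pd_out (ps _ pQ)|exact: pd_out|].
  rewrite opprD addrACA subrr add0r -scalemxAr -scalemxAl.
  have -> : H *m Q *m ctr H - cR s *: (H *m Q *m ctr H) = cR (1 - s) *: (H *m Q *m ctr H).
    by rewrite !cRE rmorphB rmorph1 scalerBl scale1r.
  by apply: psdZ (psd_conj _ pQ); rewrite subr_ge0 ltW.
have tr : rtrace (cR s *: Qp) + rtrace (cR s *: Qc) < P.
  have tr0 : rtrace Qp + rtrace Qc = P := rtrace_bc kkt lam0.
  rewrite (rtraceZ s Qp) (rtraceZ s Qc) -mulrDr tr0 -[ltRHS]mul1r ltr_pM2r //; exact: s1.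
have hw : (_ <= wmax mu _)%E :=
  wmax_ub mu (subset_closure (dirty_paper_achievable G K (ps _ pQp) (ps _ pQc) tr)).
have hs : r1%:R * ln s + logdet (1%:M + G *m (Qp + Qc) *m ctr G) <=
    logdet (1%:M + G *m (cR s *: Qp + cR s *: Qc) *m ctr G).
  by rewrite -scalerDr; exact: (scale_ge _ G _ (psdD pQp pQc)).
apply: le_trans (leeD hw (lexx _)); rewrite -EFinD lee_fin.
exact: scaled_rate_arith (le_trans ler01 mu1) hs (scale_le _ G _ pQc) (scale_ge _ K _ pQc).
Qed.

End WorstNoise.

Theorem theorem3 (R : realType) (npt nct npr ncr : nat)
  (Hpp : 'M[R[i]]_(npr, npt)) (Hcp : 'M[R[i]]_(npr, nct)) (Hcc : 'M[R[i]]_(ncr, nct))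
  (Pp Pc mu alpha : R) :
  0 < Pp -> 0 < Pc -> 1 <= mu -> 0 < alpha ->
  wmax mu (Rpartout Hpp Hcp Hcc Pp Pc alpha) = wmax mu (CBC Hpp Hcp Hcc Pp Pc alpha) ->
  wmax mu (Rpartout Hpp Hcp Hcc Pp Pc alpha) =
  ereal_inf [set wmax mu (Rout Hpp Hcp Hcc Pp Pc alpha Qz) |
             Qz in [set Qz : 'M[R[i]]_(npr, ncr) | admissible Qz]].
Proof.
move=> Pp0 Pc0 mu1 alpha0 hyp; have mu0 : 0 <= mu := le_trans ler01 mu1.
pose P := Pp + alpha * Pc; have P0 : 0 < P by rewrite addr_gt0 // mulr_gt0.
pose G := Gmx alpha Hpp Hcp; pose K := Kmx npt alpha Hcc.
apply/le_anti/andP; split.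
  by apply: le_ereal_inf_tmp => _ [Qz aQz <-]; exact: wmax_partout_le.
have [P1 [P2 opt]] := mac_optimal_exists G K mu P0.
have [lam kkt] := mac_optimal_kkt mu1 P0 opt.
have inf_le c (Qz : 'M[R[i]]_(npr, ncr)) : admissible Qz ->
    (forall Qp Qc, psd Qp -> psd Qc -> rtrace Qp + rtrace Qc <= P ->
      mu * (logdet (1%:M + G *m (Qp + Qc) *m ctr G) - logdet (1%:M + G *m Qc *m ctr G)) +
      (logdet (Sigmaz Qz + col_mx G K *m Qc *m ctr (col_mx G K)) - logdet (Sigmaz Qz)) <= c) ->
    (ereal_inf [set wmax mu (Rout Hpp Hcp Hcc Pp Pc alpha Qz) |
             Qz in [set Qz : 'M[R[i]]_(npr, ncr) | admissible Qz]] <= c%:E)%E.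
  move=> aQz hc; apply: (@le_trans _ _ (wmax mu (Rout Hpp Hcp Hcc Pp Pc alpha Qz))).
    by apply: ereal_inf_lbound; exists Qz.
  apply: wmax_cl_hull_le => p [_ [_ [Qp [Qc [pQp [pQc [hP [h1 h2]]]]]]]].
  exact: le_trans (lerD (ler_wpM2l mu0 h1) h2) (hc Qp Qc pQp pQc hP).
have lam_ge0 := kkt_ge0 kkt.
have /orP[/eqP lamE|lam0] : (0 == lam) || (0 < lam) by rewrite -le_eqVlt.
  (* Both channel matrices vanish, so uncorrelated noise bounds the infimum by 0, which the origin
     attains. *)
  have [G0 K0] := kkt_lam0 mu1 kkt (esym lamE).
  apply: le_trans (partout_ge0 Hpp Hcp Hcc mu (ltW P0)).
  have S0 : Sigmaz (0 : 'M[R[i]]_(npr, ncr)) = 1%:M by rewrite /Sigmaz ctr0 -scalar_mx_block.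
  apply: (inf_le _ 0); first by rewrite /admissible S0; exact: pd1.
  move=> Qp Qc _ _ _; rewrite G0 K0 S0 col_mx0 !mul0mx !addr0 !subrr mulr0 addr0.
  exact: lexx.
rewrite hyp; apply: le_trans (wmax_bc_ge mu1 kkt lam0 P0).
apply: (@lee_ln_approx _ _ _ (npt + nct)%:R) => // s s01.
have [aQ pS] := worst_noise mu1 kkt lam0 s01.
rewrite -EFinD; apply: (inf_le _ _ aQ) => Qp Qc pQp pQc hP.
have s1 : 0 < s <= 1 by case/andP: s01 => -> /ltW.
rewrite mulNr; exact: (outer_rate_le mu1 kkt lam0 s1 aQ pS pQp pQc hP).
Qed.
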